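(* Let $k$ be a positive integer and let $\tilde L_n^{k,k}(e^x)=1+\sum_{d\ge1}\tilde L_n^{k,k,d}e^{dx}$ $(n=0,\dots,k-1)$ be the generating functions of the virtual structure constants with $N=k$. Then for every function $w(x)$, $$\frac1{\tilde L_0^{k,k}(e^x)}\partial_x\Bigl(\frac1{\tilde L_1^{k,k}(e^x)}\partial_x\Bigl(\cdots\partial_x\Bigl(\frac1{\tilde L_{k-2}^{k,k}(e^x)}\partial_x\Bigl(\frac1{\tilde L_{k-1}^{k,k}(e^x)}w(x)\Bigr)\Bigr)\cdots\Bigr)\Bigr)$$ $$=\Bigl((\partial_x)^{k-1}-k\,e^x(k\partial_x+k-1)\cdots(k\partial_x+2)(k\partial_x+1)\Bigr)w(x).$$
   Context: **Virtual structure constants.** Fix $k$. The rational numbers $\tilde L_n^{N,k,d}$ ($N,n\in{\bf Z}$, $d\ge1$) are defined by descending recursion on $N$. For $N\ge2k$: $\tilde L_n^{N,k,1}$ is given by $\sum_{n=0}^{k-1}\tilde L_n^{N,k,1}w^n=k\prod_{j=1}^{k-1}(jw+(k-j))$ (and $\tilde L_n^{N,k,1}=0$ for $n\notin\{0,\dots,k-1\}$), and $\tilde L_n^{N,k,d}=0$ for $d\ge2$. For $N<2k$: $\tilde L_n^{N,k,d}=\phi_n^{N,k}(Poly_d)$, where $\phi_n^{N,k}$ is the ${\bf Q}$-linear map on homogeneous polynomials of degree $d-1$ in $x,y,z_1,\dots,z_{d-1}$ with $$\phi_n^{N,k}\bigl(x^{d_{i_0}}z_{i_1}^{d_{i_1}}\cdots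 z_{i_{l-1}}^{d_{i_{l-1}}}y^{d_{i_l}}\bigr)=\prod_{j=1}^l\tilde L_{n+\delta_j}^{N+1,k,i_j-i_{j-1}} .$$ Here each monomial is written uniquely with $0=i_0<i_1<\cdots<i_l=d$, $d_{i_j}\ge1$ for $1\le j\le l-1$, $d_{i_0},d_{i_l}\ge0$, $\sum_{j=0}^ld_{i_j}=d-1$, and $\delta=(\delta_1,\dots,\delta_l)=\alpha+\beta+\gamma+\sum_{j=1}^{l-1}(d_{i_j}-1)\epsilon_j+d_{i_l}\epsilon_l\in{\bf Z}^l$ with $\alpha=(l-d,\dots,l-d)$, $\beta=(0,i_1-1,i_2-2,\dots,i_{l-1}-l+1)$, $\gamma=(0,i_1(N-k),\dots,i_{l-1}(N-k))$, $\epsilon_j=(1,\dots,1,0,\dots,0)$ ($j$ ones). The number $\tilde L_n^{N,k,d}$ vanishes unless $0\le n\le N-1-(N-k)d$. **The polynomial $Poly_d$.** With $u_0=x$, $u_d=y$, $$Poly_d(x,y,z_1,\dots,z_{d-1})=\frac{d}{(2\pi\sqrt{-1})^{d-1}}\int_{D_1}du_1\cdots\int_{D_{d-1}}du_{d-1}\prod_{j=1}^{d-1}\frac{u_j^2}{(2u_j-u_{j-1}-u_{j+1})(u_j-z_j)},$$ where $D_j$ goes around both poles $u_j=\frac{u_{j-1}+u_{j+1}}2$ and $u_j=z_j$. Concretely, take counterclockwise circles $|u_j|=R_j$ with $R_j>|z_j|$ and $2R_j>R_{j-1}+R_{j+1}$, where $R_0=|x|$, $R_d=|y|$. It is a homogeneous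 polynomial of degree $d-1$, and $Poly_1=1$. The identity is to be read as an identity of differential operators whose coefficients are power series in $e^x$. *)

(* Defs.v *)
From HB Require Import structures.
From mathcomp Require Import all_boot all_order all_algebra.
From mathcomp Require Import complex mpoly.
From mathcomp Require Import boolp classical_sets reals trigo.
From mathcomp Require Import measure lebesgue_measure lebesgue_integral.

Set Implicit Arguments.
Unset Strict Implicit.
Unset Printing Implicit Defensive.

Import Order.TTheory GRing.Theory Num.Theory.

Local Open Scope ring_scope.

(* Formal power series in q = e^x over a field: [f n] is the coefficient of   *)
(* q^n.                                                                       *)
Definition fps (F : fieldType) : Type := nat -> F.

Section PowerSeriesRing.
Variable F : fieldType.
Implicit Types (a b c : fps F) (n m : nat).

HB.instance Definition _ := Choice.copy (fps F) (nat -> F).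

Definition fps_add a b : fps F := fun n => a n + b n.
Definition fps_opp a : fps F := fun n => - a n.
Definition fps_const (x : F) : fps F := fun n => if n == 0%N then x else 0.
Definition fps_mul a b : fps F := fun n => \sum_(i < n.+1) a i * b (n - i)%N.

Fact fps_addA : associative fps_add.
Proof. by move=> a b c; apply/funext => n; exact: addrA. Qed.
Fact fps_addC : commutative fps_add.
Proof. by move=> a b; apply/funext => n; exact: addrC. Qed.
Fact fps_add0 : left_id (fps_const 0) fps_add.
Proof.
by move=> a; apply/funext => n; rewrite /fps_add /fps_const if_same add0r.
Qed.
Fact fps_addN : left_inverse (fps_const 0) fps_opp fps_add.
Proof.
move=> a; apply/funext => n.
by rewrite /fps_add /fps_opp /fps_const if_same addNr.
Qed.

HB.instance Definition _ :=
  GRing.isZmodule.Build (fps F) fps_addA fps_addC fps_add0 fps_addN.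

Let trunc m a : {poly F} := \poly_(i < m) a i.

Let fps_mulE m a b n : (n < m)%N -> fps_mul a b n = (trunc m a * trunc m b)`_n.
Proof.
move=> lt_nm; rewrite coefM; apply: eq_bigr => i _; rewrite !coef_poly.
by rewrite (leq_ltn_trans (leq_subr _ _) lt_nm) (leq_trans (ltn_ord i) lt_nm).
Qed.

Let trunc_coefMl m a b (p : {poly F}) n : (n < m)%N ->
  (trunc m (fps_mul a b) * p)`_n = (trunc m a * trunc m b * p)`_n.
Proof.
move=> lt_nm; rewrite !coefM; apply: eq_bigr => i _; congr (_ * _).
have lt_im : (i < m)%N by exact: leq_trans (ltn_ord i) lt_nm.
by rewrite coef_poly lt_im (fps_mulE _ _ lt_im).
Qed.

Fact fps_mulC : commutative fps_mul.
Proof.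
by move=> a b; apply/funext => n; rewrite !(fps_mulE _ _ (ltnSn n)) mulrC.
Qed.
Fact fps_mulA : associative fps_mul.
Proof.
move=> a b c; apply/funext => n.
rewrite (fps_mulC a) !(fps_mulE _ _ (ltnSn n)) !(trunc_coefMl _ _ _ (ltnSn n)).
by rewrite mulrC mulrA.
Qed.
Fact fps_mul1 : left_id (fps_const 1) fps_mul.
Proof.
move=> a; apply/funext => n; rewrite /fps_mul big_ord_recl subn0 mul1r.
by rewrite big1 ?addr0 // => i _; rewrite mul0r.
Qed.
Fact fps_mulDl : left_distributive fps_mul fps_add.
Proof.
move=> a b c; apply/funext => n; rewrite /fps_mul /fps_add -big_split.
by apply: eq_bigr => i _; rewrite mulrDl.
Qed.
Fact fps_one_neq0 : fps_const 1 != 0.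
Proof.
by apply/negP => /eqP/(congr1 (fun a => a 0%N))/eqP; rewrite /= oner_eq0.
Qed.

HB.instance Definition _ := GRing.Zmodule_isComNzRing.Build (fps F)
  fps_mulA fps_mulC fps_mul1 fps_mulDl fps_one_neq0.

Lemma fpsD a b n : (a + b) n = a n + b n. Proof. by []. Qed.
Lemma fpsN a n : (- a) n = - a n. Proof. by []. Qed.
Lemma fpsM a b n : (a * b) n = \sum_(i < n.+1) a i * b (n - i)%N.
Proof. by []. Qed.
Lemma fps0 n : (0 : fps F) n = 0.
Proof. by rewrite -[LHS]/(fps_const 0 n) /fps_const if_same. Qed.
Lemma fps1 n : (1 : fps F) n = (n == 0%N)%:R. Proof. by case: n. Qed.

Lemma fps_sum (I : Type) (r : seq I) (P : pred I) (f : I -> fps F) n :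
  (\sum_(i <- r | P i) f i) n = \sum_(i <- r | P i) f i n.
Proof.
elim: r => [|i r IHr]; first by rewrite !big_nil fps0.
by rewrite !big_cons; case: ifP; rewrite // fpsD IHr.
Qed.

Definition fps_unit : pred (fps F) := fun a => a 0%N != 0.

(* For a 0 != 0 the inverse is the geometric series                          *)
(* (a 0)^-1 * \sum_i t^i with t = 1 - (a 0)^-1 * a, whose terms of index > n *)
(* do not contribute to the coefficient of q^n.                              *)
Definition fps_inv a : fps F :=
  if fps_unit a then
    fun n => (fps_const (a 0%N)^-1 *
              \sum_(i < n.+1) (1 - fps_const (a 0%N)^-1 * a) ^+ i) n
  else a.

Let fps_exp_small (t : fps F) m n : t 0%N = 0 -> (n < m)%N -> (t ^+ m) n = 0.
Proof.
move=> t0; elim: m n => // m IHm n lt_nm; rewrite exprS fpsM big1 // => i _.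
case: (posnP i) => [->|i_gt0]; first by rewrite t0 mul0r.
rewrite IHm ?mulr0 //; have := ltn_ord i => lt_in.
by rewrite -ltnS (leq_trans _ lt_nm)// ltnS ltn_subrL i_gt0 (leq_trans i_gt0).
Qed.

Fact fps_mulVf : {in fps_unit, left_inverse 1 fps_inv *%R}.
Proof.
move=> a; rewrite unfold_in => a0; apply/funext => n.
set t := 1 - fps_const (a 0%N)^-1 * a.
have t0 : t 0%N = 0.
  rewrite /t fpsD fpsN fpsM big_ord1 fps1 /= /fps_const /=.
  by rewrite mulVf ?subrr.
pose S m : fps F := \sum_(i < m) t ^+ i.
have S_stable m p : (p <= n)%N -> (p < m)%N -> S m p = S n.+1 p.
  move=> le_pn lt_pm; rewrite /S !fps_sum.
  have aux j : (p < j)%N ->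
      \sum_(i < j) (t ^+ i) p = \sum_(i < p.+1) (t ^+ i) p.
    move=> lt_pj; rewrite -!(big_mkord xpredT (fun i => (t ^+ i) p)).
    rewrite (big_cat_nat (leq0n p.+1) lt_pj)/= [X in _ + X]big_nat_cond.
    rewrite [X in _ + X]big1 ?addr0//.
    by move=> i /andP[/andP[lt_pi _] _]; exact: fps_exp_small.
  by rewrite (aux m)// (aux n.+1).
have invE p : (p <= n)%N -> fps_inv a p = (fps_const (a 0%N)^-1 * S n.+1) p.
  move=> le_pn; rewrite /fps_inv /fps_unit a0 -/t -/(S p.+1) !fpsM.
  apply: eq_bigr => i _; congr (_ * _); rewrite (S_stable p.+1)//.
    by rewrite (leq_trans (leq_subr _ _)).
  by rewrite ltnS leq_subr.
have -> : (fps_inv a * a) n = (fps_const (a 0%N)^-1 * S n.+1 * a) n.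
  by rewrite !fpsM; apply: eq_bigr => i _; rewrite invE// -ltnS ltn_ord.
have -> : fps_const (a 0%N)^-1 * S n.+1 * a = 1 - t ^+ n.+1.
  rewrite mulrAC; have -> : fps_const (a 0%N)^-1 * a = 1 - t.
    by rewrite /t opprB addrC subrK.
  by rewrite -[in RHS](expr1n _ n.+1) subrXX; congr (_ * _);
     apply: eq_bigr => i _; rewrite expr1n mul1r.
by rewrite fpsD fpsN fps_exp_small// subr0.
Qed.

Fact fps_unitP a b : b * a = 1 -> fps_unit a.
Proof.
move=> /(congr1 (fun c => c 0%N)); rewrite fpsM big_ord1 subnn fps1 /= => ba1.
by apply/eqP => a0; move/eqP: ba1; rewrite a0 mulr0 eq_sym oner_eq0.
Qed.

Fact fps_inv_out : {in [predC fps_unit], fps_inv =1 id}.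
Proof.
move=> a na; have /negbTE nu : ~~ fps_unit a by exact: na.
by rewrite /fps_inv nu.
Qed.

HB.instance Definition _ := GRing.ComNzRing_hasMulInverse.Build (fps F)
  fps_mulVf fps_unitP fps_inv_out.

Lemma fps_unitE a : (a \is a GRing.unit) = (a 0%N != 0). Proof. by []. Qed.

Definition fps_q : fps F := fun n => (n == 1%N)%:R.

(* The derivation d/dx on power series in q = e^x.                            *)
Definition fps_theta a : fps F := fun n => n%:R * a n.

End PowerSeriesRing.

Section PolyD.
Variable R : realType.
Implicit Types (d : nat) (u v : nat -> R[i]) (rho : nat -> R).

Definition circle_pt (r t : R) : R[i] := ((r * cos t) +i* (r * sin t))%C.

(* \oint_{|s| = r} f(s) ds, counterclockwise: s = r e^{it}, ds = i s dt.      *)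
Definition circle_int (r : R) (f : R[i] -> R[i]) : R[i] :=
  let g t := f (circle_pt r t) * ('i%C * circle_pt r t) in
  Complex (\int[lebesgue_measure]_(t in `[0, 2 * pi]%classic) complex.Re (g t))
          (\int[lebesgue_measure]_(t in `[0, 2 * pi]%classic) complex.Im (g t)).

(* \oint_{|u_1| = rho_1} du_1 ... \oint_{|u_m| = rho_m} du_m f(u); the values *)
(* of u outside of the indices 1, ..., m are left unchanged.                  *)
Fixpoint iter_circle_int (m : nat) rho (f : (nat -> R[i]) -> R[i]) u : R[i] :=
  if m is m'.+1 then
    iter_circle_int m' rho
      (fun u' => circle_int (rho m) (fun s => f [eta u' with m |-> s])) u
  else f u.

(* The arguments (x, z_1, ..., z_{d-1}, y) of Poly_d are indexed from 0 to d: *)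
(* v 0 = x, v d = y, and v j = z_j for 0 < j < d.                             *)
Definition virt_poly_radii d v rho : Prop :=
  [/\ (rho 0%N)%:C%C = `|v 0%N|, (rho d)%:C%C = `|v d| &
      forall j, (0 < j < d)%N ->
        `|v j| < (rho j)%:C%C /\ rho j.-1 + rho j.+1 < 2 * rho j].

Definition virt_poly_integrand d v u : R[i] :=
  \prod_(1 <= j < d)
    (u j ^+ 2 / ((2 * u j - u j.-1 - u j.+1) * (u j - v j))).

(* The integration variables are u_1, ..., u_{d-1}; starting from u := v sets *)
(* u_0 = x and u_d = y.                                                       *)
Definition virt_poly_int d v rho : R[i] :=
  d%:R / (2 * pi%:C%C * 'i%C) ^+ d.-1 *
  iter_circle_int d.-1 rho (virt_poly_integrand d v) v.

Definition is_virt_poly d (p : {mpoly rat[d.+1]}) : Prop :=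
  forall v rho, virt_poly_radii d v rho ->
    (map_mpoly (@ratr R[i]) p).@[fun i : 'I_d.+1 => v i] =
    virt_poly_int d v rho.

(* Poly_d for d >= 1: the polynomial with rational coefficients (unique, as it *)
(* is determined by its values) that represents the integral.                 *)
Definition virt_poly d : {mpoly rat[d.+1]} :=
  xget 0 [set p | is_virt_poly p]%classic.

End PolyD.

Section StructureConstants.
Variables (R : realType) (k : nat).
Implicit Types (N n : int) (d : nat).

(* [:: i_0; i_1; ...; i_l], with i_0 = 0, i_l = d, and in between the indices *)
(* of the variables z_j that occur in the monomial m.                         *)
Definition mnm_nodes d (m : 'X_{1..d.+1}) : seq nat :=
  0%N :: rcons [seq j <- iota 1 d.-1 | (0 < m (inord j))%N] d.

Definition mnm_len d (m : 'X_{1..d.+1}) : nat := (size (mnm_nodes m)).-1.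

Definition mnm_node d (m : 'X_{1..d.+1}) (j : nat) : nat :=
  nth 0%N (mnm_nodes m) j.

(* The component delta_p for 1 <= p <= l; the last two lines are the          *)
(* p-th components of the multiples of the vectors epsilon_j, that is, the    *)
(* terms with j >= p.                                                         *)
Definition mnm_delta N d (m : 'X_{1..d.+1}) (p : nat) : int :=
  let l := mnm_len m in
  (l%:Z - d%:Z)
  + ((mnm_node m p.-1)%:Z - (p.-1)%:Z)
  + (mnm_node m p.-1)%:Z * (N - k%:Z)
  + \sum_(p <= j < l) ((m (inord (mnm_node m j)))%:Z - 1)
  + (m (inord d))%:Z.

(* phi_n^{N,k}, where L n d stands for L_n^{N+1,k,d}.                         *)
Definition vsc_phi (L : int -> nat -> rat) N n d
    (p : {mpoly rat[d.+1]}) : rat :=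
  \sum_(m <- msupp p) p@_m *
    \prod_(1 <= j < (mnm_len m).+1)
      L (n + mnm_delta N m j) (mnm_node m j - mnm_node m j.-1)%N.

Definition vsc_init n d : rat :=
  if (d == 1%N) && (0 <= n) then
    (k%:R *: \prod_(1 <= j < k) (j%:R *: 'X + (k - j)%:R%:P) : {poly rat})`_`|n|
  else 0.

(* The recursion index is e = max (2k - N) 0.                                 *)
Fixpoint vsc_rec (e : nat) n d : rat :=
  if e is e'.+1 then vsc_phi (vsc_rec e') ((2 * k)%:Z - e%:Z) n (virt_poly R d)
  else vsc_init n d.

(* The virtual structure constants L_n^{N,k,d}.                               *)
Definition vsc N n d : rat :=
  vsc_rec (if N < (2 * k)%:Z then `|(2 * k)%:Z - N|%N else 0%N) n d.

Lemma vsc_ge N n d : (2 * k)%:Z <= N -> vsc N n d = vsc_init n d.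
Proof. by rewrite /vsc ltNge => ->. Qed.

Lemma vsc_lt N n d : N < (2 * k)%:Z ->
  vsc N n d = vsc_phi (vsc (N + 1)) N n (virt_poly R d).
Proof.
move=> ltN; rewrite {1}/vsc ltN.
have [e eE] : exists e, (2 * k)%:Z - N = e.+1%:Z.
  move: (ltN); rewrite -subr_gt0; case: (_ - N) => // -[//|e] _.
  by exists e.
have NE : N = (2 * k)%:Z - e.+1%:Z by rewrite -eE opprB addrC subrK.
suff -> : vsc (N + 1) = vsc_rec e by rewrite eE absz_nat /= -NE.
apply/funext => n'; apply/funext => d'; rewrite /vsc.
have -> : (2 * k)%:Z - (N + 1) = e%:Z.
  by rewrite opprD addrA eE -addn1 PoszD addrK.
case: ifPn => [//|]; rewrite -leNgt -subr_le0.
have -> : (2 * k)%:Z - (N + 1) = e%:Z.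
  by rewrite opprD addrA eE -addn1 PoszD addrK.
by rewrite lez_nat leqn0 => /eqP ->.
Qed.

(* The generating function L_n^{k,k}(q) = 1 + \sum_(d >= 1) L_n^{k,k,d} q^d.  *)
Definition vsc_gen (n : nat) : fps rat :=
  fun d => if d == 0%N then 1 else vsc k%:Z n%:Z d.

End StructureConstants.

(* Main.v *)
(* Write E(x, y) = k \prod_(0 < j < k) (j x + (k - j) y), kap_j = 2 u_j -      *)
(* u_(j-1) - u_(j+1), and CT for the constant term on a torus |u_j| = rho_j    *)
(* with rho concave, where u_j / kap_j expands as a geometric series. The      *)
(* product u_1 ... u_(d-1) is a rational combination of products in which      *)
(* each u_j either is absent or carries kap_j and a power of u_j; integrating  *)
(* these evaluates Poly_d, and inserting them in the integrand below turns     *)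
(* the recursion in N into the closed form                                     *)
(*   L_n^{N,k,d} = d CT(u_0^(-n) u_d^(n-D) \prod_(0 <= i < d) E(u_i, u_(i+1))  *)
(*                      \prod_(0 < i < d) u_i^(2-N) / kap_i),                  *)
(* with D = N - 1 - (N - k) d, the base case N = 2k holding by a degree count. *)
(* For N = k, the partial applications of the left-hand side to e^(tx) have    *)
(* coefficients given by similar constant terms with poles at u_p = t + T - p; *)
(* the linear relation between the shifted variables u_p - (t + T - p) and     *)
(* the kernels kap_j is the recursion which defines these coefficients. At     *)
(* the last step all of them vanish by a degree count, except those of q^0 and *)
(* q^1, which are t^(k-1) and -E(t+1, t), as for the right-hand side. Two      *)
(* operators which agree on e^(tx) for all positive integers t are equal.      *)
Require Import Defs.
From mathcomp Require Import all_boot all_order all_algebra.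
From mathcomp Require Import complex mpoly.
From mathcomp Require Import boolp classical_sets reals trigo.
From mathcomp Require Import ereal normedtype sequences realfun derive ftc.
From mathcomp Require Import measure lebesgue_measure lebesgue_integral.
From mathcomp Require Import ring lra zify.

Set Implicit Arguments.
Unset Strict Implicit.
Unset Printing Implicit Defensive.

Import Order.TTheory GRing.Theory Num.Theory.
Import numFieldNormedType.Exports.

Local Open Scope ring_scope.

(** * Circle integrals and constant terms *)

(** Both sides are differential operators over the power series in [q = e^x], so it suffices to
    compare them on [e^(tx)] for all positive integers [t]. There d/dx multiplies the coefficient of
    [q^g] by [t + g], and division by the series of index [n] is a triangular recursion whose
    coefficients are structure constants. The proof solves this recursion by constant terms on a
    torus.

    Structure constants: on a torus with strictly concave radii the kernels [u_j / kap_j] are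
    geometric series, and constant terms vanish for degree reasons ([ct_deg0]) or factor at a shared
    variable ([ct_mul]). A run of kernels across a gap of length [g] contributes [1/g] ([ct_gap]), a
    node contributes its value ([ct_zeta]), and together these evaluate every term of the normal
    form of [u_1 ... u_(d-1)] ([prod_normal_form], [ct_chain]). This makes [Poly_d] explicit
    ([virt_polyE]). Passing from [N + 1] to [N] multiplies the integrand by those same inner
    variables; the normal form cuts it into blocks at the nodes, the gap lengths cancel, and
    [closed_form] follows by induction on [2k - N].

    Left-hand side: for [N = k] the partial applications to [e^(tx)] have the coefficients
    [- resV n p]. Since [hh] is affine and the kernels are second differences, [u_p - hh p] is a
    combination of its analogues at the last two positions and of the [kap_j]. This is [kerA_split];
    its constant term [resV_rec] is the required recursion. It starts from [resV_k] and ends with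
    [resV_0] and [resV_01], which leave exactly the coefficients of the right-hand side
    ([virt_op_eval]). A root count ([poly_fps_eq0]) turns this into an identity of operators. *)

Section CircleIntegral.
Variable R : realType.
Local Notation C := R[i].
Local Notation mu := (@lebesgue_measure R).
Implicit Types (g h : R -> C) (f : C -> C) (r t : R).

Definition cint g : C :=
  Complex (\int[mu]_(t in `[0, 2 * pi]%classic) complex.Re (g t))
          (\int[mu]_(t in `[0, 2 * pi]%classic) complex.Im (g t)).

Definition ccont g : Prop :=
  continuous (fun t => complex.Re (g t)) /\ continuous (fun t => complex.Im (g t)).

Lemma normc_ge_Im (x : C) : `|complex.Im x|%:C%C <= `|x|.
Proof.
have := normc_ge_Re (x * 'i%C); rewrite normrM.
have -> : `|'i%C : C| = 1 by rewrite normc_def /= expr0n expr1n add0r sqrtr1.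
by rewrite mulr1; case: x => a b /=; rewrite mulr0 mulr1 sub0r normrN.
Qed.

Lemma Re_le_real (x : C) (e : R) : `|x| <= e%:C%C -> `|complex.Re x| <= e.
Proof. by move=> H; rewrite -lecR; apply: le_trans H; exact: normc_ge_Re. Qed.

Lemma Im_le_real (x : C) (e : R) : `|x| <= e%:C%C -> `|complex.Im x| <= e.
Proof. by move=> H; rewrite -lecR; apply: le_trans H; exact: normc_ge_Im. Qed.

Lemma continuous_unif_lim (a : R -> R) :
  (forall e : R, 0 < e ->
    exists2 b : R -> R, continuous b & forall t, `|a t - b t| <= e) ->
  continuous a.
Proof.
move=> H t; apply/cvgrPdist_le => e e0.
have e3 : 0 < e / 3 by rewrite divr_gt0.
have [b bc ab] := H _ e3.
have /cvgrPdist_le /(_ _ e3) := bc t.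
apply: filterS => s bs.
have -> : a t - a s = (a t - b t) + (b t - b s) + (b s - a s) by ring.
have -> : e = e / 3 + e / 3 + e / 3 by field.
apply: (le_trans (ler_normD _ _)); apply: lerD; last by rewrite distrC.
by apply: (le_trans (ler_normD _ _)); apply: lerD.
Qed.

(** The integrands below are known only as uniform limits of Laurent polynomials; this is how they
    become continuous, hence integrable. *)
Lemma ccont_unif_lim g :
  (forall e : R, 0 < e ->
    exists2 h, ccont h & forall t, `|g t - h t| <= e%:C%C) ->
  ccont g.
Proof.
move=> H; split; apply: continuous_unif_lim => e e0;
  have [h [hr hi] gh] := H _ e0.
- exists (fun t => complex.Re (h t)) => // t.
  by have := Re_le_real (gh t); rewrite raddfB.
- exists (fun t => complex.Im (h t)) => // t.
  by have := Im_le_real (gh t); rewrite raddfB.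
Qed.

Let twopi_gt0 : 0 < 2 * pi :> R. Proof. by rewrite mulr_gt0 ?pi_gt0. Qed.

Lemma cont_integrable (a : R -> R) : continuous a ->
  mu.-integrable `[0, 2 * pi]%classic (EFin \o a).
Proof.
move=> ac; apply: continuous_compact_integrable; first exact: segment_compact.
by apply: continuous_subspaceT.
Qed.

Let meas_I : measurable (`[0, 2 * pi]%classic : set (measurableTypeR R)).
Proof. exact: measurable_itv. Qed.

Lemma cintB g h : ccont g -> ccont h ->
  cint (fun t => g t - h t) = cint g - cint h.
Proof.
move=> [gr gi] [hr hi]; rewrite /cint.
under eq_Rintegral do rewrite raddfB.
under [X in Complex _ X]eq_Rintegral do rewrite raddfB.
by rewrite !RintegralB //; exact: cont_integrable.
Qed.

Lemma cintD g h : ccont g -> ccont h ->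
  cint (fun t => g t + h t) = cint g + cint h.
Proof.
move=> [gr gi] [hr hi]; rewrite /cint.
under eq_Rintegral do rewrite raddfD.
under [X in Complex _ X]eq_Rintegral do rewrite raddfD.
by rewrite !RintegralD //; exact: cont_integrable.
Qed.

Lemma Rint_cst (e : R) :
  \int[mu]_(t in `[0, 2 * pi]%classic) e = 2 * pi * e.
Proof.
rewrite Rintegral_cst //.
rewrite [X in e * fine X](_ : _ = (2 * pi)%:E) /=; first by rewrite mulrC.
by rewrite [LHS]lebesgue_measure_itv /= lte_fin twopi_gt0 -EFinB subr0.
Qed.

Lemma Rint_le (a : R -> R) (e : R) : continuous a -> (forall t, `|a t| <= e) ->
  `|\int[mu]_(t in `[0, 2 * pi]%classic) a t| <= 2 * pi * e.
Proof.
move=> ac ae; apply: (le_trans (le_normr_Rintegral _ _)) => //.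
  exact: cont_integrable.
apply: (@le_trans _ _ (\int[mu]_(t in `[0, 2 * pi]%classic) e)).
  apply: le_Rintegral => //; apply: cont_integrable.
  - by move=> t; apply: cvg_norm; exact: ac.
  - by move=> t; exact: cvg_cst.
by rewrite Rint_cst.
Qed.

(** Real and imaginary parts are estimated separately. The constant is twice the sharp one, which is
    harmless because only convergence matters. *)
Lemma cint_le g (e : R) : ccont g -> (forall t, `|g t| <= e%:C%C) ->
  `|cint g| <= (4 * pi * e)%:C%C.
Proof.
move=> [gr gi] ge.
have -> : cint g =
    (complex.Re (cint g))%:C%C + 'i%C * (complex.Im (cint g))%:C%C.
  by rewrite -complexE.
apply: (le_trans (ler_normD _ _)).
have -> : (4 * pi * e)%:C%C = (2 * pi * e)%:C%C + (2 * pi * e)%:C%C :> C.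
  by rewrite -rmorphD /=; congr _%:C%C; ring.
have nC (x : R) : `|x%:C%C : C| = `|x|%:C%C.
  by rewrite normc_def /= expr0n addr0 sqrtr_sqr.
apply: lerD.
  by rewrite nC lecR; apply: Rint_le => // t; exact: Re_le_real.
rewrite normrM.
have -> : `|'i%C : C| = 1 by rewrite normc_def /= expr0n expr1n add0r sqrtr1.
by rewrite mul1r nC lecR; apply: Rint_le => // t; exact: Im_le_real.
Qed.

Lemma cintZ (c : C) g : ccont g -> cint (fun t => c * g t) = c * cint g.
Proof.
move=> [gr gi]; case: c => a b.
have cM (x : R) (h : R -> R) : continuous h -> continuous (fun t => x * h t).
  by move=> hc t; apply: cvgM; [exact: cvg_cst | exact: hc].
have E : (fun t => (a +i* b)%C * g t) =
  (fun t => Complex (a * complex.Re (g t) - b * complex.Im (g t))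
                    (a * complex.Im (g t) + b * complex.Re (g t))).
  by apply/funext => t; case: (g t) => x y; simpc.
have I (x : R) (h : R -> R) : continuous h ->
    mu.-integrable `[0, 2 * pi]%classic (EFin \o (fun t => x * h t)).
  by move=> hc; apply: cont_integrable; exact: cM.
have Z (x : R) (h : R -> R) : continuous h ->
    \int[mu]_(t in `[0, 2 * pi]%classic) (x * h t) =
    x * \int[mu]_(t in `[0, 2 * pi]%classic) h t.
  by move=> hc; rewrite RintegralZl //; exact: cont_integrable.
rewrite E /cint /=.
rewrite RintegralB; [|exact: meas_I|exact: I|exact: I].
rewrite RintegralD; [|exact: meas_I|exact: I|exact: I].
by rewrite !Z //; simpc.
Qed.

Lemma circle_ptE r t : circle_pt r t = r%:C%C * circle_pt 1 t.
Proof. by rewrite /circle_pt !mul1r; simpc. Qed.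

Lemma norm_circle_pt r t : 0 <= r -> `|circle_pt r t| = r%:C%C.
Proof.
move=> r0; rewrite normc_def /= !exprMn -mulrDr cos2Dsin2 mulr1.
by rewrite sqrtr_sqr ger0_norm.
Qed.

Lemma circle_pt1D t u : circle_pt 1 (t + u) = circle_pt 1 t * circle_pt 1 u.
Proof.
rewrite /circle_pt !mul1r cosD sinD; simpc.
by apply/eqP; rewrite eq_complex /=; apply/andP; split; apply/eqP; ring.
Qed.

Lemma circle_pt10 : circle_pt 1 (0 : R) = 1.
Proof. by rewrite /circle_pt cos0 sin0 mulr1 mulr0. Qed.

Lemma circle_pt_neq0 r t : 0 < r -> circle_pt r t != 0.
Proof. by move=> r0; rewrite -normr_gt0 norm_circle_pt ?ltW// ltcR. Qed.

Lemma circle_pt1X (n : int) t : circle_pt 1 t ^ n = circle_pt 1 (n%:~R * t).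
Proof.
have natE (m : nat) : circle_pt 1 t ^+ m = circle_pt 1 (m%:R * t).
  elim: m => [|m IHm]; first by rewrite expr0 mul0r circle_pt10.
  by rewrite exprS IHm -circle_pt1D mulrS mulrDl mul1r.
case: n => n; first by rewrite -exprnP natE.
rewrite NegzE -exprnN natE; apply: (mulfI (circle_pt_neq0 (n.+1%:R * t) ltr01)).
rewrite mulfV ?circle_pt_neq0 //.
by rewrite -circle_pt1D mulrNz mulNr subrr circle_pt10.
Qed.

Lemma ccont_circle (c : C) (b : R) : ccont (fun t => c * circle_pt 1 (b * t)).
Proof.
have cb : continuous (fun t : R => b * t).
  by move=> t; apply: cvgM; [exact: cvg_cst | exact: cvg_id].
have cc : continuous (fun t : R => cos (b * t)).
  by move=> t; apply: continuous_comp; [exact: cb | exact: continuous_cos].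
have cs : continuous (fun t : R => sin (b * t)).
  by move=> t; apply: continuous_comp; [exact: cb | exact: continuous_sin].
case: c => c d; rewrite /circle_pt; split => t; simpc => /=.
- have -> : (fun t0 : R => c * (1 * cos (b * t0)) - d * (1 * sin (b * t0)))
          = (fun t0 => c * cos (b * t0) - d * sin (b * t0)).
    by apply/funext => s; rewrite !mul1r.
  apply: cvgB; apply: cvgM; [exact: cvg_cst|exact: cc|exact: cvg_cst|exact: cs].
- have -> : (fun t0 : R => c * (1 * sin (b * t0)) + d * (1 * cos (b * t0)))
          = (fun t0 => c * sin (b * t0) + d * cos (b * t0)).
    by apply/funext => s; rewrite !mul1r.
  apply: cvgD; apply: cvgM; [exact: cvg_cst|exact: cs|exact: cvg_cst|exact: cc].
Qed.

End CircleIntegral.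

Section CircleMoments.
Variable R : realType.
Local Notation C := R[i].
Local Notation mu := (@lebesgue_measure R).

Let twopi_gt0 : 0 < 2 * pi :> R. Proof. by rewrite mulr_gt0 ?pi_gt0. Qed.

Lemma circle_pt_period (n : int) : circle_pt 1 (n%:~R * (2 * pi)) = 1 :> C.
Proof.
rewrite -circle_pt1X.
have -> : circle_pt 1 (2 * pi) = 1 :> C.
  by rewrite /circle_pt !mul1r mulr_natl cos2pi sin2pi.
by rewrite exp1rz.
Qed.

(** The antiderivative [F] takes the same value at both ends of the period. *)
Lemma Rint_trig (a1 a2 : R) (n : int) : n != 0 ->
  \int[mu]_(t in `[0, 2 * pi]%classic)
     (a1 * cos (n%:~R * t) + a2 * sin (n%:~R * t)) = 0.
Proof.
move=> n0; set b : R := n%:~R; have b0 : b != 0 by rewrite intr_eq0.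
pose F (t : R) := a1 / b * sin (b * t) - a2 / b * cos (b * t).
have dF (t : R) : is_derive t 1 F (a1 * cos (b * t) + a2 * sin (b * t)).
  have db : is_derive t 1 (fun t : R => b * t) b.
    by apply: is_derive_eq; rewrite /GRing.scale /=; ring.
  have ds : is_derive t 1 (fun t : R => sin (b * t)) (cos (b * t) * b).
    by apply: (is_derive1_comp (f := sin)).
  have dc : is_derive t 1 (fun t : R => cos (b * t)) (- sin (b * t) * b).
    by apply: (is_derive1_comp (f := cos)).
  apply: is_derive_eq; rewrite /GRing.scale /=; field; exact: b0.
have cF : continuous F.
  by move=> t; apply: differentiable_continuous; apply/derivable1_diffP;
     exact: ex_derive.
have [/(congr1 (@complex.Re R)) /= cE /(congr1 (@complex.Im R)) /= sE] :=
  (circle_pt_period n, circle_pt_period n).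
rewrite !mul1r -/b in cE sE.
rewrite /Rintegral (@continuous_FTC2 _ _ F) //=.
- rewrite /F !mulr0 cos0 sin0 cE sE; ring.
- apply: continuous_subspaceT => t.
  apply: cvgD; apply: cvgM; do ?exact: cvg_cst;
    apply: (@continuous_comp _ _ _ (fun t : R => b * t));
    rewrite ?/continuous_at; do ?[exact: continuous_cos|exact: continuous_sin];
    by apply: cvgM; [exact: cvg_cst | exact: cvg_id].
- split; first by move=> t _; exact: ex_derive.
    by apply: cvg_at_right_filter; exact: cF.
  by apply: cvg_at_left_filter; exact: cF.
- by move=> t _; rewrite derive1E; apply: derive_val.
Qed.

Lemma cint_circle (c : C) (n : int) :
  cint (fun t => c * circle_pt 1 (n%:~R * t)) =
  if n == 0 then (2 * pi)%:C%C * c else 0.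
Proof.
have [->|n0] := eqVneq n 0.
  have E (t : R) : c * circle_pt 1 (0%:~R * t) = c.
    by rewrite mul0r circle_pt10 mulr1.
  rewrite /cint; under eq_Rintegral do rewrite E.
  under [X in Complex _ X]eq_Rintegral do rewrite E.
  by rewrite !Rint_cst; case: c {E} => c d; simpc.
case: c => c d; rewrite /cint.
under eq_Rintegral => t _.
  have -> : complex.Re ((c +i* d)%C * circle_pt 1 (n%:~R * t)) =
            c * cos (n%:~R * t) + - d * sin (n%:~R * t).
    by rewrite /circle_pt /=; ring.
  over.
under [X in Complex _ X]eq_Rintegral => t _.
  have -> : complex.Im ((c +i* d)%C * circle_pt 1 (n%:~R * t)) =
            d * cos (n%:~R * t) + c * sin (n%:~R * t).
    by rewrite /circle_pt /=; ring.
  over.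
by rewrite !Rint_trig.
Qed.

End CircleMoments.

(** * Laurent polynomials on a torus and their uniform limits *)

Section LaurentPolynomials.
Variable R : realType.
Local Notation C := R[i].
Implicit Types (m : nat) (rho : nat -> R) (v u : nat -> C) (f g : (nat -> C) -> C).
Implicit Types (al be : nat -> int) (p q : seq (C * (nat -> int))).

Definition on_torus m rho v u : Prop :=
  (forall j, (0 < j <= m)%N -> `|u j| = (rho j)%:C%C) /\
  (forall j, ~~ (0 < j <= m)%N -> u j = v j).

Definition mon m al u : C := \prod_(1 <= j < m.+1) u j ^ al j.

(** A Laurent polynomial is a list of coefficients with exponent vectors, repetitions allowed, so
    that addition is concatenation. *)
Definition lpoly m p u : C := \sum_(t <- p) t.1 * mon m t.2 u.

Definition cterm m p : C :=
  \sum_(t <- p | all (fun j => t.2 j == 0) (iota 1 m)) t.1.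

Definition circle_av (r : R) (g : C -> C) : C :=
  cint (fun t => g (circle_pt r t)) / (2 * pi)%:C%C.

(* The constant term of f: for a Laurent polynomial, the iterated average     *)
(* over the circles |u_j| = rho j picks the coefficient of u^0.               *)
Fixpoint ctm m rho f v : C :=
  if m is m'.+1 then
    ctm m' rho (fun u => circle_av (rho m) (fun s => f [eta u with m |-> s])) v
  else f v.

(** Uniform approximability on the torus takes the place of a convergent Laurent expansion; [ctm] is
    then the limit of the algebraic constant terms [cterm]. *)
Definition lapprox m rho v f : Prop :=
  forall e : C, 0 < e ->
    exists p, forall u, on_torus m rho v u -> `|f u - lpoly m p u| <= e.

Lemma cterm_seqS m p :
  cterm m.+1 p = cterm m [seq t <- p | t.2 m.+1 == 0].
Proof.
rewrite /cterm big_filter_cond; apply: eq_bigl => t.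
by rewrite -(addn1 m) iotaD all_cat /= andbT add1n addn1 andbC.
Qed.

Lemma ccont_sum (T : Type) (r : seq T) (F : T -> R -> C) :
  (forall i, ccont (F i)) -> ccont (fun t => \sum_(i <- r) F i t).
Proof.
move=> H; elim: r => [|i r [IHr IHi]].
  split => t; under eq_fun do rewrite big_nil; exact: cvg_cst.
have [Hr Hi] := H i.
split => t; under eq_fun do rewrite big_cons raddfD.
  by apply: cvgD; [exact: Hr | exact: IHr].
by apply: cvgD; [exact: Hi | exact: IHi].
Qed.

Lemma cint_sum (T : Type) (r : seq T) (F : T -> R -> C) :
  (forall i, ccont (F i)) ->
  cint (fun t => \sum_(i <- r) F i t) = \sum_(i <- r) cint (F i).
Proof.
move=> H; elim: r => [|i r IHr].
  under eq_fun do rewrite big_nil; rewrite big_nil.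
  have c0 := cint_circle (0 : C) 1; rewrite oner_eq0 in c0.
  by rewrite -[RHS]c0; congr cint; apply/funext => t; rewrite mul0r.
under eq_fun do rewrite big_cons; rewrite big_cons -IHr.
by rewrite -cintD //; exact: ccont_sum.
Qed.

Let pi2_neq0 : (2 * pi)%:C%C != 0 :> C.
Proof.
by rewrite fmorph_eq0 gt_eqF // mulr_gt0 ?pi_gt0.
Qed.

Lemma real_normC (x : R) : `|x%:C%C : C| = `|x|%:C%C.
Proof. by rewrite normc_def /= expr0n addr0 sqrtr_sqr. Qed.

Lemma circle_av_close (r : R) (g h : C -> C) (e : C) :
  ccont (fun t => g (circle_pt r t)) -> ccont (fun t => h (circle_pt r t)) ->
  (forall t, `|g (circle_pt r t) - h (circle_pt r t)| <= e) ->
  `|circle_av r g - circle_av r h| <= 2 * e.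
Proof.
move=> gc hc gh; have e0 : 0 <= e by apply: le_trans (gh 0).
have [e' eE] : exists e' : R, e = e'%:C%C.
  by exists (complex.Re e); rewrite RRe_real // ger0_real.
have nE : `|(2 * pi)%:C%C : C| = (2 * pi)%:C%C.
  by rewrite real_normC ger0_norm // mulr_ge0 ?pi_ge0.
have two : 2 = (2 : R)%:C%C :> C by rewrite rmorph_nat.
rewrite /circle_av -mulrBl -cintB // normrM normfV nE.
have p0 : 0 < (2 * pi)%:C%C :> C by rewrite -nE normr_gt0.
rewrite ler_pdivrMr // eE two -!rmorphM /=.
have -> : 2 * e' * (2 * pi) = 4 * pi * e' by ring.
apply: cint_le; last by move=> t; rewrite -eE.
case: gc hc => [gr gi] [hr hi].
split => t; under eq_fun do rewrite raddfB.
  by apply: cvgB; [exact: gr|exact: hr].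
by apply: cvgB; [exact: gi|exact: hi].
Qed.

Lemma lpoly_slice m p u (r t : R) : 0 < r ->
  lpoly m.+1 p [eta u with m.+1 |-> circle_pt r t] =
  \sum_(i <- p) (i.1 * r%:C%C ^ (i.2 m.+1) * mon m i.2 u) *
                circle_pt 1 ((i.2 m.+1)%:~R * t).
Proof.
move=> r0; apply: eq_bigr => i _.
rewrite /mon big_nat_recr //= eqxx circle_ptE -circle_pt1X.
have -> : \prod_(1 <= j < m.+1)
    (if j == m.+1 then r%:C%C * circle_pt 1 t else u j) ^ i.2 j =
    \prod_(1 <= j < m.+1) u j ^ i.2 j.
  by apply: eq_big_nat => j /andP[_ jm] /=; rewrite ifN // neq_ltn jm.
by rewrite expfzMl -!mulrA; congr (_ * _); rewrite mulrCA.
Qed.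

Lemma ccont_lpoly_slice m p u (r : R) : 0 < r ->
  ccont (fun t => lpoly m.+1 p [eta u with m.+1 |-> circle_pt r t]).
Proof.
move=> r0; under eq_fun do rewrite lpoly_slice //.
by apply: ccont_sum => i; exact: ccont_circle.
Qed.

Lemma circle_av_lpoly m p u (r : R) : 0 < r ->
  circle_av r (fun s => lpoly m.+1 p [eta u with m.+1 |-> s]) =
  lpoly m [seq t <- p | t.2 m.+1 == 0] u.
Proof.
move=> r0; rewrite /circle_av; under eq_fun do rewrite lpoly_slice //.
rewrite cint_sum; last by move=> i; exact: ccont_circle.
rewrite mulr_suml /lpoly big_filter [RHS]big_mkcond; apply: eq_bigr => i _ /=.
rewrite cint_circle; case: eqP => [->|_]; last by rewrite mul0r.
by rewrite mulrAC mulfV // mul1r mulr1.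
Qed.

Lemma on_torus_slice m rho v u (t : R) : 0 <= rho m.+1 ->
  on_torus m rho v u ->
  on_torus m.+1 rho v [eta u with m.+1 |-> circle_pt (rho m.+1) t].
Proof.
move=> r0 [H1 H2]; split=> j /=.
  case: eqP => [->|/eqP jm] H; first by rewrite norm_circle_pt.
  by apply: H1; case/andP: H => -> /=; rewrite leq_eqVlt (negbTE jm).
case: eqP => [->|jm] H; first by rewrite /= ltnSn in H.
apply: H2; apply: contra H => /andP[-> jm']; exact: leqW.
Qed.

Lemma ccont_slice m rho v f u : 0 < rho m.+1 ->
  lapprox m.+1 rho v f -> on_torus m rho v u ->
  ccont (fun t => f [eta u with m.+1 |-> circle_pt (rho m.+1) t]).
Proof.
move=> r0 Hf Hu; apply: ccont_unif_lim => e e0.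
have [|p Hp] := Hf e%:C%C; first by rewrite ltcR.
exists (fun t => lpoly m.+1 p [eta u with m.+1 |-> circle_pt (rho m.+1) t]).
  exact: ccont_lpoly_slice.
by move=> t; apply: Hp; apply: on_torus_slice => //; exact: ltW.
Qed.

Lemma slice_close m rho v f p (e : C) u : 0 < rho m.+1 ->
  lapprox m.+1 rho v f ->
  (forall u, on_torus m.+1 rho v u -> `|f u - lpoly m.+1 p u| <= e) ->
  on_torus m rho v u ->
  `|circle_av (rho m.+1) (fun s => f [eta u with m.+1 |-> s]) -
    lpoly m [seq t <- p | t.2 m.+1 == 0] u| <= 2 * e.
Proof.
move=> r0 Hf Hp Hu; rewrite -(@circle_av_lpoly m p u (rho m.+1)) //.
apply: circle_av_close.
- exact: ccont_slice Hf Hu.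
- exact: ccont_lpoly_slice.
- by move=> t; apply: Hp; apply: on_torus_slice => //; exact: ltW.
Qed.

Lemma lapprox_slice m rho v f : 0 < rho m.+1 -> lapprox m.+1 rho v f ->
  lapprox m rho v
    (fun u => circle_av (rho m.+1) (fun s => f [eta u with m.+1 |-> s])).
Proof.
move=> r0 Hf e e0.
have [|p Hp] := Hf (e / 2); first by rewrite divr_gt0.
exists [seq t <- p | t.2 m.+1 == 0] => u Hu.
have := slice_close r0 Hf Hp Hu.
by rewrite mulrC mulfVK // pnatr_eq0.
Qed.

Lemma on_torus0 rho v : on_torus 0 rho v v.
Proof. by split=> // j; case: j. Qed.

(** Each averaging at most doubles the error. The total factor depends on [m] only, so constant
    terms pass to uniform limits. *)
Lemma ctm_close m rho v f p (e : C) :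
  (forall j, (0 < j <= m)%N -> 0 < rho j) ->
  lapprox m rho v f ->
  (forall u, on_torus m rho v u -> `|f u - lpoly m p u| <= e) ->
  `|ctm m rho f v - cterm m p| <= 2 ^+ m * e.
Proof.
elim: m f p e => [|m IHm] f p e Hr Hf Hp.
  have := Hp _ (on_torus0 rho v); rewrite /= expr0 mul1r; congr (`|_ - _| <= _).
  by rewrite /cterm /lpoly /=; apply: eq_bigr => i _; rewrite /mon big_geq ?mulr1.
have r0 : 0 < rho m.+1 by apply: Hr; rewrite /= leqnn.
rewrite /= cterm_seqS exprSr -mulrA; apply: IHm.
- by move=> j /andP[j0 jm]; apply: Hr; rewrite j0 leqW.
- exact: lapprox_slice.
- by move=> u Hu; exact: slice_close Hu.
Qed.

Lemma eq_iter_circle_int m rho v f g :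
  (forall u, on_torus m rho v u -> f u = g u) ->
  (forall j, (0 < j <= m)%N -> 0 < rho j) ->
  iter_circle_int m rho f v = iter_circle_int m rho g v.
Proof.
elim: m f g => [|m IHm] f g H Hr /=; first exact/H/on_torus0.
apply: IHm => [u Hu|j /andP[j0 jm]]; last by apply: Hr; rewrite j0 leqW.
rewrite /circle_int.
have E t : f [eta u with m.+1 |-> circle_pt (rho m.+1) t] =
           g [eta u with m.+1 |-> circle_pt (rho m.+1) t].
  by apply/H/on_torus_slice => //; apply/ltW/Hr; rewrite /= leqnn.
by congr Complex; apply: eq_Rintegral => t _; rewrite E.
Qed.

Lemma on_torus_neq0 m rho v u j :
  (forall j, (0 < j <= m)%N -> 0 < rho j) ->
  on_torus m rho v u -> (0 < j <= m)%N -> u j != 0.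
Proof. by move=> Hr [Hu _] Hj; rewrite -normr_gt0 Hu // ltcR Hr. Qed.

Lemma on_torus_prod_neq0 m rho v u :
  (forall j, (0 < j <= m)%N -> 0 < rho j) ->
  on_torus m rho v u -> \prod_(1 <= j < m.+1) u j != 0.
Proof.
move=> Hr Hu; rewrite prodf_seq_neq0; apply/allP => j; rewrite mem_index_iota.
by move=> Hj; apply: on_torus_neq0 Hr Hu _.
Qed.

(** On each circle [ds = i s dt], and the factor [s] cancels one factor of the denominator. The
    scalar [c] is kept general so that the induction can absorb a factor [2 pi i] at each step. *)
Lemma iter_circle_ctm m rho v f (c : C) :
  (forall j, (0 < j <= m)%N -> 0 < rho j) ->
  lapprox m rho v f ->
  iter_circle_int m rho (fun u => c * (f u / \prod_(1 <= j < m.+1) u j)) v =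
  c * ((2 * pi%:C%C * 'i%C) ^+ m * ctm m rho f v).
Proof.
elim: m f c => [|m IHm] f c Hr Hf.
  by rewrite /= big_geq // expr0 mul1r invr1 mulr1.
have r0 : 0 < rho m.+1 by apply: Hr; rewrite /= leqnn.
have Hr' j : (0 < j <= m)%N -> 0 < rho j.
  by move=> /andP[j0 jm]; apply: Hr; rewrite j0 leqW.
rewrite exprS -mulrA [c * (_ * _)]mulrA.
rewrite -(IHm _ _ Hr' (lapprox_slice r0 Hf)) /=.
apply: (eq_iter_circle_int (v := v) _ Hr') => u Hu.
have P0 := on_torus_prod_neq0 Hr' Hu.
rewrite /circle_int -/(cint _).
have prodE (s : C) : \prod_(1 <= j < m.+2) [eta u with m.+1 |-> s] j =
    (\prod_(1 <= j < m.+1) u j) * s.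
  rewrite big_nat_recr //= eqxx; congr (_ * _).
  apply: eq_big_nat => j /andP[_ jm] /=; rewrite ifN //.
  by rewrite neq_ltn jm.
transitivity (cint (fun t => (c * 'i%C / \prod_(1 <= j < m.+1) u j) *
    f [eta u with m.+1 |-> circle_pt (rho m.+1) t])).
  congr cint; apply/funext => t; rewrite prodE invfM.
  have z0 := circle_pt_neq0 t r0; set z := circle_pt _ _ in z0 *.
  by rewrite -!mulrA; congr (_ * _); field; rewrite z0 P0.
rewrite cintZ; last exact: ccont_slice Hf Hu.
rewrite /circle_av; have -> : 2 * pi%:C%C = (2 * pi)%:C%C :> C.
  by rewrite [RHS]rmorphM /= rmorph_nat.
by move: (2 * pi)%:C%C pi2_neq0 => w w0; field; rewrite w0 P0.
Qed.

End LaurentPolynomials.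

(** * Weighted degrees and vanishing of constant terms *)

Section LaurentDegrees.
Variables (R : realType) (m : nat) (rho : nat -> R) (v : nat -> R[i]).
Hypothesis rho_gt0 : forall j, (0 < j <= m)%N -> 0 < rho j.
Local Notation C := R[i].
Implicit Types (u : nat -> C) (f g : (nat -> C) -> C) (al be om : nat -> int).
Implicit Types (p q : seq (C * (nat -> int))).
Implicit Types (W : (nat -> int) -> Prop) (c : (nat -> int) -> int).
Local Notation T := (on_torus m rho v).
Local Notation ct f := (ctm m rho f v).

Definition wdot om al : int := \sum_(1 <= j < m.+1) om j * al j.

Fixpoint exps_in (P : (nat -> int) -> Prop) p : Prop :=
  if p is t :: p' then P t.2 /\ exps_in P p' else True.

(* f has degree at most c om at infinity when u_j is given the weight om j,   *)
(* for every om in W; negative weights express vanishing orders at u_j = 0.   *)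
Definition ldeg W c f : Prop :=
  (exists B : C, forall u, T u -> `|f u| <= B) /\
  forall e : C, 0 < e -> exists2 p,
    exps_in (fun al => forall om, W om -> wdot om al <= c om) p &
    forall u, T u -> `|f u - lpoly m p u| <= e.

Lemma wdotD om al be : wdot om (fun j => al j + be j) = wdot om al + wdot om be.
Proof. by rewrite /wdot -big_split; apply: eq_bigr => j _; rewrite mulrDr. Qed.

Lemma exps_cat (P : (nat -> int) -> Prop) p q :
  exps_in P p -> exps_in P q -> exps_in P (p ++ q).
Proof. by elim: p => //= t p IHp [Pt Pp] Pq; split=> //; apply: IHp. Qed.

Lemma exps_imply (P Q : (nat -> int) -> Prop) p :
  (forall al, P al -> Q al) -> exps_in P p -> exps_in Q p.
Proof. by move=> PQ; elim: p => //= t p IHp [Pt Pp]; split; auto. Qed.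

Definition lmul p q : seq (C * (nat -> int)) :=
  [seq (s.1 * t.1, fun j => s.2 j + t.2 j) | s <- p, t <- q].

Lemma exps_mul (P Q S : (nat -> int) -> Prop) p q :
  (forall al be, P al -> Q be -> S (fun j => al j + be j)) ->
  exps_in P p -> exps_in Q q -> exps_in S (lmul p q).
Proof.
move=> PQS; elim: p => //= s p IHp [Ps Pp] Qq.
apply: exps_cat; last exact: IHp.
by elim: q Qq {IHp} => //= t q IHq [Qt Qq]; split; [apply: PQS | apply: IHq].
Qed.

Lemma monD al be u : T u ->
  mon m (fun j => al j + be j) u = mon m al u * mon m be u.
Proof.
move=> Tu; rewrite /mon -big_split; apply: eq_big_nat => j Hj /=.
by rewrite expfzDr //; apply: on_torus_neq0 rho_gt0 Tu _.
Qed.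

Lemma lpoly_cat p q u : lpoly m (p ++ q) u = lpoly m p u + lpoly m q u.
Proof. by rewrite /lpoly big_cat. Qed.

Lemma lpoly_mul p q u : T u -> lpoly m (lmul p q) u = lpoly m p u * lpoly m q u.
Proof.
move=> Tu; rewrite /lpoly big_allpairs_dep mulr_suml; apply: eq_bigr => s _.
rewrite mulr_sumr; apply: eq_bigr => t _ /=.
by rewrite monD // mulrACA.
Qed.

Lemma ldeg_lapprox W c f : ldeg W c f -> lapprox m rho v f.
Proof. by case=> _ H e e0; have [p _ Hp] := H e e0; exists p. Qed.

Lemma ldeg_ext W c f g : (forall u, T u -> f u = g u) ->
  ldeg W c f -> ldeg W c g.
Proof.
move=> fg [[B HB] Hf]; split; first by exists B => u Tu; rewrite -fg //; apply: HB.
move=> e e0; have [p Pp Hp] := Hf e e0; exists p => // u Tu.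
by rewrite -fg //; apply: Hp.
Qed.

Lemma ldeg_le W W' c c' f :
  (forall om, W' om -> W om /\ c om <= c' om) -> ldeg W c f -> ldeg W' c' f.
Proof.
move=> H [HB Hf]; split=> // e e0; have [p Pp Hp] := Hf e e0; exists p => //.
apply: exps_imply Pp => al Hal om Hom.
by have [H1 H2] := H om Hom; apply: le_trans H2; exact: Hal.
Qed.

Lemma ldegD W c f g : ldeg W c f -> ldeg W c g -> ldeg W c (fun u => f u + g u).
Proof.
move=> [[B HB] Hf] [[B' HB'] Hg]; split.
  exists (B + B') => u Tu; apply: (le_trans (ler_normD _ _)).
  by apply: lerD; [exact: HB | exact: HB'].
move=> e e0; have e2 : 0 < e / 2 by rewrite divr_gt0.
have [p Pp Hp] := Hf _ e2; have [q Pq Hq] := Hg _ e2.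
exists (p ++ q); first exact: exps_cat.
move=> u Tu; rewrite lpoly_cat opprD addrACA (splitr e).
by apply: (le_trans (ler_normD _ _)); apply: lerD; [exact: Hp | exact: Hq].
Qed.

(** Degrees add because exponents do. The accuracy of [q] is fixed after [p], relative to a bound
    [K] for the polynomial [p] on the torus. *)
Lemma ldegM W c c' f g : ldeg W c f -> ldeg W c' g ->
  ldeg W (fun om => c om + c' om) (fun u => f u * g u).
Proof.
move=> [[B HB] Hf] [[B' HB'] Hg].
pose A := `|B| + 1; pose A' := `|B'| + 1.
have A0 : 0 < A by rewrite ltr_wpDl.
have A0' : 0 < A' by rewrite ltr_wpDl.
have HA u : T u -> `|f u| <= A.
  move=> Tu; have H := HB u Tu; have B0 : 0 <= B by apply: le_trans H.
  by rewrite (le_trans H) // /A (ger0_norm B0) lerDl.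
have HA' u : T u -> `|g u| <= A'.
  move=> Tu; have H := HB' u Tu; have B0 : 0 <= B' by apply: le_trans H.
  by rewrite (le_trans H) // /A' (ger0_norm B0) lerDl.
split.
  by exists (A * A') => u Tu; rewrite normrM; apply: ler_pM; rewrite ?HA ?HA'.
move=> e e0.
have e1 : 0 < e / 2 / A' by rewrite !divr_gt0.
have [p Pp Hp] := Hf _ e1.
have [K K0 HK] : exists2 K : C, 0 < K & forall u, T u -> `|lpoly m p u| <= K.
  exists (A + e / 2 / A'); first by rewrite addr_gt0.
  move=> u Tu; rewrite -[lpoly m p u](subrK (f u)) addrC.
  apply: (le_trans (ler_normD _ _)); apply: lerD; first exact: HA.
  by rewrite distrC; exact: Hp.
have e2 : 0 < e / 2 / K by rewrite !divr_gt0.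
have [q Pq Hq] := Hg _ e2.
exists (lmul p q).
  apply: (exps_mul _ Pp Pq) => al be H1 H2 om Hom.
  by rewrite wdotD; apply: lerD; [exact: H1 | exact: H2].
move=> u Tu; rewrite lpoly_mul //.
have -> : f u * g u - lpoly m p u * lpoly m q u =
  (f u - lpoly m p u) * g u + lpoly m p u * (g u - lpoly m q u) by ring.
apply: (le_trans (ler_normD _ _)); rewrite !normrM (splitr e); apply: lerD.
  apply: (@le_trans _ _ (e / 2 / A' * A')); last by rewrite divfK // gt_eqF.
  by apply: ler_pM; rewrite ?Hp ?HA'.
apply: (@le_trans _ _ (K * (e / 2 / K))); last by rewrite mulrC divfK // gt_eqF.
by apply: ler_pM; rewrite ?Hq ?HK.
Qed.

Lemma norm_exprz (x : C) (n : int) : `|x ^ n| = `|x| ^ n.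
Proof. by case: n => n; [exact: normrX | rewrite /= normfV normrX]. Qed.

Lemma ldeg_lpoly W c p :
  exps_in (fun al => forall om, W om -> wdot om al <= c om) p ->
  ldeg W c (lpoly m p).
Proof.
move=> Pp; split; last first.
  by move=> e e0; exists p => // u Tu; rewrite subrr normr0 ltW.
exists (\sum_(t <- p) `|t.1| * \prod_(1 <= j < m.+1) (rho j)%:C%C ^ t.2 j).
move=> u Tu; apply: (le_trans (ler_norm_sum _ _ _)); apply: ler_sum => t _.
rewrite normrM /mon normr_prod; apply: ler_pM => //.
  by apply: prodr_ge0 => j _.
rewrite le_eqVlt; apply/orP; left; apply/eqP; apply: eq_big_nat => j Hj.
by rewrite norm_exprz Tu.1.
Qed.

Lemma ldeg_mon W al (a : C) : ldeg W (wdot^~ al) (fun u => a * mon m al u).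
Proof.
apply: (@ldeg_ext _ _ (lpoly m [:: (a, al)])).
  by move=> u _; rewrite /lpoly big_seq1.
by apply: ldeg_lpoly; split.
Qed.

Lemma wdot0 om : wdot om (fun=> 0) = 0.
Proof. by rewrite /wdot big1 // => j _; rewrite mulr0. Qed.

Lemma ldeg_cst W (a : C) : ldeg W (fun=> 0) (fun=> a).
Proof.
apply: (@ldeg_ext _ _ (fun u => a * mon m (fun=> 0) u)).
  by move=> u _; rewrite /mon big1 ?mulr1.
by apply: (ldeg_le _ (ldeg_mon W _ _)) => om Hom; rewrite wdot0.
Qed.

(** Outside [1, ..., m] the value [u i] is the constant [v i], so its weight is 0; this lets
    boundary and integration variables be treated alike. *)
Definition wt om (i : nat) : int := if (0 < i <= m)%N then om i else 0.

Lemma wdot_delta om i (z : int) : wdot om (fun j => if j == i then z else 0) = wt om i * z.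
Proof.
rewrite /wdot /wt; case: ifP => Hi.
  rewrite (bigD1_seq i) ?mem_index_iota ?iota_uniq //= eqxx big1 ?addr0 //.
  by move=> j /negbTE ->; rewrite mulr0.
rewrite mul0r big_seq big1 // => j; rewrite mem_index_iota => Hj.
by case: eqP => [E|_]; [rewrite -E Hj in Hi | rewrite mulr0].
Qed.

Lemma ldeg_var W i (z : int) : ldeg W (fun om => wt om i * z) (fun u => u i ^ z).
Proof.
have [Hi|Hi] := boolP (0 < i <= m)%N.
  apply: (@ldeg_ext _ _ (fun u => 1 * mon m (fun j => if j == i then z else 0) u)).
    move=> u Tu; rewrite mul1r /mon.
    rewrite (bigD1_seq i) ?mem_index_iota ?iota_uniq //= eqxx big1 ?mulr1 //.
    by move=> j /negbTE ->.
  by apply: (ldeg_le _ (ldeg_mon W _ _)) => om Hom; rewrite wdot_delta.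
apply: (@ldeg_ext _ _ (fun u => v i ^ z)); first by move=> u [_ H]; rewrite H.
by apply: (ldeg_le _ (ldeg_cst W _)) => om Hom; rewrite /wt (negbTE Hi) mul0r.
Qed.

Lemma ldeg_prod W (I : eqType) (r : seq I) (c_ : I -> (nat -> int) -> int)
    (f_ : I -> (nat -> C) -> C) :
  (forall i, i \in r -> ldeg W (c_ i) (f_ i)) ->
  ldeg W (fun om => \sum_(i <- r) c_ i om) (fun u => \prod_(i <- r) f_ i u).
Proof.
elim: r => [|i r IHr] H.
  apply: (@ldeg_ext _ _ (fun=> 1)); first by move=> u _; rewrite big_nil.
  by apply: (ldeg_le _ (ldeg_cst W _)) => om Hom; rewrite big_nil.
apply: (@ldeg_ext _ _ (fun u => f_ i u * \prod_(i <- r) f_ i u)).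
  by move=> u _; rewrite big_cons.
have H1 : ldeg W (c_ i) (f_ i) by apply: H; rewrite mem_head.
have H2 : ldeg W (fun om => \sum_(i <- r) c_ i om) (fun u => \prod_(i <- r) f_ i u).
  by apply: IHr => j Hj; apply: H; rewrite inE Hj orbT.
by apply: ldeg_le (ldegM H1 H2) => om Hom; rewrite big_cons.
Qed.

Lemma ldeg_sum W (I : eqType) (r : seq I) c (f_ : I -> (nat -> C) -> C) :
  (forall i, i \in r -> ldeg W c (f_ i)) ->
  ldeg W c (fun u => \sum_(i <- r) f_ i u).
Proof.
elim: r => [|i r IHr] H.
  apply: (@ldeg_ext _ _ (lpoly m [::])); last exact: ldeg_lpoly.
  by move=> u _; rewrite /lpoly !big_nil.
apply: (@ldeg_ext _ _ (fun u => f_ i u + \sum_(i <- r) f_ i u)).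
  by move=> u _; rewrite big_cons.
apply: ldegD; first by apply: H; rewrite mem_head.
by apply: IHr => j Hj; apply: H; rewrite inE Hj orbT.
Qed.

Lemma exp_small (r e : C) : 0 <= r -> r < 1 -> 0 < e -> exists n, r ^+ n <= e.
Proof.
move=> r0 r1 e0.
have rE : r = (complex.Re r)%:C%C by rewrite RRe_real // ger0_real.
have eE : e = (complex.Re e)%:C%C by rewrite RRe_real // gtr0_real.
move: (complex.Re r) (complex.Re e) rE eE => x y rE eE.
rewrite rE lecR in r0; rewrite rE ltcR in r1; rewrite eE ltcR in e0.
have /cvgrPdist_le /(_ _ e0) [n _ /(_ n (leqnn n))] :
    (x ^+ k @[k --> \oo] --> (0 : R))%classic.
  by apply: cvg_expr; rewrite ger0_norm.
rewrite /= sub0r normrN ger0_norm ?exprn_ge0 // => H.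
by exists n; rewrite rE eE -rmorphXn lecR.
Qed.

(** The partial sums of the geometric series converge uniformly, with rate given by [r], and inherit
    degree at most 0 from the powers of [g]. *)
Lemma ldeg_geo W g (r : C) : ldeg W (fun=> 0) g -> r < 1 ->
  (forall u, T u -> `|g u| <= r) ->
  ldeg W (fun=> 0) (fun u => (1 - g u)^-1).
Proof.
move=> Hg r1 Hr.
have [u0 Tu0] : exists u, T u.
  exists (fun j => if (0 < j <= m)%N then (rho j)%:C%C else v j); split=> j.
    by move=> H; rewrite H real_normC gtr0_norm // rho_gt0.
  by move/negbTE->.
have r0 : 0 <= r by apply: le_trans (Hr u0 Tu0).
have r1' : 0 < 1 - r by rewrite subr_gt0.
have nz u : T u -> 1 - r <= `|1 - g u|.
  move=> Tu; have := lerB_dist 1 (g u); rewrite normr1; apply: le_trans.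
  by rewrite lerD2l lerN2 Hr.
have nz' u : T u -> 1 - g u != 0.
  by move=> Tu; rewrite -normr_gt0 (lt_le_trans r1') ?nz.
have Hb u : T u -> `|(1 - g u)^-1| <= (1 - r)^-1.
  by move=> Tu; rewrite normfV lef_pV2 ?posrE ?nz // normr_gt0 nz'.
split; first by exists (1 - r)^-1.
have Hpow n : ldeg W (fun=> 0) (fun u => \sum_(i < n) g u ^+ i).
  apply: (@ldeg_ext _ _ (fun u => \sum_(i <- iota 0 n) g u ^+ i)).
    by move=> u _; rewrite -(big_mkord xpredT (fun i => g u ^+ i)) /index_iota subn0.
  apply: ldeg_sum => i _.
  elim: i => [|i IHi]; first by apply: ldeg_ext (ldeg_cst W 1) => u _; rewrite expr0.
  apply: (@ldeg_ext _ _ (fun u => g u * g u ^+ i)).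
    by move=> u _; rewrite exprS.
  by apply: ldeg_le (ldegM Hg IHi).
move=> e e0; have e2 : 0 < e / 2 by rewrite divr_gt0.
have [n Hn] := exp_small r0 r1 (mulr_gt0 e2 r1').
have [p Pp Hp] := (Hpow n).2 _ e2.
exists p => // u Tu.
have -> : (1 - g u)^-1 - lpoly m p u =
    g u ^+ n / (1 - g u) + (\sum_(i < n) g u ^+ i - lpoly m p u).
  have E : \sum_(i < n) g u ^+ i = (1 - g u ^+ n) / (1 - g u).
    apply: (mulIf (nz' u Tu)); rewrite divfK ?nz' // mulrC.
    by rewrite -opprB mulNr -subrX1 opprB.
  by rewrite E; field; exact: nz'.
rewrite (splitr e); apply: (le_trans (ler_normD _ _)); apply: lerD; last exact: Hp.
apply: (@le_trans _ _ (r ^+ n * (1 - r)^-1)); last by rewrite ler_pdivrMr.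
by rewrite normrM normrX; apply: ler_pM; rewrite ?lerXn2r ?nnegrE ?Hr ?Hb.
Qed.

End LaurentDegrees.

(** * The constant term as a functional: linearity, vanishing, factorization *)

Section ConstantTerm.
Variables (R : realType) (m : nat) (rho : nat -> R) (v : nat -> R[i]).
Hypothesis rho_gt0 : forall j, (0 < j <= m)%N -> 0 < rho j.
Local Notation C := R[i].
Implicit Types (u : nat -> C) (f g : (nat -> C) -> C) (al be om : nat -> int).
Implicit Types (p q : seq (C * (nat -> int))).
Implicit Types (W : (nat -> int) -> Prop) (c : (nat -> int) -> int).
Local Notation T := (on_torus m rho v).
Local Notation ct f := (ctm m rho f v).
Local Notation lap f := (lapprox m rho v f).
Local Notation deg W c f := (ldeg m rho v W c f).

(** Restricting to [e <= 1] lets errors quadratic in [e] be bounded linearly. The [e] chosen in the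
    proof would force [|x| + 2 * K <= K]. *)
Lemma small_eq0 (x K : C) :
  (forall e : C, 0 < e -> e <= 1 -> `|x| <= e * K) -> x = 0.
Proof.
move=> H; apply/eqP; rewrite -normr_eq0; apply/negPn/negP => x0.
have {}x0 : 0 < `|x| by rewrite lt_def x0 normr_ge0.
have K0 : 0 < K by have := H 1 ltr01 (lexx _); rewrite mul1r; exact: lt_le_trans.
pose e := `|x| / (`|x| + 2 * K).
have D0 : 0 < `|x| + 2 * K by rewrite addr_gt0 // mulr_gt0.
have e0 : 0 < e by rewrite divr_gt0.
have e1 : e <= 1 by rewrite ler_pdivrMr // mul1r lerDl mulr_ge0 // ltW.
have := H e e0 e1; rewrite /e mulrAC ler_pdivlMr // ler_pM2l //.
rewrite -subr_ge0; have -> : K - (`|x| + 2 * K) = - (`|x| + K) by ring.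
by rewrite oppr_ge0 => /(lt_le_trans (addr_gt0 x0 K0)); rewrite ltxx.
Qed.

Lemma ct_close f p (e : C) : lap f ->
  (forall u, T u -> `|f u - lpoly m p u| <= e) ->
  `|ct f - cterm m p| <= 2 ^+ m * e.
Proof. by move=> Hf Hp; apply: (ctm_close rho_gt0 Hf Hp). Qed.

Lemma cterm_cat p q : cterm m (p ++ q) = cterm m p + cterm m q.
Proof. by rewrite /cterm big_cat. Qed.

Lemma lapD f g : lap f -> lap g -> lap (fun u => f u + g u).
Proof.
move=> Hf Hg e e0; have e2 : 0 < e / 2 by rewrite divr_gt0.
have [p Hp] := Hf _ e2; have [q Hq] := Hg _ e2; exists (p ++ q) => u Tu.
rewrite lpoly_cat opprD addrACA (splitr e).
by apply: (le_trans (ler_normD _ _)); apply: lerD; [exact: Hp | exact: Hq].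
Qed.

Lemma ctD f g : lap f -> lap g -> ct (fun u => f u + g u) = ct f + ct g.
Proof.
move=> Hf Hg; apply/eqP; rewrite -subr_eq0; apply/eqP.
apply: (@small_eq0 _ (2 ^+ m * 4)) => e e0 _.
have [p Hp] := Hf _ e0; have [q Hq] := Hg _ e0.
have Hpq u : T u -> `|f u + g u - lpoly m (p ++ q) u| <= e + e.
  move=> Tu; rewrite lpoly_cat opprD addrACA.
  by apply: (le_trans (ler_normD _ _)); apply: lerD; [exact: Hp | exact: Hq].
have H1 := ct_close (lapD Hf Hg) Hpq.
have H2 := ct_close Hf Hp; have H3 := ct_close Hg Hq.
rewrite cterm_cat in H1.
set X := ct _ in H1 *; set Y := ct f in H2 *; set Z := ct g in H3 *.
have -> : X - (Y + Z) = (X - (cterm m p + cterm m q)) +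
   (- (Y - cterm m p) + - (Z - cterm m q)) by ring.
have -> : e * (2 ^+ m * 4) = 2 ^+ m * (e + e) + (2 ^+ m * e + 2 ^+ m * e) by ring.
apply: (le_trans (ler_normD _ _)); apply: lerD => //.
by apply: (le_trans (ler_normD _ _)); rewrite !normrN; apply: lerD.
Qed.

Lemma cterm1 (t : C * (nat -> int)) :
  cterm m [:: t] = if all (fun j => t.2 j == 0) (iota 1 m) then t.1 else 0.
Proof. by rewrite /cterm big_mkcond big_seq1. Qed.

Lemma cterm_scale (a : C) p :
  cterm m [seq (a * t.1, t.2) | t <- p] = a * cterm m p.
Proof. by rewrite /cterm big_map mulr_sumr. Qed.

Lemma lpoly_scale (a : C) p u :
  lpoly m [seq (a * t.1, t.2) | t <- p] u = a * lpoly m p u.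
Proof.
by rewrite /lpoly big_map mulr_sumr; apply: eq_bigr => t _ /=; rewrite mulrA.
Qed.

Lemma lapZ (a : C) f : lap f -> lap (fun u => a * f u).
Proof.
move=> Hf e e0; have a1 : 0 < `|a| + 1 by rewrite ltr_wpDl.
have [|p Hp] := Hf (e / (`|a| + 1)); first by rewrite divr_gt0.
exists [seq (a * t.1, t.2) | t <- p] => u Tu.
rewrite lpoly_scale -mulrBr normrM.
apply: (@le_trans _ _ ((`|a| + 1) * (e / (`|a| + 1)))).
  by apply: ler_pM; rewrite ?Hp // lerDl.
by rewrite mulrC divfK // gt_eqF.
Qed.

Lemma ctZ (a : C) f : lap f -> ct (fun u => a * f u) = a * ct f.
Proof.
move=> Hf; apply/eqP; rewrite -subr_eq0; apply/eqP.
apply: (@small_eq0 _ (2 ^+ m * `|a| * 2)) => e e0 _.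
have [p Hp] := Hf _ e0.
have Hap u : T u ->
    `|a * f u - lpoly m [seq (a * t.1, t.2) | t <- p] u| <= `|a| * e.
  by move=> Tu; rewrite lpoly_scale -mulrBr normrM ler_wpM2l ?Hp.
have H1 := ct_close (lapZ a Hf) Hap; rewrite cterm_scale in H1.
have H2 := ct_close Hf Hp.
set X := ct _ in H1 *; set Y := ct f in H2 *.
have -> : X - a * Y = (X - a * cterm m p) + - (a * (Y - cterm m p)) by ring.
have -> : e * (2 ^+ m * `|a| * 2) =
  2 ^+ m * (`|a| * e) + `|a| * (2 ^+ m * e) by ring.
apply: (le_trans (ler_normD _ _)); rewrite normrN; apply: lerD => //.
by rewrite normrM ler_wpM2l.
Qed.

Lemma ct_ext f g : (forall u, T u -> f u = g u) -> lap f -> ct f = ct g.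
Proof.
move=> fg Hf.
have Hg : lap g.
  by move=> e e0; have [p Hp] := Hf e e0; exists p => u Tu; rewrite -fg // Hp.
apply/eqP; rewrite -subr_eq0; apply/eqP.
apply: (@small_eq0 _ (2 ^+ m * 2)) => e e0 _; have [p Hp] := Hf _ e0.
have Hp' u : T u -> `|g u - lpoly m p u| <= e by move=> Tu; rewrite -fg // Hp.
have H1 := ct_close Hf Hp; have H2 := ct_close Hg Hp'.
have -> : ct f - ct g = (ct f - cterm m p) - (ct g - cterm m p) by ring.
have -> : e * (2 ^+ m * 2) = 2 ^+ m * e + 2 ^+ m * e by ring.
by apply: (le_trans (ler_normB _ _)); apply: lerD.
Qed.

Lemma lap0 : lap (fun=> 0).
Proof.
by move=> e e0; exists [::] => u _; rewrite /lpoly big_nil subrr normr0 ltW.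
Qed.

Lemma ct_lpoly p : ct (lpoly m p) = cterm m p.
Proof.
have Hp : lap (lpoly m p).
  by move=> e e0; exists p => u _; rewrite subrr normr0 ltW.
apply/eqP; rewrite -subr_eq0; apply/eqP.
apply: (@small_eq0 _ (2 ^+ m)) => e e0 _; rewrite mulrC; apply: ct_close => //.
by move=> u _; rewrite subrr normr0 ltW.
Qed.

Lemma ct_cst (a : C) : ct (fun=> a) = a.
Proof.
have H : lap (fun=> a) by apply: (@ldeg_lapprox _ _ _ _ (fun=> True)); exact: ldeg_cst.
rewrite (@ct_ext _ (lpoly m [:: (a, fun=> 0)])) //.
  rewrite ct_lpoly cterm1 /=.
  by have -> : all (fun=> (0 : int) == 0) (iota 1 m) by rewrite all_predT.
by move=> u _; rewrite /lpoly big_seq1 /mon big1 ?mulr1.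
Qed.

Lemma lap_sum (I : eqType) (r : seq I) (f_ : I -> (nat -> C) -> C) :
  (forall i, i \in r -> lap (f_ i)) -> lap (fun u => \sum_(i <- r) f_ i u).
Proof.
elim: r => [|i r IHr] H.
  by under eq_fun do rewrite big_nil; exact: lap0.
under eq_fun do rewrite big_cons; apply: lapD; first by apply: H; rewrite mem_head.
by apply: IHr => l Hl; apply: H; rewrite inE Hl orbT.
Qed.

Lemma ct_sum (I : eqType) (r : seq I) (f_ : I -> (nat -> C) -> C) :
  (forall i, i \in r -> lap (f_ i)) ->
  ct (fun u => \sum_(i <- r) f_ i u) = \sum_(i <- r) ct (f_ i).
Proof.
elim: r => [|i r IHr] H.
  by under eq_fun do rewrite big_nil; rewrite big_nil ct_cst.
have Hr l : l \in r -> lap (f_ l) by move=> Hl; apply: H; rewrite inE Hl orbT.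
under eq_fun do rewrite big_cons.
rewrite big_cons ctD ?IHr //; first by apply: H; rewrite mem_head.
exact: lap_sum.
Qed.

Lemma cterm_exps0 (P : (nat -> int) -> Prop) p : exps_in P p ->
  (forall al, P al -> ~~ all (fun j => al j == 0) (iota 1 m)) -> cterm m p = 0.
Proof.
move=> Pp HP; elim: p Pp => [|t p IHp] /=; first by rewrite /cterm big_nil.
move=> [Pt Pp]; rewrite /cterm big_cons (negbTE (HP _ Pt)); exact: IHp.
Qed.

(** The constant monomial has weight 0, so it cannot occur in approximations of negative degree. *)
Lemma ct_deg0 W c f om : deg W c f -> W om -> c om < 0 -> ct f = 0.
Proof.
move=> Hf Wom com; apply: (@small_eq0 _ (2 ^+ m)) => e e0 _.
have [p Pp Hp] := Hf.2 e e0.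
have H := ct_close (ldeg_lapprox Hf) Hp; rewrite mulrC.
rewrite (cterm_exps0 Pp) ?subr0 // in H.
move=> al /(_ om Wom) Hal; apply/negP => /allP al0.
have : wdot m om al = 0.
  rewrite /wdot big_seq big1 // => j; rewrite mem_index_iota => Hj.
  by rewrite (eqP (al0 j _)) ?mulr0 // mem_iota add1n.
by move=> E; rewrite E leNgt com in Hal.
Qed.

Definition delta (i : nat) (s : int) (j : nat) : int := if j == i then s else 0.

Lemma wdot_deltal i s al : (0 < i <= m)%N -> wdot m (delta i s) al = s * al i.
Proof.
move=> Hi; rewrite /wdot (bigD1_seq i) ?mem_index_iota ?iota_uniq //=.
rewrite /delta eqxx big1 ?addr0 // => j /negbTE ->; exact: mul0r.
Qed.

(** This family is closed under negation. Degree at most 0 for all its members therefore says that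
    the variables with index in [P] do not occur in the approximating polynomials ([delta_deg0]). In
    the same way [Wsuptot] adds homogeneity of total degree 0. *)
Definition Wsup (P : nat -> bool) om : Prop := forall i, ~~ P i -> om i = 0.

Definition Wtot (s : int) : nat -> int := fun=> s.

Definition Wsuptot (P : nat -> bool) om : Prop :=
  Wsup P om \/ exists s, om = Wtot s.

Lemma Wsup_delta (P : nat -> bool) i s : P i -> Wsup P (delta i s).
Proof. by move=> Pi l; rewrite /delta; case: eqP => // ->; rewrite Pi. Qed.

Lemma delta_deg0 (P : nat -> bool) al :
  (forall om, Wsup P om -> wdot m om al <= 0) ->
  forall i, (0 < i <= m)%N -> P i -> al i = 0.
Proof.
move=> H i Hi Pi; apply/eqP; rewrite eq_le.
have := H _ (Wsup_delta 1 Pi); have := H _ (Wsup_delta (- 1) Pi).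
by rewrite !wdot_deltal // mulN1r mul1r oppr_le0 => -> ->.
Qed.

(** Away from [j] each variable is absent from one of the two monomials. If the product is constant,
    [be] therefore vanishes away from [j], and its total degree 0 gives [be j = 0] as well. *)
Lemma all_split (P Q : nat -> bool) (j : nat) al be :
  (forall i : nat, i != j -> P i || Q i) ->
  (forall om, Wsup P om -> wdot m om al <= 0) ->
  (forall om, Wsuptot Q om -> wdot m om be <= 0) ->
  all (fun i => al i + be i == 0) (iota 1 m) =
  all (fun i => al i == 0) (iota 1 m) && all (fun i => be i == 0) (iota 1 m).
Proof.
move=> PQ Hal Hbe.
have al0 := delta_deg0 Hal.
have be0 := delta_deg0 (fun om H => Hbe om (or_introl H)).
have btot : \sum_(1 <= i < m.+1) be i = 0.
  have E s : wdot m (Wtot s) be = s * \sum_(1 <= i < m.+1) be i.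
    by rewrite /wdot mulr_sumr.
  have := Hbe (Wtot 1) (or_intror (ex_intro _ 1 erefl)).
  have := Hbe (Wtot (- 1)) (or_intror (ex_intro _ (- 1) erefl)).
  rewrite !E mulN1r mul1r oppr_le0 => H1 H2.
  by apply/eqP; rewrite eq_le H1 H2.
apply/idP/idP; last first.
  move=> /andP[/allP H1 /allP H2]; apply/allP => i Hi.
  by rewrite (eqP (H1 i Hi)) (eqP (H2 i Hi)).
move=> /allP H.
have S i : (0 < i <= m)%N -> al i + be i = 0.
  by move=> Hi; apply/eqP/H; rewrite mem_iota add1n.
have B i : (0 < i <= m)%N -> i != j -> be i = 0.
  move=> Hi /PQ /orP[Pi|Qi]; last exact: be0.
  by have := S i Hi; rewrite (al0 i Hi Pi) add0r.
have Bj i : (0 < i <= m)%N -> be i = 0.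
  move=> Hi; have [ij|] := eqVneq i j; last exact: B.
  move: btot; rewrite (bigD1_seq i) ?mem_index_iota ?iota_uniq //=.
  rewrite big_seq_cond big1 ?addr0 // => l.
  by rewrite mem_index_iota ij => /andP[Hl lj]; apply: B.
apply/andP; split; apply/allP => i; rewrite mem_iota add1n => Hi.
  by have := S i Hi; rewrite Bj // addr0 => ->.
by rewrite Bj.
Qed.

Lemma cterm_lmul (P Q : nat -> bool) (j : nat) p q :
  (forall i : nat, i != j -> P i || Q i) ->
  exps_in (fun al => forall om, Wsup P om -> wdot m om al <= 0) p ->
  exps_in (fun be => forall om, Wsuptot Q om -> wdot m om be <= 0) q ->
  cterm m (lmul p q) = cterm m p * cterm m q.
Proof.
move=> PQ Hp Hq; elim: p Hp => [|s p IHp] /=.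
  by rewrite /cterm /lmul /= !big_nil mul0r.
move=> [Hs Hp].
have -> : lmul (s :: p) q =
   [seq (s.1 * t.1, fun j => s.2 j + t.2 j) | t <- q] ++ lmul p q by [].
rewrite cterm_cat IHp // {IHp}.
have -> : cterm m (s :: p) = cterm m [:: s] + cterm m p.
  by rewrite -cat1s cterm_cat.
rewrite mulrDl; congr (_ + _).
elim: q Hq => [|t q IHq] /=; first by rewrite /cterm /= !big_nil mulr0.
move=> [Ht Hq].
rewrite -cat1s cterm_cat IHq // -[t :: q]cat1s cterm_cat mulrDr.
congr (_ + _); rewrite !cterm1 /= (all_split PQ Hs Ht).
by case: all; case: all; rewrite ?mulr0 ?mul0r.
Qed.

(* If f and g share at most the variable u_j and g is homogeneous of degree   *)
(* 0, then a product of monomials of f and g is constant only if both are.   *)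
Lemma ct_mul (P Q : nat -> bool) (j : nat) f g : (forall i : nat, i != j -> P i || Q i) ->
  deg (Wsup P) (fun=> 0) f -> deg (Wsuptot Q) (fun=> 0) g ->
  ct (fun u => f u * g u) = ct f * ct g.
Proof.
move=> PQ Hf Hg.
have Hfg : lap (fun u => f u * g u).
  have sub W f' : deg W (fun=> 0) f' -> deg (fun=> False) (fun=> 0) f'.
    by apply: ldeg_le.
  apply: (@ldeg_lapprox _ _ _ _ (fun=> False) (fun=> 0 + 0)).
  by apply: ldegM => //; [apply: sub Hf | apply: sub Hg].
have [[A HA] _] := Hf; have [[B HB] _] := Hg.
apply/eqP; rewrite -subr_eq0; apply/eqP.
apply: (@small_eq0 _ (2 ^+ m * (`|B| + (`|A| + 1)) +
   (2 ^+ m * (`|ct g| + 2 ^+ m) + `|ct f| * 2 ^+ m))) => e e0 e1.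
have [p Pp Hp] := Hf.2 _ e0; have [q Pq Hq] := Hg.2 _ e0.
have nA u : T u -> `|f u| <= `|A|.
  by move=> Tu; have H := HA u Tu; rewrite (le_trans H) // ger0_norm //; apply: le_trans H.
have nB u : T u -> `|g u| <= `|B|.
  by move=> Tu; have H := HB u Tu; rewrite (le_trans H) // ger0_norm //; apply: le_trans H.
have np u : T u -> `|lpoly m p u| <= `|A| + 1.
  move=> Tu; rewrite -[lpoly m p u](subrK (f u)) addrC.
  apply: (le_trans (ler_normD _ _)); apply: lerD; first exact: nA.
  by rewrite distrC; apply: le_trans e1; exact: Hp.
have Hpq u : T u ->
    `|f u * g u - lpoly m (lmul p q) u| <= e * `|B| + (`|A| + 1) * e.
  move=> Tu; rewrite (lpoly_mul rho_gt0 _ _ Tu).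
  have -> : f u * g u - lpoly m p u * lpoly m q u =
    (f u - lpoly m p u) * g u + lpoly m p u * (g u - lpoly m q u) by ring.
  apply: (le_trans (ler_normD _ _)); rewrite !normrM; apply: lerD.
    by apply: ler_pM; rewrite ?Hp ?nB.
  by apply: ler_pM; rewrite ?Hq ?np.
have H1 := ct_close Hfg Hpq; rewrite (cterm_lmul PQ Pp Pq) in H1.
have H2 := ct_close (ldeg_lapprox Hf) Hp.
have H3 := ct_close (ldeg_lapprox Hg) Hq.
set X := ct _ in H1 *; set Y := ct f in H2 *; set Z := ct g in H3 *.
set cp := cterm m p in H1 H2; set cq := cterm m q in H1 H3.
have E0 : 0 <= (2 ^+ m : C) by rewrite exprn_ge0.
have nQ : `|cq| <= `|Z| + 2 ^+ m.
  rewrite -[cq](subrK Z) addrC; apply: (le_trans (ler_normD _ _)).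
  apply: lerD => //; rewrite distrC (le_trans H3) //.
  by rewrite -[leRHS]mulr1 ler_wpM2l.
have -> : X - Y * Z = (X - cp * cq) - ((Y - cp) * cq + Y * (Z - cq)) by ring.
apply: (le_trans (ler_normB _ _)).
have -> : e * (2 ^+ m * (`|B| + (`|A| + 1)) +
     (2 ^+ m * (`|Z| + 2 ^+ m) + `|Y| * 2 ^+ m)) =
  2 ^+ m * (e * `|B| + (`|A| + 1) * e) +
  (2 ^+ m * e * (`|Z| + 2 ^+ m) + `|Y| * (2 ^+ m * e)) by ring.
apply: lerD => //; apply: (le_trans (ler_normD _ _)); rewrite !normrM.
by apply: lerD; [apply: ler_pM | apply: ler_wpM2l].
Qed.

End ConstantTerm.

(** * The kernels of the virtual polynomials *)

Section Kernels.
Variables (R : realType) (m : nat) (rho : nat -> R) (v : nat -> R[i]).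
Hypothesis rho_gt0 : forall j, (0 < j <= m)%N -> 0 < rho j.
Hypothesis v_le : forall j, (j <= m.+1)%N -> ~~ (0 < j <= m)%N ->
  `|v j| <= (rho j)%:C%C.
Hypothesis concave : forall j, (0 < j <= m)%N ->
  rho j.-1 + rho j.+1 < 2 * rho j.
Local Notation C := R[i].
Implicit Types (u : nat -> C) (f g : (nat -> C) -> C) (al be om : nat -> int).
Implicit Types (W : (nat -> int) -> Prop) (c : (nat -> int) -> int).
Local Notation T := (on_torus m rho v).
Local Notation ct f := (ctm m rho f v).
Local Notation lap f := (lapprox m rho v f).
Local Notation deg W c f := (ldeg m rho v W c f).
Local Notation wt := (wt m).

Definition kap u (j : nat) : C := 2 * u j - u j.-1 - u j.+1.

Lemma torus_le u j : T u -> (j <= m.+1)%N -> `|u j| <= (rho j)%:C%C.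
Proof.
move=> [H1 H2] Hj; have [Hi|Hi] := boolP (0 < j <= m)%N; first by rewrite H1.
by rewrite H2 // v_le.
Qed.

Definition kq u (j : nat) : C := (u j.-1 + u j.+1) / (2 * u j).

(** This is where strict concavity of the radii enters: it makes [1 - kq] invertible by a geometric
    series and [kap] nonzero on the torus. *)
Lemma kq_le j : (0 < j <= m)%N ->
  exists2 r : C, r < 1 & forall u, T u -> `|kq u j| <= r.
Proof.
move=> Hj; exists ((rho j.-1 + rho j.+1) / (2 * rho j))%:C%C.
  rewrite (_ : 1 = (1 : R)%:C%C) // ltcR ltr_pdivrMr ?mul1r ?concave //.
  by rewrite mulr_gt0 ?rho_gt0.
have two : 2 = (2 : R)%:C%C :> C by rewrite rmorph_nat.
move=> u Tu; rewrite normrM normfV normrM (Tu.1 j Hj) normr_nat.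
rewrite [leRHS]rmorphM fmorphV /= two -[X in _ / X]rmorphM /=.
apply: ler_wpM2r.
  by rewrite invr_ge0 lecR mulr_ge0 // ltW // rho_gt0.
case/andP: Hj => j0 jm.
apply: (le_trans (ler_normD _ _)); rewrite rmorphD /=.
by apply: lerD; apply: torus_le => //; rewrite ?ltnS // (leq_trans (leq_pred _)) // leqW.
Qed.

Lemma kapE u j : u j != 0 -> kap u j = 2 * u j * (1 - kq u j).
Proof. by move=> u0; rewrite /kap /kq; field. Qed.

Lemma torus_neq0 u j : T u -> (0 < j <= m)%N -> u j != 0.
Proof. by move=> Tu; apply: (on_torus_neq0 rho_gt0 Tu). Qed.

Lemma kap_neq0 u j : T u -> (0 < j <= m)%N -> kap u j != 0.
Proof.
move=> Tu Hj; have u0 := torus_neq0 Tu Hj; rewrite kapE //.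
rewrite !mulf_neq0 // ?pnatr_eq0 //; have [r r1 Hr] := kq_le Hj.
rewrite subr_eq0; apply/eqP => E; have := Hr u Tu; rewrite -E normr1.
by move=> /le_lt_trans /(_ r1); rewrite ltxx.
Qed.

Lemma deg_var W i (z : int) c : (forall om, W om -> wt om i * z <= c om) ->
  deg W c (fun u => u i ^ z).
Proof.
move=> H; apply: (@ldeg_le _ _ _ _ W _ (fun om => wt om i * z)) => [om Hom|].
  by split=> //; exact: H.
exact: ldeg_var.
Qed.

(** The ratio is half the geometric series in [kq], whose numerators are the neighbours of [u j];
    the degree stays at most 0 as long as the weight at [j] dominates both neighbouring weights. *)
Lemma deg_ratio W j : (0 < j <= m)%N ->
  (forall om, W om -> wt om j.-1 <= wt om j /\ wt om j.+1 <= wt om j) ->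
  deg W (fun=> 0) (fun u => u j / kap u j).
Proof.
move=> Hj HW; have [r r1 Hr] := kq_le Hj.
have Hq : deg W (fun=> 0) (fun u => kq u j).
  apply: (@ldeg_ext _ _ _ _ _ _ (fun u => 2^-1 * ((u j.-1 ^ 1 + u j.+1 ^ 1) * u j ^ (- 1)))).
    move=> u Tu; rewrite !expr1z exprN1 /kq invfM mulrA mulrC; ring.
  apply: (@ldeg_le _ _ _ _ W _ (fun om => 0 + (wt om j + wt om j * (- 1)))).
    by move=> om Hom; split=> //; rewrite mulrN1 subrr addr0.
  apply: ldegM => //; first exact: ldeg_cst.
  apply: ldegM => //; last by apply: deg_var.
  by apply: ldegD; apply: deg_var => om Hom; rewrite mulr1; have [] := HW om Hom.
apply: (@ldeg_ext _ _ _ _ _ _ (fun u => 2^-1 * (1 - kq u j)^-1)).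
  move=> u Tu; have u0 := torus_neq0 Tu Hj; rewrite kapE //.
  have := kap_neq0 Tu Hj; rewrite kapE // mulf_eq0 negb_or => /andP[_ k0].
  by field; rewrite k0 u0.
apply: (@ldeg_le _ _ _ _ W _ (fun om => 0 + 0)); first by [].
by apply: ldegM => //; [exact: ldeg_cst | exact: ldeg_geo r1 Hr].
Qed.

Definition zeta (z : C) (j : nat) u : C := (1 - z / u j)^-1.

Lemma zeta_lt (z : C) j : (0 < j <= m)%N -> `|z| < (rho j)%:C%C ->
  exists2 r : C, r < 1 & forall u, T u -> `|z / u j| <= r.
Proof.
move=> Hj zr; exists (`|z| / (rho j)%:C%C).
  by rewrite ltr_pdivrMr ?mul1r // ltcR rho_gt0.
by move=> u Tu; rewrite normrM normfV Tu.1.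
Qed.

Lemma zeta_neq0 (z : C) j u : (0 < j <= m)%N -> `|z| < (rho j)%:C%C -> T u ->
  1 - z / u j != 0.
Proof.
move=> Hj zr Tu; have [r r1 Hr] := zeta_lt Hj zr.
rewrite subr_eq0; apply/eqP => E; have := Hr u Tu; rewrite -E normr1.
by move=> /le_lt_trans /(_ r1); rewrite ltxx.
Qed.

Lemma zetaE (z : C) j u : (0 < j <= m)%N -> `|z| < (rho j)%:C%C -> T u ->
  u j != z /\ zeta z j u = u j / (u j - z).
Proof.
move=> Hj zr Tu; have u0 := torus_neq0 Tu Hj; have H := zeta_neq0 Hj zr Tu.
have uz : u j - z != 0.
  apply: contraNneq H => /eqP; rewrite subr_eq0 => /eqP <-.
  by rewrite mulfV ?subrr.
split; first by rewrite -subr_eq0.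
by rewrite /zeta; field; rewrite ?u0 ?uz.
Qed.

Lemma zetaS (z : C) j u : (0 < j <= m)%N -> `|z| < (rho j)%:C%C -> T u ->
  zeta z j u = 1 + z * u j ^ (- 1) * zeta z j u.
Proof.
move=> Hj zr Tu; have u0 := torus_neq0 Tu Hj.
have [uz ->] := zetaE Hj zr Tu; rewrite exprN1.
have uz' : u j - z != 0 by rewrite subr_eq0.
by field; rewrite ?u0 ?uz'.
Qed.

Lemma deg_zeta W (z : C) j : (0 < j <= m)%N -> `|z| < (rho j)%:C%C ->
  (forall om, W om -> 0 <= wt om j) -> deg W (fun=> 0) (zeta z j).
Proof.
move=> Hj zr HW; have [r r1 Hr] := zeta_lt Hj zr.
apply: ldeg_geo r1 Hr => //.
apply: (@ldeg_ext _ _ _ _ _ _ (fun u => z * u j ^ (- 1))).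
  by move=> u _; rewrite exprN1.
apply: (@ldeg_le _ _ _ _ W _ (fun om => 0 + wt om j * (- 1))).
  by move=> om Hom; rewrite add0r mulrN1 oppr_le0 HW.
by apply: ldegM => //; [exact: ldeg_cst | apply: deg_var].
Qed.

Definition deg1 om (z : int) f := deg (eq om) (fun=> z) f.

Lemma deg1W W c om z f : W om -> c om <= z -> deg W c f -> deg1 om z f.
Proof. by move=> H1 H2; apply: ldeg_le => om' <-. Qed.

Lemma deg1M om z z' f g : deg1 om z f -> deg1 om z' g ->
  deg1 om (z + z') (fun u => f u * g u).
Proof. by move=> H1 H2; apply: (ldegM rho_gt0 H1 H2). Qed.

Lemma deg1_le om z z' f : z <= z' -> deg1 om z f -> deg1 om z' f.
Proof. by move=> H; apply: ldeg_le. Qed.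

Lemma deg1_prod om (I : eqType) (r : seq I) (f_ : I -> (nat -> C) -> C) :
  (forall i, i \in r -> deg1 om 0 (f_ i)) ->
  deg1 om 0 (fun u => \prod_(i <- r) f_ i u).
Proof.
move=> H; have := ldeg_prod rho_gt0 (c_ := fun _ _ => 0) H.
by apply: ldeg_le => om' Hom'; rewrite big1_eq.
Qed.

Lemma deg1_ct0 om z f : deg1 om z f -> z < 0 -> ct f = 0.
Proof. by move=> H z0; apply: (ct_deg0 rho_gt0 H (erefl om)). Qed.

Lemma deg1_lap om z f : deg1 om z f -> lap f.
Proof. exact: ldeg_lapprox. Qed.

Definition win (a b : nat) : nat -> int := fun i => if (a < i < b)%N then 1 else 0.

Lemma wt_win a b i : 0 <= wt (win a b) i <= 1.
Proof. by rewrite /wt /win; case: ifP => //; case: ifP. Qed.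

Lemma deg1_ratio a b j : (0 < j <= m)%N -> (a < j < b)%N || ((j.+1 < b)%N ==> (j.+1 <= a)%N) && ((j <= a)%N || (b < j)%N) ->
  deg1 (win a b) 0 (fun u => u j / kap u j).
Proof.
move=> Hj H; apply: deg_ratio => // om <-.
have E : (a < j < b)%N -> wt (win a b) j = 1 by rewrite /wt Hj /win => ->.
case/orP: H => [/E ->|H]; first by have /andP[_ ->] := wt_win a b j.-1; have /andP[_ ->] := wt_win a b j.+1.
rewrite /wt /win; do ![case: ifP => //]; lia.
Qed.

(** With no weight to test, only boundedness and approximability by Laurent polynomials remain. *)
Definition nice f := deg (fun=> False) (fun=> 0) f.

Lemma deg_nice W c f : deg W c f -> nice f.
Proof. exact: ldeg_le. Qed.

Lemma nice_lap f : nice f -> lap f.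
Proof. exact: ldeg_lapprox. Qed.

Lemma niceM f g : nice f -> nice g -> nice (fun u => f u * g u).
Proof. by move=> Hf Hg; exact: deg_nice (ldegM rho_gt0 Hf Hg). Qed.

Lemma niceD f g : nice f -> nice g -> nice (fun u => f u + g u).
Proof. exact: ldegD. Qed.

Lemma nice_cst (a : C) : nice (fun=> a).
Proof. exact: ldeg_cst. Qed.

Lemma nice_var i (z : int) : nice (fun u => u i ^ z).
Proof. exact: deg_var. Qed.

Lemma nice_ratio j : (0 < j <= m)%N -> nice (fun u => u j / kap u j).
Proof. by move=> Hj; exact: deg_ratio. Qed.

Lemma nice_prod (I : eqType) (r : seq I) (f_ : I -> (nat -> C) -> C) :
  (forall i, i \in r -> nice (f_ i)) ->
  nice (fun u => \prod_(i <- r) f_ i u).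
Proof. by move=> H; exact: deg_nice (ldeg_prod rho_gt0 H). Qed.

Lemma sum_kap u a n :
  \sum_(a.+1 <= j < a + n.+1) kap u j =
  u a.+1 - u a + u (a + n)%N - u (a + n.+1)%N.
Proof.
elim: n => [|n IHn]; first by rewrite addn1 big_geq // addn0; ring.
have -> : (a + n.+2 = (a + n.+1).+1)%N by lia.
rewrite big_nat_recr /=; last by lia.
by rewrite IHn /kap addnS /=; ring.
Qed.

(** [kap] is minus the discrete second difference. The value next to an end of the gap is thus the
    linear interpolation between both ends, corrected by [kap] with the weights of the discrete
    Green function. *)
Lemma gap_identity u a n :
  n.+1%:R * u a.+1 = n%:R * u a + u (a + n.+1)%N +
    \sum_(a.+1 <= j < a + n.+1) (a + n.+1 - j)%:R * kap u j :> C.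
Proof.
elim: n => [|n IHn]; first by rewrite addn1 big_geq //; ring.
have -> : \sum_(a.+1 <= j < a + n.+2) (a + n.+2 - j)%:R * kap u j =
    \sum_(a.+1 <= j < a + n.+1) (a + n.+1 - j)%:R * kap u j +
    \sum_(a.+1 <= j < a + n.+2) kap u j.
  have -> : (a + n.+2 = (a + n.+1).+1)%N by lia.
  rewrite big_nat_recr /=; last by lia.
  rewrite [X in _ = _ + X]big_nat_recr /=; last by lia.
  rewrite addrA -big_split /=; congr (_ + _); last by rewrite subSnn mul1r.
  apply: eq_big_nat => j /andP[_ jn].
  have -> : ((a + n.+1).+1 - j = (a + n.+1 - j).+1)%N by lia.
  by rewrite -natr1 mulrDl mul1r.
have -> : n.+2%:R * u a.+1 = n.+1%:R * u a.+1 + u a.+1 by rewrite -[n.+2]addn1 natrD mulrDl mul1r.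
by rewrite IHn sum_kap -[n.+1%:R]natr1; ring.
Qed.

Lemma gap_identity_rev u a n :
  n.+1%:R * u (a + n)%N = n%:R * u (a + n.+1)%N + u a +
    \sum_(a.+1 <= j < a + n.+1) (j - a)%:R * kap u j :> C.
Proof.
have -> : \sum_(a.+1 <= j < a + n.+1) (j - a)%:R * kap u j =
    n.+1%:R * (\sum_(a.+1 <= j < a + n.+1) kap u j) -
    \sum_(a.+1 <= j < a + n.+1) (a + n.+1 - j)%:R * kap u j.
  rewrite mulr_sumr -sumrB; apply: eq_big_nat => j /andP[aj jn].
  rewrite -mulrBl -natrB; last by lia.
  by congr (_%:R * _); lia.
have := gap_identity u a n; rewrite sum_kap.
set S := \sum_(_ <= j < _) _ => E.
have -> : S = n.+1%:R * u a.+1 - (n%:R * u a + u (a + n.+1)%N) by rewrite E; ring.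
by rewrite -[n.+1%:R]natr1; ring.
Qed.

(** Induction on the gap length. Writing 1 as [u_(a+1)^(-1) * u_(a+1)] and expanding the second
    factor by [gap_identity], the two end terms and all [kap_j] with [j > a + 1] vanish by degree.
    The term [j = a + 1] removes the first kernel and leaves a gap shorter by one; its coefficient
    cancels the denominator given by the induction hypothesis. *)
Lemma ct_gap n a f : (a + n.+1 <= m.+1)%N ->
  deg (Wsup (fun i => a < i < a + n.+1)%N) (fun=> 0) f ->
  ct (fun u => f u * \prod_(a.+1 <= i < a + n.+1) (u i / kap u i)) =
  ct f / n.+1%:R.
Proof.
elim: n a => [|n IHn] a Hb Hf.
  rewrite divr1; apply: ct_ext => //; last first.
    apply/nice_lap/niceM; first exact: deg_nice Hf.
    by apply: nice_prod => i; rewrite mem_index_iota; lia.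
  by move=> u _; rewrite big_geq ?addn1 // mulr1.
set b := (a + n.+2)%N in Hb Hf *.
have Ha1 : (0 < a.+1 <= m)%N by lia.
have nf := deg_nice Hf.
pose Q u j := \prod_(i <- [seq i <- index_iota a.+1 b | i != j]) (u i / kap u i).
have nQ j : nice (Q^~ j).
  by apply: nice_prod => i; rewrite mem_filter mem_index_iota => Hi; apply: nice_ratio; lia.
pose X j u := f u * (u a.+1 ^ (- 1) * (u j ^ 1 * Q u j)).
have nX j : nice (X j).
  by do ![apply: niceM => //]; exact: nice_var.
pose B u := \prod_(a.+1 <= i < b) (u i / kap u i).
have nB : nice B.
  by apply: nice_prod => i; rewrite mem_index_iota => Hi; apply: nice_ratio; lia.
pose Y (l : nat) u := f u * (u a.+1 ^ (- 1) * (u l ^ 1 * B u)).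
have nY l : nice (Y l).
  by do ![apply: niceM => //]; exact: nice_var.
have fwin j : (j <= b)%N -> deg1 (win a j) 0 f.
  move=> jb; apply: deg1W Hf => // i; rewrite /win; case: ifP => //; lia.
have wt1 j : (a.+1 < j)%N -> wt (win a j) a.+1 = 1.
  by move=> H; rewrite /wt Ha1 /win ltnSn H.
(* Once the kernel at [j] is cancelled, the weight of the window between [a] and [j] gives every
   remaining kernel degree at most 0, while [u_(a+1)^(-1)] has degree -1. *)
have X0 j : (a.+1 < j < b)%N -> ct (X j) = 0.
  move=> /andP[aj jb]; apply: (@deg1_ct0 (win a j) (0 + (- 1 + (0 + 0)))) => //.
  apply: deg1M; first by apply: fwin; exact: ltnW.
  apply: deg1M; first by apply: deg_var => om <-; rewrite wt1.
  apply: deg1M; first by apply: deg_var => om <-; rewrite /wt /win ltnn andbF if_same.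
  apply: deg1_prod => i; rewrite mem_filter mem_index_iota => Hi.
  by apply: deg1_ratio; lia.
have Y0 l : (l <= a)%N || (b <= l)%N -> ct (Y l) = 0.
  move=> Hl; apply: (@deg1_ct0 (win a b) (0 + (- 1 + (0 + 0)))) => //.
  apply: deg1M; first exact: fwin.
  apply: deg1M; first by apply: deg_var => om <-; rewrite wt1 //; lia.
  apply: deg1M.
    apply: deg_var => om <-; rewrite /wt /win; case: ifP => // _.
    by case: ifP => //; lia.
  apply: deg1_prod => i; rewrite mem_index_iota => Hi.
  by apply: deg1_ratio; lia.
have X1 : ct (X a.+1) = ct f / n.+1%:R.
  rewrite -(IHn a.+1); first last.
  - by apply: ldeg_le Hf => om Hom; split=> // i Hi; apply: Hom; move: Hi; lia.
  - by lia.
  apply: ct_ext => //; last exact: nice_lap.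
  move=> u Tu; rewrite /X exprN1 expr1z mulKf; last exact: torus_neq0.
  congr (_ * _); rewrite /Q big_filter addSnnS -/b.
  rewrite (big_ltn_cond (m := a.+1)); last by lia.
  rewrite eqxx /= [LHS]big_nat_cond [RHS]big_nat_cond; apply: eq_bigl => i.
  by apply/andP/andP => -[H1 H2]; split=> //; move: H1; lia.
have key : n.+2%:R * ct (fun u => f u * B u) = ct f.
  rewrite -ctZ //; last by apply/nice_lap/niceM.
  have E u : T u -> n.+2%:R * (f u * B u) =
     (n.+1%:R * Y a u + Y b u) +
     \sum_(j <- index_iota a.+1 b) (b - j)%:R * X j u.
    move=> Tu; have u0 := torus_neq0 Tu Ha1.
    have G := gap_identity u a n.+1; rewrite -/b in G.
    have -> : n.+2%:R * (f u * B u) =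
        f u * (u a.+1 ^ (- 1) * (n.+2%:R * u a.+1 * B u)).
      by rewrite exprN1; field.
    rewrite G !mulrDl !mulrDr /Y !expr1z; congr (_ + _).
      by congr (_ + _); ring.
    rewrite mulr_suml !mulr_sumr; apply: eq_big_seq => j.
    rewrite mem_index_iota => Hj; rewrite /X expr1z.
    have -> : B u = u j / kap u j * Q u j.
      by rewrite /B /Q (bigD1_seq j) ?mem_index_iota ?iota_uniq //= big_filter.
    have Hjm : (0 < j <= m)%N by lia.
    have k0 := kap_neq0 Tu Hjm; move: (kap u j) k0 => K k0.
    by move: (u a.+1 ^ (- 1)) (Q u j) (u j) => x y z; field.
  rewrite (ct_ext rho_gt0 E); last by apply/nice_lap/niceM; [exact: nice_cst | exact: niceM].
  have nYs : nice (fun u => n.+1%:R * Y a u + Y b u).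
    by apply: niceD => //; apply: niceM => //; exact: nice_cst.
  have nXs j : nice (fun u => (b - j)%:R * X j u).
    by apply: niceM => //; exact: nice_cst.
  rewrite ctD //; first last.
  - by apply: lap_sum => j _; exact: nice_lap.
  - exact: nice_lap.
  rewrite ctD //; first last.
  - exact: nice_lap.
  - by apply/nice_lap/niceM => //; exact: nice_cst.
  rewrite ctZ //; last exact: nice_lap.
  rewrite !Y0 ?leqnn ?orbT // mulr0 !add0r.
  rewrite ct_sum //; last by move=> j _; exact: nice_lap.
  rewrite big_ltn; last by lia.
  rewrite ctZ //; last exact: nice_lap.
  rewrite X1 big_seq big1 ?addr0.
    have -> : (b - a.+1 = n.+1)%N by lia.
    by rewrite mulrC divfK // pnatr_eq0.
  move=> j; rewrite mem_index_iota => Hj.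
  by rewrite ctZ //; [rewrite X0 ?mulr0 //; lia | exact: nice_lap].
by rewrite -key mulrAC mulfV ?mul1r // pnatr_eq0.
Qed.

Lemma deg_zetaB1 (z : C) j om : (0 < j <= m)%N -> `|z| < (rho j)%:C%C ->
  wt om j = 1 -> deg1 om (- 1) (fun u => zeta z j u - 1).
Proof.
move=> Hj zr omj.
apply: (@ldeg_ext _ _ _ _ _ _ (fun u => z * (u j ^ (- 1) * zeta z j u))).
  by move=> u Tu; rewrite [in RHS](zetaS Hj zr Tu); ring.
apply: (@deg1_le _ (0 + (- 1 + 0))) => //.
apply: deg1M; first exact: ldeg_cst.
apply: deg1M; first by apply: deg_var => _ <-; rewrite omj.
by apply: deg_zeta => // _ <-; rewrite omj.
Qed.

(** Each [zeta] may be replaced by 1: the difference has degree -1 for the weight of the window,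
    where all the other factors have degree at most 0. *)
Lemma ct_gap_zeta n a f (z : nat -> C) : (a + n.+1 <= m.+1)%N ->
  (forall i, (a < i < a + n.+1)%N -> `|z i| < (rho i)%:C%C) ->
  deg (Wsup (fun i => a < i < a + n.+1)%N) (fun=> 0) f ->
  ct (fun u => f u * \prod_(a.+1 <= i < a + n.+1) (u i / kap u i * zeta (z i) i u)) =
  ct f / n.+1%:R.
Proof.
move=> Hb Hz Hf; rewrite -(ct_gap Hb Hf); set b := (a + n.+1)%N in Hb Hz Hf *.
have nf := deg_nice Hf.
have fwin : deg1 (win a b) 0 f.
  by apply: deg1W Hf => // i; rewrite /win; case: ifP => //; lia.
pose om := win a b.
have r0 i : (a < i < b)%N -> deg1 om 0 (fun u => u i / kap u i).
  by move=> Hi; apply: deg1_ratio; lia.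
have om1 i : (a < i < b)%N -> wt om i = 1.
  by move=> Hi; rewrite /wt /om /win Hi ifT //; lia.
have z0 i : (a < i < b)%N -> deg1 om 0 (zeta (z i) i).
  by move=> Hi; apply: deg_zeta => [||_ <-]; rewrite ?om1 ?Hz //; lia.
have D (r : seq nat) : (forall i, i \in r -> (a < i < b)%N) ->
  deg1 om (- 1) (fun u => \prod_(i <- r) (u i / kap u i * zeta (z i) i u) -
                         \prod_(i <- r) (u i / kap u i)).
  elim: r => [|i r IHr] Hr.
    apply: (@ldeg_ext _ _ _ _ _ _ (fun=> 0)); first by move=> u _; rewrite !big_nil subrr.
    apply: (@ldeg_ext _ _ _ _ _ _ (fun u => \sum_(i <- [::] : seq nat) (0 : C))); first by move=> u _; rewrite big_nil.
    exact: ldeg_sum.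
  have Hi : (a < i < b)%N by apply: Hr; rewrite mem_head.
  have Hr' l : l \in r -> (a < l < b)%N by move=> Hl; apply: Hr; rewrite inE Hl orbT.
  apply: (@ldeg_ext _ _ _ _ _ _ (fun u =>
    (u i / kap u i * zeta (z i) i u) *
     (\prod_(i <- r) (u i / kap u i * zeta (z i) i u) - \prod_(i <- r) (u i / kap u i)) +
    (\prod_(i <- r) (u i / kap u i)) * (u i / kap u i * (zeta (z i) i u - 1)))).
    by move=> u _; rewrite !big_cons; ring.
  apply: ldegD.
    apply: (@deg1_le _ ((0 + 0) + (- 1))) => //.
    by apply: deg1M (IHr Hr'); apply: deg1M; [exact: r0 | exact: z0].
  apply: (@deg1_le _ (0 + (0 + (- 1)))) => //.
  apply: deg1M; first by apply: deg1_prod => l Hl; apply: r0; exact: Hr'.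
  apply: deg1M; first exact: r0.
  by apply: deg_zetaB1; rewrite ?om1 ?Hz //; lia.
have HD : deg1 om (0 + (- 1)) (fun u => f u * (\prod_(a.+1 <= i < b) (u i / kap u i * zeta (z i) i u) -
                         \prod_(a.+1 <= i < b) (u i / kap u i))).
  by apply: deg1M fwin (D _ _) => i; rewrite mem_index_iota.
have H0 := deg1_ct0 HD isT.
have nB : nice (fun u => f u * \prod_(a.+1 <= i < b) (u i / kap u i)).
  apply: niceM => //; apply: nice_prod => i; rewrite mem_index_iota => Hi.
  by apply: nice_ratio; lia.
rewrite -[RHS]addr0 -[X in _ = _ + X]H0 -ctD //; first last.
- exact: deg1_lap HD.
- exact: nice_lap.
apply: ct_ext => //; last first.
  apply/nice_lap/niceM => //; apply: nice_prod => i; rewrite mem_index_iota => Hi.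
  by apply: niceM; [apply: nice_ratio; lia | exact: deg_nice (z0 _ Hi)].
by move=> u _; ring.
Qed.

(** Evaluation at [u_i = z] of a function free of [u_i]. One step of the geometric series lowers the
    power of [u_i] and produces a factor [z]; the leftover pure positive power of [u_i] has no
    constant term. *)
Lemma ct_zeta (M i : nat) (z : C) f : (0 < i <= m)%N -> `|z| < (rho i)%:C%C ->
  deg (Wsup (pred1 i)) (fun=> 0) f ->
  ct (fun u => f u * (u i ^+ M * zeta z i u)) = z ^+ M * ct f.
Proof.
move=> Hi Hz Hf; have nf := deg_nice Hf.
have nz : nice (zeta z i) by exact: deg_zeta.
have f1 s : deg1 (delta i s) 0 f.
  by apply: deg1W Hf => // l; rewrite /delta /= => /negbTE ->.
have wts s : wt (delta i s) i = s by rewrite /wt Hi /delta eqxx.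
elim: M => [|M IHM].
  rewrite expr0 mul1r.
  have HD : deg1 (delta i 1) (0 + (- 1)) (fun u => f u * (zeta z i u - 1)).
    by apply: deg1M => //; apply: deg_zetaB1.
  rewrite -[RHS]addr0 -[X in _ = _ + X](deg1_ct0 HD isT) -ctD //; first last.
  - exact: deg1_lap HD.
  - exact: nice_lap.
  apply: ct_ext => //; last by apply/nice_lap/niceM => //; apply: niceM => //; exact: nice_cst.
  by move=> u _; rewrite expr0; ring.
have HD : deg1 (delta i (- 1)) (0 + - M.+1%:Z) (fun u => f u * u i ^ M.+1%:Z).
  by apply: deg1M => //; apply: deg_var => _ <-; rewrite wts mulN1r.
have E : z ^+ M.+1 * ct f = z * ct (fun u => f u * (u i ^+ M * zeta z i u)).
  by rewrite IHM exprS mulrA.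
have nX : nice (fun u => f u * (u i ^+ M * zeta z i u)).
  by apply: niceM => //; apply: niceM => //; exact: (nice_var i M%:Z).
rewrite E -ctZ //; last exact: nice_lap.
rewrite -[RHS]add0r -[X in _ = X + _](deg1_ct0 HD) // -ctD //; first last.
- by apply/nice_lap/niceM => //; exact: nice_cst.
- exact: deg1_lap HD.
apply: ct_ext => //; last by apply/nice_lap/niceM => //; apply: niceM => //; exact: (nice_var i M.+1%:Z).
move=> u Tu; have u0 := torus_neq0 Tu Hi.
rewrite [in LHS](zetaS Hi Hz Tu) exprN1 -exprnP exprS; field.
exact: u0.
Qed.

End Kernels.

(** * The normal form of the product of the inner variables *)

Section NormalForm.
Variable R : realType.
Local Notation C := R[i].
Implicit Types (u : nat -> C) (f g : (nat -> C) -> C) (e : nat -> nat).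
Implicit Types (s : seq (rat * (nat -> nat))).

(* In the integral of Poly_d the kernel at u_j, when present, is cancelled    *)
(* against the one of the integrand, so nfb d e contributes a multiple of the *)
(* monomial with exponents e.                                                 *)
Definition nfb d e u : C :=
  u 0%N ^+ e 0%N * u d ^+ e d *
  \prod_(1 <= j < d) (if (0 < e j)%N then kap u j * u j ^+ (e j).-1 else 1).

Definition incr e l : nat -> nat := fun i => (e i + (i == l))%N.

Definition edeg d e : nat := \sum_(0 <= i < d.+1) e i.

Definition all_edeg d (n : nat) s : bool := all (fun t => edeg d t.2 == n) s.

Definition nspan d n f : Prop :=
  exists2 s, all_edeg d n s &
    forall u, f u = \sum_(t <- s) ratr t.1 * nfb d t.2 u.

Lemma edeg_incr d e l : (l <= d)%N -> edeg d (incr e l) = (edeg d e).+1.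
Proof.
move=> ld; rewrite /edeg big_split /= -[RHS]addn1; congr (_ + _)%N.
rewrite (bigD1_seq l) ?mem_index_iota ?iota_uniq //= eqxx big1 //.
by move=> i /negbTE ->.
Qed.

Lemma nfb_incr0 d e u : (0 < d)%N -> nfb d (incr e 0) u = u 0%N * nfb d e u.
Proof.
move=> d0; rewrite /nfb /incr /= addn1 [(d == 0)%N]gtn_eqF // addn0 exprS -!mulrA.
congr (_ * (_ * (_ * _))); apply: eq_big_nat => j /andP[j1 _].
by rewrite [(j == 0)%N]gtn_eqF // addn0.
Qed.

Lemma nfb_incrd d e u : (0 < d)%N -> nfb d (incr e d) u = u d * nfb d e u.
Proof.
move=> d0; rewrite /nfb /incr eqxx addn1 [(0 == d)%N]ltn_eqF // addn0 exprS.
rewrite !mulrA [u d * _]mulrC; congr (_ * _); apply: eq_big_nat => j /andP[_ jd].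
by rewrite [(j == d)%N]ltn_eqF // addn0.
Qed.

Lemma nfb_incr d e u l : (0 < l < d)%N ->
  nfb d (incr e l) u = (if (0 < e l)%N then u l else kap u l) * nfb d e u.
Proof.
move=> /andP[l0 ld]; rewrite /nfb /incr.
rewrite [(0 == l)%N]ltn_eqF // [(d == l)%N]gtn_eqF // !addn0 mulrCA; congr (_ * _).
rewrite !(bigD1_seq l) ?mem_index_iota ?iota_uniq ?l0 //= eqxx addn1 /= mulrA.
congr (_ * _); last by apply: eq_bigr => j /negbTE ->; rewrite addn0.
case: (e l) => [|n] /=; first by rewrite expr0 !mulr1.
by rewrite exprS mulrCA.
Qed.

Lemma nspan_ext d n f g : (forall u, f u = g u) -> nspan d n f -> nspan d n g.
Proof. by move=> fg [s Hs Hf]; exists s => // u; rewrite -fg. Qed.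

Lemma nspan_base d e : nspan d (edeg d e) (nfb d e).
Proof.
exists [:: (1, e)]; first by rewrite /all_edeg /= eqxx.
by move=> u; rewrite big_seq1 rmorph1 mul1r.
Qed.

Lemma nspan0 d n : nspan d n (fun=> 0).
Proof. by exists [::] => // u; rewrite big_nil. Qed.

Lemma nspanD d n f g : nspan d n f -> nspan d n g ->
  nspan d n (fun u => f u + g u).
Proof.
move=> [s Hs Hf] [s' Hs' Hg]; exists (s ++ s'); first by rewrite /all_edeg all_cat; apply/andP.
by move=> u; rewrite big_cat Hf Hg.
Qed.

Lemma nspanZ d n (a : rat) f : nspan d n f -> nspan d n (fun u => ratr a * f u).
Proof.
move=> [s Hs Hf]; exists [seq (a * t.1, t.2) | t <- s].
  by rewrite /all_edeg all_map.
move=> u; rewrite Hf big_map mulr_sumr; apply: eq_bigr => t _ /=.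
by rewrite rmorphM mulrA.
Qed.

Lemma nspan_sum d n (I : eqType) (r : seq I) (f_ : I -> (nat -> C) -> C) :
  (forall i, i \in r -> nspan d n (f_ i)) ->
  nspan d n (fun u => \sum_(i <- r) f_ i u).
Proof.
elim: r => [|i r IHr] H.
  by apply: nspan_ext (nspan0 _ _) => u; rewrite big_nil.
apply: (@nspan_ext _ _ (fun u => f_ i u + \sum_(i <- r) f_ i u)).
  by move=> u; rewrite big_cons.
apply: nspanD; first by apply: H; rewrite mem_head.
by apply: IHr => l Hl; apply: H; rewrite inE Hl orbT.
Qed.

(** If [j] is an end or already carries an exponent, multiplication just raises that exponent.
    Otherwise [u j] is rewritten by the linear relations among the variables and the [kap], each
    [kap] being taken at an index that does not yet carry one. *)
Lemma nspan_mulv_base d e j : (0 < d)%N -> (j <= d)%N ->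
  nspan d (edeg d e).+1 (fun u => u j * nfb d e u).
Proof.
move=> d0; have [n] := ubnP j; elim: n j => // n IHn j; rewrite ltnS => jn jd.
have node i : (i <= d)%N -> (i == 0%N) || (i == d) || (0 < e i)%N ->
    nspan d (edeg d e).+1 (fun u => u i * nfb d e u).
  move=> id Hi; rewrite -(edeg_incr e id).
  apply: nspan_ext (nspan_base d (incr e i)) => u.
  have [->|i0] := eqVneq i 0%N; first exact: nfb_incr0.
  have [->|id'] := eqVneq i d; first exact: nfb_incrd.
  rewrite (negbTE i0) (negbTE id') /= in Hi.
  by rewrite nfb_incr ?Hi // lt0n i0 ltn_neqAle id' id.
have [Hj|] := boolP ((j == 0%N) || (j == d) || (0 < e j)%N); first exact: node.
rewrite !negb_or => /andP[/andP[j0 jd'] ej].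
have kapn i : (0 < i < d)%N -> ~~ (0 < e i)%N ->
    nspan d (edeg d e).+1 (fun u => kap u i * nfb d e u).
  move=> Hi ei; rewrite -(@edeg_incr d e i); last by lia.
  apply: nspan_ext (nspan_base d (incr e i)) => u.
  by rewrite nfb_incr // (negbTE ei).
case: j => // i in jn jd j0 jd' ej *.
(* If the preceding index is not a node either, the definition of [kap u i] expresses [u i.+1] by
   variables of smaller index. *)
have [/andP[i0 ei]|Hi] := boolP ((0 < i)%N && ~~ (0 < e i)%N).
  have Hk : nspan d (edeg d e).+1 (fun u => kap u i * nfb d e u).
    by apply: kapn => //; rewrite i0.
  have H1 := IHn i jn (ltnW jd).
  have H2 : nspan d (edeg d e).+1 (fun u => u i.-1 * nfb d e u).
    by apply: IHn; lia.
  have H := nspanD (nspanZ 2 H1) (nspanD (nspanZ (- 1) H2) (nspanZ (- 1) Hk)).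
  apply: nspan_ext H => u; rewrite /kap rmorphN rmorph1 rmorph_nat; ring.
have Hi' : (i == 0%N) || (i == d) || (0 < e i)%N by move: Hi; case: (i); lia.
have exb : exists b, (i.+1 < b)%N && ((b == d) || (0 < e b)%N).
  by exists d; rewrite eqxx ltn_neqAle jd' jd.
(* Here [i] is a node; with [b] the next node, [gap_identity] involves only [u i], [u b] and the
   [kap] strictly between them. *)
case: (ex_minnP exb) => b /andP[ib Hb] bmin.
have bd : (b <= d)%N by apply: bmin; rewrite eqxx ltn_neqAle jd' jd.
have [k bE] : exists k, b = (i + k.+1)%N by exists (b - i).-1; lia.
have Hnode l : (i < l < b)%N -> ~~ (0 < e l)%N.
  move=> /andP[il lb]; have [->//|li] := eqVneq l i.+1.
  apply/negP => el; have := bmin l; rewrite el orbT andbT => /(_ _); lia.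
have Hu : nspan d (edeg d e).+1 (fun u => u i * nfb d e u) by apply: node => //; lia.
have Hub : nspan d (edeg d e).+1 (fun u => u b * nfb d e u).
  by apply: node => //; case/orP: Hb => ->; rewrite ?orbT.
have Hs : nspan d (edeg d e).+1
    (fun u => \sum_(l <- index_iota i.+1 b) ratr (b - l)%:R * (kap u l * nfb d e u)).
  apply: nspan_sum => l; rewrite mem_index_iota => Hl; apply: nspanZ.
  by apply: kapn; [lia | exact: Hnode].
have H := nspanZ (k.+1%:R^-1) (nspanD (nspanD (nspanZ k%:R Hu) Hub) Hs).
apply: nspan_ext H => u; rewrite fmorphV !rmorph_nat.
apply: (mulfI (_ : k.+1%:R != 0)); first by rewrite pnatr_eq0.
rewrite mulrA mulfV ?pnatr_eq0 // mul1r [RHS]mulrA gap_identity -bE.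
rewrite [RHS]mulrDl [X in _ = X + _]mulrDl mulrA mulr_suml; congr (_ + _).
by apply: eq_big_seq => l _; rewrite rmorph_nat mulrA.
Qed.

Lemma nspan_mulv d n f j : (0 < d)%N -> (j <= d)%N -> nspan d n f ->
  nspan d n.+1 (fun u => u j * f u).
Proof.
move=> d0 jd [s Hs Hf].
apply: (@nspan_ext _ _ (fun u => \sum_(t <- s) ratr t.1 * (u j * nfb d t.2 u))).
  by move=> u; rewrite Hf mulr_sumr; apply: eq_bigr => t _; rewrite mulrCA.
elim: s Hs {Hf} => [|t s IHs] /=.
  by move=> _; apply: nspan_ext (nspan0 _ _) => u; rewrite big_nil.
move=> /andP[/eqP Ht Hs].
apply: (@nspan_ext _ _ (fun u => ratr t.1 * (u j * nfb d t.2 u) +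
    \sum_(t <- s) ratr t.1 * (u j * nfb d t.2 u))).
  by move=> u; rewrite big_cons.
apply: nspanD (IHs Hs); apply: nspanZ; rewrite -Ht.
exact: nspan_mulv_base.
Qed.

Lemma prod_normal_form d : (0 < d)%N ->
  exists2 s, all_edeg d d.-1 s &
    forall u, \prod_(1 <= j < d) u j = \sum_(t <- s) ratr t.1 * nfb d t.2 u.
Proof.
move=> d0; suff H n : (n < d)%N -> nspan d n (fun u => \prod_(1 <= j < n.+1) u j).
  by have [|s Hs E] := H d.-1; [lia | exists s => // u; rewrite -E prednK].
elim: n => [|n IHn] nd.
  apply: (@nspan_ext _ _ (nfb d (fun=> 0%N))).
    by move=> u; rewrite /nfb /= !expr0 !mul1r big1 ?big_geq.
  have E : edeg d (fun=> 0%N) = 0%N by rewrite /edeg big1.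
  by have := nspan_base d (fun=> 0%N); rewrite E.
apply: (@nspan_ext _ _ (fun u => u n.+1 * \prod_(1 <= j < n.+1) u j)).
  by move=> u; rewrite [RHS]big_nat_recr //= mulrC.
by apply: nspan_mulv (IHn _); lia.
Qed.

End NormalForm.

(** * Nodes and gaps of an exponent vector *)

Section Nodes.
Variables (d : nat) (e : nat -> nat).
Hypothesis d_gt0 : (0 < d)%N.

Definition nodes : seq nat := 0%N :: rcons [seq j <- iota 1 d.-1 | (0 < e j)%N] d.

Definition node (p : nat) : nat := nth 0%N nodes p.

Definition nlen : nat := (size nodes).-1.

Lemma nlen_gt0 : (0 < nlen)%N. Proof. by rewrite /nlen /= size_rcons. Qed.

Lemma node0 : node 0 = 0%N. Proof. by []. Qed.

Lemma node_last : node nlen = d.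
Proof. by rewrite /node /nlen nth_last /= last_rcons. Qed.

Lemma mem_nodes j : (j \in nodes) = (j == 0%N) || (j == d) || (0 < j < d)%N && (0 < e j)%N.
Proof.
rewrite inE mem_rcons inE mem_filter mem_iota -orbA; do 2!congr (_ || _).
by rewrite andbC; congr (_ && _); lia.
Qed.

Lemma sorted_nodes : sorted ltn nodes.
Proof.
rewrite /nodes /= rcons_path.
have H : path ltn 0%N [seq j <- iota 1 d.-1 | (0 < e j)%N].
  have := sorted_filter ltn_trans (fun j => (j == 0%N) || (0 < e j)%N) (iota_ltn_sorted 0 d.-1.+1).
  rewrite /= (@eq_in_filter _ (fun j => (j == 0%N) || (0 < e j)%N) (fun j => 0 < e j)%N) // => j.
  by rewrite mem_iota; case: j.
rewrite H /=; set s := [seq _ <- _ | _].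
have : last 0%N s \in 0%N :: s by exact: mem_last.
rewrite inE => /orP[/eqP ->//|]; rewrite mem_filter mem_iota; lia.
Qed.

Lemma node_lt p q : (p < q)%N -> (q <= nlen)%N -> (node p < node q)%N.
Proof.
move=> pq ql; apply: (sorted_ltn_nth ltn_trans 0%N sorted_nodes) => //.
by rewrite inE; move: ql; rewrite /nlen /= size_rcons; lia.
Qed.

Lemma node_le p : (p <= nlen)%N -> (node p <= d)%N.
Proof.
rewrite leq_eqVlt => /orP[/eqP ->|pl]; first by rewrite node_last.
by rewrite -[X in (_ <= X)%N]node_last ltnW // node_lt.
Qed.

Lemma node_interior p : (0 < p < nlen)%N ->
  (0 < node p < d)%N && (0 < e (node p))%N.
Proof.
move=> /andP[p0 pl].
have : node p \in nodes by apply: mem_nth; move: pl; rewrite /nlen /= size_rcons; lia.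
have n0 : (0 < node p)%N by rewrite -{1}node0 node_lt // ltnW.
have nd : (node p < d)%N by rewrite -[X in (_ < X)%N]node_last node_lt.
by rewrite mem_nodes n0 nd gtn_eqF // ltn_eqF.
Qed.

Lemma node_gap p j : (p < nlen)%N -> (node p < j < node p.+1)%N -> e j = 0%N.
Proof.
move=> pl /andP[pj jp]; apply/eqP; rewrite -leqn0 leqNgt; apply/negP => ej.
have jd : (j < d)%N by apply: leq_trans jp (node_le pl).
have : j \in nodes by rewrite mem_nodes ej jd (leq_ltn_trans _ pj) ?orbT.
move=> /(nthP 0%N) [q]; rewrite /= size_rcons => ql; rewrite -/(node q) => E.
have ql' : (q <= nlen)%N by rewrite /nlen /= size_rcons.
have [qp|pq] := leqP q p.
  have : (node q <= node p)%N.
    by move: qp; rewrite leq_eqVlt => /orP[/eqP ->//|/node_lt H]; apply/ltnW/H/ltnW.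
  by rewrite E leqNgt pj.
have : (node p.+1 <= node q)%N.
  by move: pq; rewrite leq_eqVlt => /orP[/eqP ->//|/node_lt H]; apply/ltnW/H.
by rewrite E leqNgt jp.
Qed.

End Nodes.

(** * Evaluation of the virtual polynomials *)

Section VirtualPolynomial.
Variable R : realType.
Local Notation C := R[i].

Definition gapprod d (e : nat -> nat) : nat :=
  \prod_(1 <= q < (nlen d e).+1) (node d e q - node d e q.-1)%N.

Lemma gapprod_gt0 d e : (0 < d)%N -> (0 < gapprod d e)%N.
Proof.
move=> d0; rewrite /gapprod big_seq; apply: prodn_cond_gt0 => q.
rewrite mem_index_iota => /andP[q0 ql]; rewrite subn_gt0.
by apply: (node_lt d0); lia.
Qed.

Section Evaluation.
Variables (d : nat) (v : nat -> C) (rho : nat -> R).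
Hypotheses (d_gt0 : (0 < d)%N) (vrho : virt_poly_radii d v rho).
Local Notation m := d.-1.
Local Notation T := (on_torus m rho v).
Local Notation ct f := (ctm m rho f v).
Local Notation deg W c f := (ldeg m rho v W c f).
Local Notation deg0 P f := (ldeg m rho v (Wsup P) (fun=> 0) f).

Let v_lt j : (0 < j <= m)%N -> `|v j| < (rho j)%:C%C.
Proof. by case: vrho => _ _ H Hj; have [|] := H j; first by lia. Qed.

Let rho_gt0 j : (0 < j <= m)%N -> 0 < rho j.
Proof. by move=> Hj; have := le_lt_trans (normr_ge0 _) (v_lt Hj); rewrite ltcR. Qed.

Let v_le j : (j <= m.+1)%N -> ~~ (0 < j <= m)%N -> `|v j| <= (rho j)%:C%C.
Proof.
move=> Hj1 Hj2; case: vrho => H0 Hd _.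
have [->|->] : j = 0%N \/ j = d by lia.
  by rewrite H0.
by rewrite Hd.
Qed.

Let concave j : (0 < j <= m)%N -> rho j.-1 + rho j.+1 < 2 * rho j.
Proof. by case: vrho => _ _ H Hj; have [|] := H j; first by lia. Qed.

Lemma deg0M P f g : deg0 P f -> deg0 P g -> deg0 P (fun u => f u * g u).
Proof. by move=> Hf Hg; exact: (ldegM rho_gt0 Hf Hg). Qed.

Lemma deg0_prod P (r : seq nat) (f_ : nat -> (nat -> C) -> C) :
  (forall i, i \in r -> deg0 P (f_ i)) -> deg0 P (fun u => \prod_(i <- r) f_ i u).
Proof.
move=> H; have := ldeg_prod rho_gt0 (c_ := fun _ _ => 0) H.
by apply: ldeg_le => om' Hom'; rewrite big1_eq.
Qed.

Section Chain.
Variable e : nat -> nat.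

(** At a node the kernel has been cancelled by the factor [kap u j] of [nfb], which leaves a power
    and a Cauchy kernel. *)
Definition vterm (j : nat) (u : nat -> C) : C :=
  if (0 < e j)%N then u j ^+ e j * zeta (v j) j u
  else u j / kap u j * zeta (v j) j u.

Lemma deg0_node P j n : ~~ P j -> (0 < j <= m)%N ->
  deg0 P (fun u => u j ^+ n * zeta (v j) j u).
Proof.
move=> Pj Hj; have om0 om : Wsup P om -> wt m om j = 0.
  by move=> Hom; rewrite /wt Hj Hom.
apply: deg0M; last by apply: deg_zeta => //; [exact: v_lt | move=> om /om0 ->].
by apply: (deg_var rho v (z := n%:Z)) => om /om0 ->; rewrite mul0r.
Qed.

Lemma deg0_vterm P j : ~~ P j -> ~~ P j.-1 -> ~~ P j.+1 -> (0 < j <= m)%N ->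
  deg0 P (vterm j).
Proof.
move=> Pj Pj1 Pj2 Hj; have [ej|ej] := boolP (0 < e j)%N.
  apply: (@ldeg_ext _ _ _ _ _ _ (fun u => u j ^+ e j * zeta (v j) j u)).
    by move=> u _; rewrite /vterm ej.
  exact: deg0_node.
apply: (@ldeg_ext _ _ _ _ _ _ (fun u => u j / kap u j * zeta (v j) j u)).
  by move=> u _; rewrite /vterm (negbTE ej).
have om0 i om : ~~ P i -> Wsup P om -> wt m om i = 0.
  by move=> Pi Hom; rewrite /wt Hom // if_same.
apply: deg0M.
  by apply: deg_ratio => // om Hom; rewrite !om0.
by apply: deg_zeta => //; [exact: v_lt | move=> om Hom; rewrite om0].
Qed.

(** The chain is integrated from its top end: [ct_gap_zeta] turns the last gap into the inverse of
    its length. The node below is then free of kernels, and [ct_zeta] replaces its variable by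
    [v]. *)
Lemma ct_chain p f : (p <= nlen d e)%N ->
  deg0 (fun i => i < node d e p)%N f ->
  ct (fun u => \prod_(1 <= j < node d e p) vterm j u * f u) =
  (\prod_(1 <= j < node d e p) v j ^+ e j) /
  (\prod_(1 <= q < p.+1) (node d e q - node d e q.-1))%N%:R * ct f.
Proof.
elim: p f => [|p IHp] f pl Hf.
  rewrite !big_geq // divr1 mul1r; apply: ct_ext => //.
    by move=> u _; rewrite big_geq // mul1r.
  apply: (@ldeg_lapprox _ _ _ _ (Wsup (fun i => i < node d e 0)%N) (fun=> 0)).
  apply: deg0M => //; apply: deg0_prod => i; rewrite mem_index_iota node0; lia.
set a := node d e p; set b := node d e p.+1 in Hf *.
have ab : (a < b)%N by apply: (node_lt d_gt0).
have bd : (b <= d)%N by apply: (node_le d_gt0).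
have [n bE] : exists n, b = (a + n.+1)%N by exists (b - a).-1; lia.
have egap j : (a < j < b)%N -> e j = 0%N by apply: (node_gap d_gt0).
have vgap : \prod_(a.+1 <= j < b) v j ^+ e j = 1.
  by rewrite big_nat_cond big1 // => j /andP[Hj _]; rewrite egap.
pose B u := \prod_(a.+1 <= i < b) (u i / kap u i * zeta (v i) i u).
have BE u : \prod_(a.+1 <= j < b) vterm j u = B u.
  by apply: eq_big_nat => j Hj; rewrite /vterm egap.
have Hab : (a + n.+1 <= m.+1)%N by lia.
have zlt i : (a < i < a + n.+1)%N -> `|v i| < (rho i)%:C%C.
  by move=> Hi; apply: v_lt; lia.
have fgap : deg0 (fun i => a < i < a + n.+1)%N f.
  by apply: ldeg_le Hf => om Hom; split=> // i Hi; apply: Hom; move: Hi; lia.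
rewrite [in RHS]big_nat_recr //= -/a -/b natrM invfM.
have -> : (b - a = n.+1)%N by lia.
have nf : nice m rho v f := deg_nice Hf.
have nB : nice m rho v B.
  apply: nice_prod => // i; rewrite mem_index_iota => Hi.
  apply: niceM => //; first by apply: nice_ratio => //; lia.
  by apply: deg_zeta => //; [lia | apply: v_lt; lia].
have nV : nice m rho v (fun u => \prod_(1 <= j < b) vterm j u).
  apply: nice_prod => // i; rewrite mem_index_iota => Hi.
  by apply: (@deg_nice _ _ _ _ (Wsup (fun=> false)) (fun=> 0)); apply: deg0_vterm => //; lia.
(* The first gap starts at [u 0], which is constant on the torus, so there is no node to evaluate
   there. *)
have [p0|p0] := posnP p.
  have a0 : a = 0%N by rewrite /a p0.
  rewrite [X in _ * (X%:R^-1 / _)]big_geq; last by rewrite p0.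
  rewrite invr1 mul1r.
  have -> : \prod_(1 <= j < b) v j ^+ e j = 1 by move: vgap; rewrite a0.
  have := ct_gap_zeta rho_gt0 v_le concave Hab zlt fgap; rewrite -bE.
  rewrite mul1r [RHS]mulrC => <-.
  apply: ct_ext => //; last by apply/nice_lap/niceM.
  by move=> u _; rewrite mulrC -/(B u) -BE a0.
have Hp : (0 < p < nlen d e)%N by rewrite p0.
have /andP[Had ea] := node_interior d_gt0 Hp; rewrite -/a in Had ea.
have Ham : (0 < a <= m)%N by lia.
pose g u := f u * (u a ^+ e a * zeta (v a) a u).
pose f1 u := \prod_(1 <= j < a) vterm j u * g u.
have split_prod (F : nat -> C) :
    \prod_(1 <= j < b) F j = \prod_(1 <= j < a) F j * F a * \prod_(a.+1 <= j < b) F j.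
  rewrite (big_cat_nat (n := a.+1)) /=; [|lia|lia].
  by rewrite big_nat_recr //=; lia.
have sub (P : nat -> bool) : (forall i, P i -> (i < b)%N) -> deg0 P f.
  move=> HP; apply: ldeg_le Hf => om Hom; split=> // i Hi; apply: Hom.
  by apply: contra Hi; exact: HP.
have Hg : deg0 (fun i => i < a)%N g.
  apply: deg0M; first by apply: sub => i; lia.
  by apply: deg0_node => //; rewrite ltnn.
have Hf1 : deg0 (fun i => a < i < a + n.+1)%N f1.
  apply: deg0M.
    apply: deg0_prod => i; rewrite mem_index_iota => Hi.
    by apply: deg0_vterm; lia.
  by apply: deg0M => //; apply: deg0_node => //; rewrite ltnn.
have Hz : `|v a| < (rho a)%:C%C by exact: v_lt.
have -> : \prod_(1 <= j < b) v j ^+ e j =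
    \prod_(1 <= j < a) v j ^+ e j * v a ^+ e a by rewrite split_prod vgap mulr1.
transitivity (ct (fun u => f1 u * B u)).
  apply: ct_ext => //.
    move=> u _; rewrite split_prod BE /f1 /g.
    have -> : vterm a u = u a ^+ e a * zeta (v a) a u by rewrite /vterm ea.
    by rewrite [f u * _]mulrC !mulrA; rewrite mulrAC.
  by apply/nice_lap/niceM.
have := ct_gap_zeta rho_gt0 v_le concave Hab zlt Hf1; rewrite -bE => ->.
rewrite (IHp g (ltnW pl) Hg) -/a.
rewrite (ct_zeta rho_gt0 (e a) Ham Hz); last by apply: sub => i /eqP ->.
set X := \prod_(1 <= j < a) _; set Y := (\prod_(1 <= q < p.+1) _)%N.
have Y0 : Y%:R != 0 :> C.
  rewrite pnatr_eq0 -lt0n /Y big_seq; apply: prodn_cond_gt0 => q.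
  by rewrite mem_index_iota => Hq; rewrite subn_gt0; apply: (node_lt d_gt0); lia.
by field; rewrite Y0 addrC natr1 pnatr_eq0.
Qed.

End Chain.

Lemma nfbE e u : T u ->
  nfb d e u * \prod_(1 <= j < d) (u j / kap u j * zeta (v j) j u) =
  v 0%N ^+ e 0%N * v d ^+ e d * \prod_(1 <= j < d) vterm e j u.
Proof.
move=> Tu; rewrite /nfb (Tu.2 0%N) // (Tu.2 d); last by lia.
rewrite -mulrA -big_split /=; congr (_ * _); apply: eq_big_nat => j Hj.
have Hj' : (0 < j <= m)%N by lia.
rewrite /vterm; case: ifP => ej; last by rewrite mul1r.
have k0 := kap_neq0 rho_gt0 v_le concave Tu Hj'.
rewrite mulrA; congr (_ * _); rewrite -[in RHS](prednK ej) exprS.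
by move: (kap u j) k0 => K k0; field.
Qed.

(** Writing [du_j] as [u_j] times [du_j / u_j] makes the integral a constant term and puts the
    product of the inner variables into the integrand; this product is then replaced by its normal
    form. *)
Lemma virt_poly_int_nf (s : seq (rat * (nat -> nat))) :
  (forall u : nat -> C,
     \prod_(1 <= j < d) u j = \sum_(t <- s) ratr t.1 * nfb d t.2 u) ->
  virt_poly_int d v rho =
  \sum_(t <- s) ratr (d%:R * t.1 / (gapprod d t.2)%:R) *
     (v 0%N ^+ t.2 0%N * v d ^+ t.2 d * \prod_(1 <= j < d) v j ^+ t.2 j).
Proof.
move=> Hs; rewrite /virt_poly_int.
pose F u := \prod_(1 <= j < d) u j *
  \prod_(1 <= j < d) (u j / kap u j * zeta (v j) j u).
have nF : nice m rho v F.
  apply: niceM => //; apply: nice_prod => // i; rewrite mem_index_iota => Hi.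
    apply: (@ldeg_ext _ _ _ _ _ _ (fun u => u i ^ 1)); last exact: nice_var.
    by move=> u _; rewrite expr1z.
  apply: niceM => //; first by apply: nice_ratio => //; lia.
  by apply: deg_zeta => //; [lia | apply: v_lt; lia].
have -> : iter_circle_int m rho (virt_poly_integrand d v) v =
    iter_circle_int m rho (fun u => 1 * (F u / \prod_(1 <= j < m.+1) u j)) v.
  apply: (eq_iter_circle_int (v := v)) => // u Tu.
  rewrite mul1r prednK // /F mulrAC mulfV ?mul1r; last first.
    by have := on_torus_prod_neq0 rho_gt0 Tu; rewrite prednK.
  apply: eq_big_nat => j Hj; have Hj' : (0 < j <= m)%N by lia.
  have [uz ->] := zetaE rho_gt0 Hj' (v_lt Hj') Tu.
  by rewrite -/(kap u j) expr2 invfM mulrACA.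
rewrite (iter_circle_ctm 1 rho_gt0 (nice_lap nF)) mul1r.
have P0 : (2 * pi%:C%C * 'i%C) ^+ m != 0 :> C.
  rewrite expf_neq0 // !mulf_neq0 ?pnatr_eq0 //.
    by rewrite fmorph_eq0 gt_eqF // pi_gt0.
  by rewrite eq_complex /= oner_eq0 andbF.
rewrite mulrA divfK //.
have -> : ct F = \sum_(t <- s) ratr t.1 * (v 0%N ^+ t.2 0%N * v d ^+ t.2 d *
    (\prod_(1 <= j < d) v j ^+ t.2 j / (gapprod d t.2)%:R)).
  pose f_ (t : rat * (nat -> nat)) u := ratr t.1 *
    (v 0%N ^+ t.2 0%N * v d ^+ t.2 d * \prod_(1 <= j < d) vterm t.2 j u) : C.
  have nV t : nice m rho v (fun u => \prod_(1 <= j < d) vterm t.2 j u).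
    apply: nice_prod => // i; rewrite mem_index_iota => Hi.
    by apply: (@deg_nice _ _ _ _ (Wsup (fun=> false)) (fun=> 0)); apply: deg0_vterm => //; lia.
  have nf t : nice m rho v (f_ t).
    by apply: niceM => //; [exact: nice_cst | apply: niceM => //; exact: nice_cst].
  rewrite (ct_ext rho_gt0 (g := fun u => \sum_(t <- s) f_ t u)); last exact: nice_lap; last first.
    move=> u Tu; rewrite /F Hs mulr_suml; apply: eq_bigr => t _.
    by rewrite /f_ -(nfbE _ Tu); exact/esym/mulrA.
  rewrite ct_sum //; last by move=> t _; exact: nice_lap.
  apply: eq_bigr => t _; rewrite ctZ //; last first.
    by apply/nice_lap/niceM => //; exact: nice_cst.
  rewrite ctZ //; last exact: nice_lap.
  congr (_ * (_ * _)).
  have := @ct_chain t.2 (nlen d t.2) (fun=> 1) (leqnn _).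
  rewrite node_last ct_cst // mulr1 -/(gapprod d t.2) => <-; last first.
    exact: ldeg_cst.
  by congr (ctm _ _ _ _); apply/funext => u; rewrite mulr1.
rewrite mulr_sumr; apply: eq_bigr => t _.
by rewrite !rmorphM /= fmorphV !rmorph_nat; ring.
Qed.

End Evaluation.

Definition mnm_of d (e : nat -> nat) : 'X_{1..d.+1} := [multinom e i | i < d.+1].

Definition vpoly d (s : seq (rat * (nat -> nat))) : {mpoly rat[d.+1]} :=
  \sum_(t <- s) (d%:R * t.1 / (gapprod d t.2)%:R) *: 'X_[mnm_of d t.2].

Lemma vpoly_is_virt d s : (0 < d)%N ->
  (forall u : nat -> C,
     \prod_(1 <= j < d) u j = \sum_(t <- s) ratr t.1 * nfb d t.2 u) ->
  is_virt_poly R (vpoly d s).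
Proof.
move=> d0 Hs v rho vrho; rewrite (virt_poly_int_nf d0 vrho Hs) /vpoly.
rewrite [map_mpoly _ _]raddf_sum [meval _ _]raddf_sum; apply: eq_bigr => t _ /=.
rewrite map_mpolyZ mevalZ map_mpolyX mevalX; congr (_ * _).
rewrite (eq_bigr (fun i : 'I_d.+1 => v i ^+ t.2 i)); last by move=> i _; rewrite mnmE.
rewrite -(big_mkord xpredT (fun i => v i ^+ t.2 i)) big_nat_recr //= big_ltn //.
by rewrite -mulrA [in RHS]mulrAC -mulrA [_ * v d ^+ _]mulrC.
Qed.

(** On the unit torus, the coefficient of [M0] is the constant term of [p] times the inverse of that
    monomial. Indices are shifted by one because torus variables start at 1. *)
Lemma mpoly_eval_inj d (p : {mpoly rat[d.+1]}) :
  (forall v : nat -> C,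
     (map_mpoly (@ratr C) p).@[fun i : 'I_d.+1 => v i] = 0) -> p = 0.
Proof.
move=> Hp; apply/mpolyP => M0; rewrite mcoeff0.
pose ex (M : 'X_{1..d.+1}) := fun j : nat => (M (inord j.-1))%:Z.
pose q := [seq (ratr p@_M : C, fun j => ex M j + - ex M0 j) | M <- msupp p].
have r0 j : (0 < j <= d.+1)%N -> (0 : R) < (fun=> 1) j by [].
have := @ct_lpoly R d.+1 (fun=> 1) (fun=> 0) r0 q.
rewrite (ct_ext r0 (g := fun=> 0)); first last.
- by move=> e e0; exists q => u _; rewrite subrr normr0 ltW.
- move=> u Tu; rewrite /lpoly big_map.
  rewrite (eq_bigr (fun M => (ratr p@_M * mon d.+1 (ex M) u) * mon d.+1 (fun j => - ex M0 j) u)); last first.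
    by move=> M _ /=; rewrite (monD r0 _ _ Tu) mulrA.
  rewrite -mulr_suml; have := Hp (fun j => u j.+1); rewrite mevalE.
  rewrite (perm_big (msupp p)) /=; last by apply: msupp_map_mpoly; exact: fmorph_inj.
  move=> E; rewrite [X in X * _](_ : _ = 0) ?mul0r // -[RHS]E.
  apply: eq_bigr => M _; rewrite mcoeff_map_mpoly; congr (_ * _).
  rewrite /mon big_add1 /= big_mkord; apply: eq_bigr => i _.
  by rewrite /ex inord_val.
rewrite ct_cst // /cterm big_map => /esym.
have Hall M : all (fun j => ex M j + - ex M0 j == 0) (iota 1 d.+1) = (M == M0).
  apply/allP/eqP => [H|-> j _]; last by rewrite subrr.
  apply/mnmP => i; have /H : i.+1 \in iota 1 d.+1.
    by rewrite mem_iota /=; have := ltn_ord i; lia.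
  by rewrite subr_eq0 /ex /= inord_val => /eqP [].
rewrite (eq_bigl (pred1 M0)); last by move=> M; exact: Hall.
have [M0p|/memN_msupp_eq0 ->//] := boolP (M0 \in msupp p).
rewrite -big_filter filter_pred1_uniq ?msupp_uniq // big_seq1 => /eqP.
by rewrite fmorph_eq0 => /eqP.
Qed.

Lemma ex_radii d (v : nat -> C) : (0 < d)%N -> exists rho, virt_poly_radii d v rho.
Proof.
move=> d0; pose a (j : nat) : R := complex.Re `|v j|.
have aE j : `|v j| = (a j)%:C%C by rewrite RRe_real // normr_real.
have a0 j : 0 <= a j by rewrite -lecR -aE normr_ge0.
pose K : R := 1 + \sum_(0 <= j < d.+1) a j.
have aK j : (j <= d)%N -> a j < K.
  move=> jd; rewrite /K (bigD1_seq j) ?mem_index_iota ?iota_uniq //=.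
  have : 0 <= \sum_(0 <= i < d.+1 | i != j) a i by apply: sumr_ge0.
  lra.
(* The second difference of [j (d - j)] is -2, so [q] is strictly concave, and it exceeds every
   [|v j|]. Lowering its two end values to [|v 0|] and [|v d|] preserves concavity. *)
pose q (j : nat) : R := K * (1 + j%:R * (d - j)%:R).
pose rho (j : nat) : R := if (j == 0%N) || (j == d) then a j else q j.
have K0 : 0 < K by apply: le_lt_trans (aK 0%N _).
have rq j : (j <= d)%N -> rho j <= q j.
  move=> jd; rewrite /rho; case: ifP => // _.
  have := aK j jd; have : 0 <= K * (j%:R * (d - j)%:R) by rewrite !mulr_ge0 // ltW.
  by rewrite /q mulrDr mulr1; lra.
exists rho; split.
- by rewrite aE /rho eqxx.
- by rewrite aE /rho eqxx orbT.
move=> j Hj; have rj : rho j = q j by rewrite /rho ifF //; lia.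
split.
  rewrite aE ltcR rj; have jd : (j <= d)%N by lia.
  have := aK j jd; have : 0 <= K * (j%:R * (d - j)%:R) by rewrite !mulr_ge0 // ltW.
  by rewrite /q mulrDr mulr1; lra.
have H1 : rho j.-1 <= q j.-1 by apply: rq; lia.
have H2 : rho j.+1 <= q j.+1 by apply: rq; lia.
have [i jE] : exists i, j = i.+1 by exists j.-1; lia.
have [l dE] : exists l, d = (i + l.+2)%N by exists (d - i.+2)%N; lia.
have q1 : q j.-1 = K * (1 + i%:R * l.+2%:R) by rewrite /q jE /=; congr (K * (1 + _ * _%:R)); lia.
have q2 : q j.+1 = K * (1 + i.+2%:R * l%:R) by rewrite /q jE /=; congr (K * (1 + _ * _%:R)); lia.
have q3 : q j = K * (1 + i.+1%:R * l.+1%:R) by rewrite /q jE /=; congr (K * (1 + _ * _%:R)); lia.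
rewrite rj q3; rewrite q1 in H1; rewrite q2 in H2.
have Ei2 : i.+2%:R = i%:R + 2 :> R by rewrite -addn2 natrD.
have El2 : l.+2%:R = l%:R + 2 :> R by rewrite -addn2 natrD.
rewrite Ei2 in H2; rewrite El2 in H1; rewrite -(addn1 i) -(addn1 l) !natrD.
by move: H1 H2; move: (i%:R : R) (l%:R : R) => x y; nra.
Qed.

(** Admissible radii exist for every [v], so two polynomials that represent the integral take the
    same values everywhere and coincide. *)
Lemma virt_polyE d : (0 < d)%N ->
  exists s, [/\ all_edeg d d.-1 s,
    forall u : nat -> C,
      \prod_(1 <= j < d) u j = \sum_(t <- s) ratr t.1 * nfb d t.2 u &
    virt_poly R d = vpoly d s].
Proof.
move=> d0; have [s Hs Hu] := prod_normal_form R d0; exists s; split=> //.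
have Hv := vpoly_is_virt d0 Hu.
have Hx : is_virt_poly R (virt_poly R d) by apply: (xgetPex 0); exists (vpoly d s).
apply/eqP; rewrite -subr_eq0; apply/eqP; apply: mpoly_eval_inj => v.
have [rho vrho] := ex_radii v d0.
rewrite map_mpoly_is_additive mevalB.
rewrite -[RHS](subrr (virt_poly_int d v rho)).
by congr (_ - _); [exact: Hx vrho | exact: Hv vrho].
Qed.

End VirtualPolynomial.

(** * Closed form of the structure constants *)

Section ClosedForm.
Variables (R : realType) (m : nat) (rho : nat -> R) (v : nat -> R[i]).
Hypothesis rho_gt0 : forall j, (0 < j <= m)%N -> 0 < rho j.
Hypothesis v_le : forall j, (j <= m.+1)%N -> ~~ (0 < j <= m)%N ->
  `|v j| <= (rho j)%:C%C.
Hypothesis concave : forall j, (0 < j <= m)%N ->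
  rho j.-1 + rho j.+1 < 2 * rho j.
Variable k : nat.
Hypothesis k_gt0 : (0 < k)%N.
Local Notation C := R[i].
Implicit Types (u : nat -> C) (f g : (nat -> C) -> C) (al be om : nat -> int).
Implicit Types (W : (nat -> int) -> Prop) (c : (nat -> int) -> int) (N n : int).
Local Notation T := (on_torus m rho v).
Local Notation ct f := (ctm m rho f v).
Local Notation deg W c f := (ldeg m rho v W c f).
Local Notation wt := (wt m).

Definition edge (x y : C) : C :=
  k%:R * \prod_(1 <= j < k) (j%:R * x + (k - j)%:R * y).

Lemma deg_edge W i j c : (forall om, W om -> wt om i <= c om /\ wt om j <= c om) ->
  deg W (fun om => k.-1%:Z * c om) (fun u => edge (u i) (u j)).
Proof.
move=> Hc; rewrite /edge.
apply: (@ldeg_le _ _ _ _ W _ (fun om => 0 + \sum_(l <- index_iota 1 k) c om)).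
  move=> om Hom; split=> //; rewrite add0r big_const_seq count_predT size_iota.
  by rewrite iter_addr_0 subn1 -mulr_natl natz.
apply: ldegM => //; first exact: ldeg_cst.
apply: ldeg_prod => // l _.
have deg_lin (a : C) i' : (forall om, W om -> wt om i' <= c om) ->
    deg W c (fun u => a * u i').
  move=> H; apply: (@ldeg_ext _ _ _ _ _ _ (fun u => a * u i' ^ 1)).
    by move=> u _; rewrite expr1z.
  apply: (@ldeg_le _ _ _ _ W _ (fun om => 0 + c om)).
    by move=> om Hom; rewrite add0r.
  apply: ldegM => //; first exact: ldeg_cst.
  by apply: deg_var => om Hom; rewrite mulr1; exact: H.
by apply: ldegD; apply: deg_lin => om Hom; have [] := Hc om Hom.
Qed.

Definition Dg N (g : nat) : int := N - 1 - (N - k%:Z) * g%:Z.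

(** This is [u_i^(2-N) / kap_i], split so that the second factor has degree 0. *)
Definition gapf N u (i : nat) : C := u i ^ (1 - N) * (u i / kap u i).

(* Up to the factor b - a, the constant term of [Hf N n a b] is the virtual   *)
(* structure constant L_n^{N,k,b-a}.                                          *)
Definition Hf N n (a b : nat) u : C :=
  u a ^ (- n) * u b ^ (n - Dg N (b - a)) *
  (\prod_(a <= i < b) edge (u i) (u i.+1) * \prod_(a.+1 <= i < b) gapf N u i).

Lemma deg_gapf W N i : (0 < i <= m)%N ->
  (forall om, W om -> wt om i.-1 <= wt om i /\ wt om i.+1 <= wt om i) ->
  deg W (fun om => wt om i * (1 - N)) (gapf N ^~ i).
Proof.
move=> Hi HW.
apply: (@ldeg_le _ _ _ _ W _ (fun om => wt om i * (1 - N) + 0)).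
  by move=> om Hom; rewrite addr0.
by apply: ldegM => //; [exact: deg_var | exact: deg_ratio].
Qed.

(** [Dg] is the exponent that makes the integrand homogeneous of total degree 0: it balances [k - 1]
    for each edge and [1 - N] for each inner vertex. *)
Lemma deg_Hf W N n a b : (0 < a)%N -> (a < b)%N -> (b <= m)%N ->
  (forall om, W om -> forall i, (a <= i <= b)%N -> wt om i = wt om a) ->
  deg W (fun=> 0) (Hf N n a b).
Proof.
move=> a0 ab bm flat.
pose x om := wt om a.
apply: (@ldeg_le _ _ _ _ W _ (fun om =>
   (x om * (- n) + x om * (n - Dg N (b - a))) +
   (\sum_(i <- index_iota a b) k.-1%:Z * x om +
    \sum_(i <- index_iota a.+1 b) x om * (1 - N)))).
  move=> om Hom; split=> //.
  rewrite !big_const_seq !count_predT !size_iota !iter_addr_0 /Dg.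
  have [h hE] : exists h, b = (a + h.+1)%N by exists (b - a).-1; lia.
  have -> : (b - a = h.+1)%N by lia.
  have -> : (b - a.+1 = h)%N by lia.
  have -> : k.-1%:Z = k%:Z - 1 by lia.
  rewrite -[_ *+ h.+1]mulr_natl -[_ *+ h]mulr_natl !natz.
  rewrite le_eqVlt; apply/orP; left; apply/eqP.
  by rewrite -(addn1 h) PoszD; ring.
apply: ldegM => //.
  apply: ldegM => //; apply: deg_var => om Hom //.
  by rewrite (flat om Hom) // leqnn ltnW.
apply: ldegM => //; apply: ldeg_prod => // i; rewrite mem_index_iota => Hi.
  by apply: deg_edge => om Hom; rewrite !(flat om Hom) //; lia.
apply: (@ldeg_le _ _ _ _ W _ (fun om => wt om i * (1 - N))).
  by move=> om Hom; rewrite (flat om Hom) //; lia.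
apply: deg_gapf; first by lia.
by move=> om Hom; rewrite !(flat om Hom) //; lia.
Qed.

Lemma nice_Hf N n a b : (0 < a)%N -> (a < b)%N -> (b <= m)%N ->
  nice m rho v (Hf N n a b).
Proof. by move=> a0 ab bm; apply: deg_Hf. Qed.

Definition initp : {poly rat} :=
  k%:R *: \prod_(1 <= j < k) (j%:R *: 'X + (k - j)%:R%:P).

Lemma size_initp : (size initp <= k)%N.
Proof.
apply: (leq_trans (size_scale_leq _ _)).
suff H l : (0 < l)%N -> (size (\prod_(1 <= j < l) (j%:R *: 'X + (k - j)%:R%:P) : {poly rat})%R <= l)%N by exact: H.
case: l => // l _; elim: l => [|l IHl]; first by rewrite big_geq // size_poly1.
rewrite big_nat_recr //=; apply: (leq_trans (size_polyMleq _ _)).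
have H : (size (l.+1%:R *: 'X + (k - l.+1)%:R%:P : {poly rat})%R <= 2)%N.
  apply: (leq_trans (size_polyD _ _)); rewrite geq_max; apply/andP; split.
    by apply: (leq_trans (size_scale_leq _ _)); rewrite size_polyX.
  by apply: (leq_trans (size_polyC_leq1 _)).
by move: IHl H; set x := size _; set y := size _; lia.
Qed.

Lemma edgeE (x y : C) : y != 0 ->
  edge x y = \sum_(0 <= i < k) ratr initp`_i * (x ^+ i * y ^ (k.-1%:Z - i%:Z)).
Proof.
move=> y0.
have -> : edge x y = y ^+ k.-1 * (map_poly ratr initp).[x / y].
  rewrite /edge /initp map_polyZ hornerZ rmorph_nat mulrCA; congr (_ * _).
  rewrite rmorph_prod horner_prod /=.
  have -> : y ^+ k.-1 = \prod_(1 <= j < k) y.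
    by rewrite big_const_nat subn1 iter_mulr_1.
  rewrite -big_split /=; apply: eq_bigr => j _.
  rewrite rmorphD /= map_polyZ map_polyX map_polyC /= !hornerE /= !rmorph_nat.
  by field.
rewrite (horner_coef_wide _ (n := k)); last first.
  by apply: leq_trans size_initp; exact: size_poly.
rewrite mulr_sumr big_mkord; apply: eq_bigr => i _.
rewrite coef_map /= mulrCA; congr (_ * _).
rewrite expr_div_n mulrCA; congr (_ * _).
by rewrite exprnN exprnP -expfzDr.
Qed.

Lemma ct_Hf1 N n a : (0 < a)%N -> (a < m)%N ->
  ct (Hf N n a a.+1) = if 0 <= n then ratr initp`_`|n| else 0.
Proof.
move=> a0 am.
pose q := [seq (ratr initp`_i : C,
  fun j => delta a (i%:Z - n) j + delta a.+1 (n - i%:Z) j) | i <- index_iota 0 k].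
have mon_delta (i : nat) (z : int) u : (0 < i <= m)%N -> mon m (delta i z) u = u i ^ z.
  move=> Hi; rewrite /mon (bigD1_seq i) ?mem_index_iota ?iota_uniq //=.
  by rewrite /delta eqxx big1 ?mulr1 // => j /negbTE ->.
have E u : T u -> Hf N n a a.+1 u = lpoly m q u.
  move=> Tu.
  have ua : u a != 0 by apply: (torus_neq0 rho_gt0 Tu); lia.
  have ub : u a.+1 != 0 by apply: (torus_neq0 rho_gt0 Tu); lia.
  rewrite /Hf big_nat1 big_geq // mulr1 edgeE // mulr_sumr /lpoly big_map.
  apply: eq_bigr => i _; rewrite mulrCA; congr (_ * _).
  rewrite (monD rho_gt0 _ _ Tu) !mon_delta; [|lia|lia].
  rewrite mulrACA; congr (_ * _); first by rewrite exprnP -expfzDr // addrC.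
  rewrite -expfzDr //; congr (_ ^ _); rewrite /Dg subSnn; lia.
rewrite (ct_ext rho_gt0 E); last by apply: nice_lap; apply: nice_Hf.
rewrite (ct_lpoly _ rho_gt0) /cterm big_map.
have Hall (i : nat) : all (fun j => delta a (i%:Z - n) j + delta a.+1 (n - i%:Z) j == 0) (iota 1 m) = (i%:Z == n).
  apply/allP/eqP => [H|-> j _]; last by rewrite /delta subrr !if_same.
  have /H : a \in iota 1 m by rewrite mem_iota; lia.
  by rewrite /delta eqxx ltn_eqF // addr0 subr_eq0 => /eqP.
rewrite (eq_bigl (fun i : nat => i%:Z == n)); last by move=> i; exact: Hall.
case: n {q E Hall} => n /=; last by rewrite big1.
have [nk|kn] := ltnP n k.
  rewrite -big_filter (eq_filter (a2 := pred1 n)); last by move=> i; rewrite /= eqz_nat.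
  by rewrite filter_pred1_uniq ?iota_uniq ?mem_index_iota // big_seq1.
rewrite nth_default ?rmorph0; last by apply: leq_trans size_initp kn.
rewrite big_nat_cond big1 // => i /andP[/andP[_ ik] /eqP[E]].
by rewrite E ltnNge kn in ik.
Qed.

(** With [h + 1] inner vertices, the degree in the inner variables is at most [(h + 2)(k - 1) + (h +
    1)(1 - 2k) = - h k - 1]. This matches the vanishing of the initial constants with [d >= 2]. *)
Lemma deg1_Hf_int n a b : (0 < a)%N -> (a.+1 < b)%N -> (b <= m)%N ->
  deg1 m rho v (win a b) (- 1) (Hf (2 * k)%:Z n a b).
Proof.
move=> a0 ab bm; pose om := win a b.
have w0 i : (i <= a)%N || (b <= i)%N -> wt om i = 0.
  by move=> Hi; rewrite /wt /om /win; case: ifP => // _; rewrite ifF //; lia.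
have w1 i : (a < i < b)%N -> wt om i = 1.
  by move=> Hi; rewrite /wt /om /win Hi ifT //; lia.
have wle i : wt om i <= 1 by have /andP[] := wt_win m a b i.
apply: (@ldeg_le _ _ _ _ (eq om) _ (fun _ => (0 + 0) +
   (\sum_(i <- index_iota a b) k.-1%:Z * 1 +
    \sum_(i <- index_iota a.+1 b) (1 - (2 * k)%:Z)))).
  move=> om' Hom; split=> //.
  rewrite !big_const_seq !count_predT !size_iota !iter_addr_0.
  have [h hE] : exists h, b = (a + h.+2)%N by exists (b - a).-2; lia.
  have -> : (b - a = h.+2)%N by lia.
  have -> : (b - a.+1 = h.+1)%N by lia.
  have -> : k.-1%:Z = k%:Z - 1 by lia.
  rewrite -[_ *+ h.+2]mulr_natl -[_ *+ h.+1]mulr_natl !natz mulr1 -(addn1 h.+1) -(addn1 h) !PoszD.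
  have : 0 <= h%:Z * k%:Z by rewrite mulr_ge0.
  nia.
apply: ldegM => //.
  by apply: ldegM => //; apply: deg_var => _ <-; rewrite w0 ?mul0r // leqnn ?orbT.
apply: ldegM => //; apply: ldeg_prod => // i; rewrite mem_index_iota => Hi.
  by apply: (@deg_edge _ _ _ (fun=> 1)) => _ <-; split; exact: wle.
apply: (@ldeg_le _ _ _ _ (eq om) _ (fun om => wt om i * (1 - (2 * k)%:Z))).
  by move=> _ <-; rewrite w1 // mul1r.
apply: deg_gapf; first by lia.
by move=> _ <-; rewrite [wt om i]w1 // !wle.
Qed.

Lemma closed_form_base n d a : (0 < d)%N -> (0 < a)%N -> (a + d <= m)%N ->
  ratr (vsc_init k n d) = d%:R * ct (Hf (2 * k)%:Z n a (a + d)).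
Proof.
move=> d0 a0 adm; rewrite /vsc_init.
have [d1|d1] := eqVneq d 1%N.
  rewrite d1 mul1r addn1 ct_Hf1 //; last by lia.
  by rewrite /= ; case: ifP => //; rewrite rmorph0.
rewrite /= rmorph0 (@deg1_ct0 _ _ _ _ rho_gt0 (win a (a + d)) (- 1)) ?mulr0 //.
by apply: deg1_Hf_int => //; lia.
Qed.

Section Chain.
Variables (d : nat) (e : nat -> nat).
Hypothesis d_gt0 : (0 < d)%N.

Definition tauf N u (a j : nat) : C :=
  if (0 < e j)%N then u (a + j)%N ^ ((e j)%:Z + 1 - N) else gapf N u (a + j).

Lemma big_shift (F : nat -> C) a i j :
  \prod_(a + i <= l < a + j) F l = \prod_(i <= l < j) F (a + l)%N.
Proof.
by rewrite addnC big_addn addKn; apply: eq_bigr => l _; rewrite addnC.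
Qed.

Lemma tauf_gap N u a p : (p < nlen d e)%N ->
  \prod_((a + node d e p).+1 <= l < a + node d e p.+1) gapf N u l =
  \prod_((node d e p).+1 <= l < node d e p.+1) tauf N u a l.
Proof.
move=> pl; rewrite -addnS big_shift; apply: eq_big_nat => l Hl.
by rewrite /tauf (node_gap d_gt0 pl).
Qed.

(** The relation required of [nn] is what makes the two powers of a shared node variable, one from
    each adjacent block, combine to the exponent in [tauf]. *)
Lemma chain_prod N (nn : nat -> int) a p u : T u -> (0 < a)%N -> (a + d <= m)%N ->
  (forall q, (0 < q < nlen d e)%N ->
     nn q.+1 = nn q + (N - k%:Z) * (node d e q - node d e q.-1)%:Z - (e (node d e q))%:Z) ->
  (0 < p <= nlen d e)%N ->
  \prod_(1 <= q < p.+1) Hf N (nn q) (a + node d e q.-1) (a + node d e q) u =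
  u a ^ (- nn 1%N) *
    u (a + node d e p)%N ^ (nn p - Dg N (node d e p - node d e p.-1)) *
  (\prod_(a <= i < a + node d e p) edge (u i) (u i.+1) *
   \prod_(1 <= j < node d e p) tauf N u a j).
Proof.
move=> Tu a0 adm Hnn; elim: p => // p IHp Hp.
have [p0|p0] := posnP p.
  rewrite p0 big_nat1 /Hf node0 addn0 addKn subn0; congr (_ * (_ * _)).
  by have := tauf_gap N u a (nlen_gt0 d e); rewrite node0 addn0.
rewrite big_nat_recr //= IHp; last by lia.
set b := node d e p; set b' := node d e p.-1; set b2 := node d e p.+1.
have bb : (b < b2)%N by apply: (node_lt d_gt0); lia.
have Hpi : (0 < p < nlen d e)%N by lia.
have /andP[Hbd eb] := node_interior d_gt0 Hpi; rewrite -/b in Hbd eb.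
have Hb0 : u (a + b)%N != 0 by apply: (torus_neq0 rho_gt0 Tu); lia.
rewrite /Hf subnDl tauf_gap -/b -/b2; last by lia.
rewrite [in RHS](@big_cat_nat _ _ _ (a + b)) /=; [|lia|lia].
rewrite [X in _ = _ * (_ * X)](@big_cat_nat _ _ _ b.+1) /=; [|lia|lia].
rewrite [X in _ = _ * (_ * (X * _))]big_nat_recr /=; last by lia.
have -> : tauf N u a b = u (a + b)%N ^ (nn p - Dg N (b - b')) * u (a + b)%N ^ (- nn p.+1).
  rewrite /tauf eb -expfzDr //; congr (_ ^ _).
  by rewrite Hnn // -/b -/b' /Dg; ring.
set A := \prod_(a <= i < a + b) _; set B := \prod_(a + b <= i < _) _.
set A' := \prod_(1 <= i < b) _; set B' := \prod_(b.+1 <= i < _) _.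
move: (u a ^ _) (u (a + b)%N ^ _) (u (a + b)%N ^ _) (u (a + b2)%N ^ _) => x y z w.
ring.
Qed.

(** The last block shares only one node variable with the earlier ones and is homogeneous of degree
    0, so [ct_mul] splits it off. *)
Lemma ct_chain_prod N (nn : nat -> int) a p : (0 < a)%N -> (a + d <= m)%N ->
  (p <= nlen d e)%N ->
  ct (fun u => \prod_(1 <= q < p.+1) Hf N (nn q) (a + node d e q.-1) (a + node d e q) u) =
  \prod_(1 <= q < p.+1) ct (Hf N (nn q) (a + node d e q.-1) (a + node d e q)).
Proof.
move=> a0 adm; elim: p => [|p IHp] Hp.
  rewrite big_geq // -[RHS](ct_cst v rho_gt0 1).
  by congr (ctm _ _ _ _); apply/funext => u; rewrite big_geq.
rewrite big_nat_recr //= -IHp; last by lia.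
under eq_fun do rewrite big_nat_recr //=.
have nlt q : (0 < q <= p.+1)%N -> (node d e q.-1 < node d e q)%N.
  by move=> Hq; apply: (node_lt d_gt0); lia.
have nle q : (q <= p.+1)%N -> (node d e q <= d)%N.
  by move=> Hq; apply: (node_le d_gt0); lia.
have nle2 q : (q <= p)%N -> (node d e q <= node d e p)%N.
  by rewrite leq_eqVlt => /orP[/eqP ->//|qp]; apply/ltnW/(node_lt d_gt0) => //; lia.
apply: (@ct_mul _ _ _ _ rho_gt0 (fun i => (a + node d e p < i)%N)
  (fun i => ~~ (a + node d e p <= i <= a + node d e p.+1)%N) (a + node d e p)).
- by move=> i; lia.
- apply: (@ldeg_le _ _ _ _ (Wsup (fun i => (a + node d e p < i)%N)) _ (fun om => \sum_(q <- index_iota 1 p.+1) 0)).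
    by move=> om Hom; rewrite big1_eq.
  apply: ldeg_prod => // q; rewrite mem_index_iota => Hq.
  have H1 := nlt q; have H2 := nle q; have H3 := nle2 q.
  apply: deg_Hf; [lia|lia|lia|move=> om Hom i Hi].
  by rewrite /wt !Hom ?if_same //; lia.
- have /= H1 := nlt p.+1; have H2 := nle p.+1.
  apply: deg_Hf; [lia|lia|lia|move=> om Hom i Hi].
  case: Hom => [Hom|[s ->]].
    by rewrite /wt !Hom ?if_same ?negbK //; lia.
  by rewrite /wt /Wtot !ifT //; lia.
Qed.

End Chain.

End ClosedForm.

(** * The recursion in N in terms of constant terms *)

Section Recursion.
Variables (R : realType) (k : nat).
Hypothesis k_gt0 : (0 < k)%N.
Local Notation C := R[i].
Implicit Types (N n : int).

(** [vsc_phi] sums over the support, whereas a list of terms may repeat monomials or let them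
    cancel; both sums are regrouped over a common duplicate-free list. *)
Lemma vsc_phi_sum d (L : int -> nat -> rat) N n (I : eqType) (s : seq I)
    (c : I -> rat) (M_ : I -> 'X_{1..d.+1}) :
  vsc_phi k L N n (\sum_(t <- s) c t *: 'X_[M_ t]) =
  \sum_(t <- s) c t *
    \prod_(1 <= j < (mnm_len (M_ t)).+1)
      L (n + mnm_delta k N (M_ t) j) (mnm_node (M_ t) j - mnm_node (M_ t) j.-1)%N.
Proof.
rewrite /vsc_phi; set P := \sum_(t <- s) _; set r0 := msupp P.
pose F (M : 'X_{1..d.+1}) := \prod_(1 <= j < (mnm_len M).+1)
      L (n + mnm_delta k N M j) (mnm_node M j - mnm_node M j.-1)%N.
rewrite -[LHS]/(\sum_(M <- r0) P@_M * F M) -[RHS]/(\sum_(t <- s) c t * F (M_ t)) /r0 {r0}.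
pose r := undup (msupp P ++ [seq M_ t | t <- s]).
have -> : \sum_(M <- msupp P) P@_M * F M = \sum_(M <- r) P@_M * F M.
  rewrite [RHS](bigID (fun M => M \in msupp P)) /= [X in _ + X]big1 ?addr0; last first.
    by move=> M /memN_msupp_eq0 ->; rewrite mul0r.
  rewrite -[RHS]big_filter; apply: perm_big; apply: uniq_perm.
  - exact: msupp_uniq.
  - by rewrite filter_uniq // undup_uniq.
  - by move=> M; rewrite mem_filter mem_undup mem_cat; case: (M \in msupp P).
transitivity (\sum_(M <- r) \sum_(t <- s) c t * (M_ t == M)%:R * F M).
  apply: eq_bigr => M _; rewrite -mulr_suml; congr (_ * _).
  by rewrite raddf_sum /=; apply: eq_bigr => t _; rewrite mcoeffZ mcoeffX.
rewrite exchange_big /=; apply: eq_big_seq => t ts.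
have tr : M_ t \in r by rewrite mem_undup mem_cat map_f ?orbT.
rewrite (bigD1_seq (M_ t)) ?undup_uniq //= eqxx mulr1 big1 ?addr0 // => M.
by rewrite eq_sym => /negbTE ->; rewrite mulr0 mul0r.
Qed.

Lemma mnm_of_inord d (e : nat -> nat) j : (j <= d)%N -> mnm_of d e (inord j) = e j.
Proof. by move=> jd; rewrite mnmE inordK. Qed.

Lemma mnm_nodes_of d (e : nat -> nat) : mnm_nodes (mnm_of d e) = nodes d e.
Proof.
rewrite /mnm_nodes /nodes; congr (_ :: rcons _ _); apply: eq_in_filter => j.
by rewrite mem_iota => Hj; rewrite mnm_of_inord //; lia.
Qed.

Lemma sum_nodes d (e : nat -> nat) p : (0 < d)%N -> (0 < p <= nlen d e)%N ->
  (\sum_(1 <= j < p) e (node d e j) = \sum_(1 <= j < node d e p) e j)%N.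
Proof.
move=> d0; elim: p => // p IHp Hp; have [p0|p0] := posnP p.
  rewrite p0 big_geq // big_nat_cond big1 // => j /andP[Hj _].
  by apply: (node_gap d0 (nlen_gt0 d e)); rewrite node0.
rewrite big_nat_recr //= IHp; last by lia.
have bb : (node d e p < node d e p.+1)%N by apply: (node_lt d0); lia.
have Hpi : (0 < p < nlen d e)%N by lia.
have /andP[Hbd eb] := node_interior d0 Hpi.
rewrite [RHS](@big_cat_nat _ _ _ (node d e p).+1) /=; [|lia|lia].
rewrite [X in _ = (X + _)%N]big_nat_recr /=; last by lia.
rewrite [X in _ = (_ + X)%N]big_nat_cond [X in _ = (_ + X)%N]big1 ?addn0 // => j /andP[Hj _].
by apply: (node_gap d0 _ Hj); lia.
Qed.

Section Delta.
Variables (d : nat) (e : nat -> nat) (N : int).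
Hypotheses (d_gt0 : (0 < d)%N) (He : edeg d e = d.-1).
Local Notation M := (mnm_of d e).

Lemma mnm_lenE : mnm_len M = nlen d e.
Proof. by rewrite /mnm_len mnm_nodes_of. Qed.

Lemma mnm_nodeE j : mnm_node M j = node d e j.
Proof. by rewrite /mnm_node mnm_nodes_of. Qed.

Lemma mnm_deltaE p : (0 < p)%N ->
  mnm_delta k N M p = (nlen d e)%:Z - d%:Z + ((node d e p.-1)%:Z - p.-1%:Z)
   + (node d e p.-1)%:Z * (N - k%:Z)
   + \sum_(p <= j < nlen d e) ((e (node d e j))%:Z - 1) + (e d)%:Z.
Proof.
move=> p0; rewrite /mnm_delta mnm_lenE !mnm_nodeE mnm_of_inord //; congr (_ + _ + _).
apply: eq_big_nat => j Hj; rewrite mnm_nodeE mnm_of_inord //.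
by apply: (node_le d_gt0); lia.
Qed.

(** The total degree [d - 1] trades the exponents at the other nodes for the one at 0. *)
Lemma mnm_delta1 : mnm_delta k N M 1 = - (e 0%N)%:Z.
Proof.
rewrite mnm_deltaE // node0 sumrB.
have -> : \sum_(1 <= j < nlen d e) (e (node d e j))%:Z = (\sum_(1 <= j < nlen d e) e (node d e j))%N%:Z.
  by rewrite -[RHS]natz natr_sum; apply: eq_bigr => j _; rewrite natz.
rewrite sum_nodes //; last by rewrite (nlen_gt0 d e) leqnn.
rewrite node_last sumr_const_nat -mulr_natl natz mulr1.
move: He; rewrite /edeg big_nat_recr //= big_ltn //.
have := nlen_gt0 d e; set l := nlen d e; set S := \sum_(_ <= _ < _) _; lia.
Qed.

(** The relation demanded by [chain_prod], with [N + 1] in place of [N]. *)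
Lemma mnm_deltaS p : (0 < p < nlen d e)%N ->
  mnm_delta k N M p.+1 = mnm_delta k N M p +
   (N + 1 - k%:Z) * (node d e p - node d e p.-1)%:Z - (e (node d e p))%:Z.
Proof.
move=> Hp; rewrite !mnm_deltaE; [|lia|lia].
rewrite [X in _ = _ + X + _ + _ - _]big_ltn; last by lia.
have H : (node d e p.-1 <= node d e p)%N by apply/ltnW/(node_lt d_gt0); lia.
rewrite -subzn //=; have -> : p%:Z = p.-1%:Z + 1 by lia.
by ring.
Qed.

Lemma mnm_delta_last : mnm_delta k N M (nlen d e) =
  1 - d%:Z + (node d e (nlen d e).-1)%:Z * (N + 1 - k%:Z) + (e d)%:Z.
Proof.
rewrite mnm_deltaE ?nlen_gt0 // big_geq //.
have := nlen_gt0 d e; case: (nlen d e) => //= l _.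
by rewrite -(addn1 l) PoszD; ring.
Qed.

End Delta.
Lemma vsc_rec_step d s e n : (0 < d)%N -> all_edeg d d.-1 s ->
  virt_poly R d = vpoly d s ->
  vsc_rec R k e.+1 n d =
  \sum_(t <- s) (d%:R * t.1 / (gapprod d t.2)%:R) *
    \prod_(1 <= q < (nlen d t.2).+1)
      vsc_rec R k e (n + mnm_delta k ((2 * k)%:Z - e.+1%:Z) (mnm_of d t.2) q)
        (node d t.2 q - node d t.2 q.-1)%N.
Proof.
move=> d0 Hs /= ->; rewrite /vpoly vsc_phi_sum; apply: eq_bigr => t _.
by rewrite mnm_lenE; congr (_ * _); apply: eq_bigr => q _; rewrite !mnm_nodeE.
Qed.

Section Torus.
Variables (m : nat) (rho : nat -> R) (v : nat -> C).
Hypothesis rho_gt0 : forall j, (0 < j <= m)%N -> 0 < rho j.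
Hypothesis v_le : forall j, (j <= m.+1)%N -> ~~ (0 < j <= m)%N ->
  `|v j| <= (rho j)%:C%C.
Hypothesis concave : forall j, (0 < j <= m)%N ->
  rho j.-1 + rho j.+1 < 2 * rho j.
Local Notation T := (on_torus m rho v).
Local Notation ct f := (ctm m rho f v).

(* Lowering N by one multiplies the integrand by the inner variables, whose   *)
(* normal form then splits it along the nodes of each term.                   *)
Lemma Hf_normal_form d e N n a (nn : nat -> int) (u : nat -> C) :
  T u -> (0 < d)%N -> (0 < a)%N -> (a + d <= m)%N -> edeg d e = d.-1 ->
  (forall q, nn q = n + mnm_delta k N (mnm_of d e) q) ->
  nfb d e (fun j => u (a + j)%N) *
   (u a ^ (- n) * u (a + d)%N ^ (n - Dg k N d) *
    (\prod_(a <= i < a + d) edge k (u i) (u i.+1) *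
     \prod_(a.+1 <= i < a + d) gapf (N + 1) u i)) =
  \prod_(1 <= q < (nlen d e).+1)
     Hf k (N + 1) (nn q) (a + node d e q.-1) (a + node d e q) u.
Proof.
move=> Tu d0 a0 adm He Hnn.
rewrite (chain_prod rho_gt0 k_gt0 d0 Tu a0 adm); first last.
- by rewrite (nlen_gt0 d e) leqnn.
- by move=> q Hq; rewrite !Hnn mnm_deltaS //; ring.
have ua : u a != 0 by apply: (torus_neq0 rho_gt0 Tu); lia.
have ud : u (a + d)%N != 0 by apply: (torus_neq0 rho_gt0 Tu); lia.
rewrite !Hnn mnm_delta1 // mnm_delta_last // node_last //.
have -> : n + (1 - d%:Z + (node d e (nlen d e).-1)%:Z * (N + 1 - k%:Z) + (e d)%:Z) -
    Dg k (N + 1) (d - node d e (nlen d e).-1) = (e d)%:Z + (n - Dg k N d).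
  have H : (node d e (nlen d e).-1 <= d)%N by apply: (node_le d0); lia.
  by rewrite /Dg -subzn //; ring.
have -> : - (n + - (e 0%N)%:Z) = (e 0%N)%:Z + - n by ring.
rewrite !expfzDr // /nfb addn0 -!exprnP.
have -> : \prod_(1 <= j < d) tauf e (N + 1) u a j =
   \prod_(1 <= j < d) (if (0 < e j)%N then kap (fun j => u (a + j)%N) j * u (a + j)%N ^+ (e j).-1 else 1) *
   \prod_(a.+1 <= i < a + d) gapf (N + 1) u i.
  rewrite -[a.+1]addn1 (big_shift (gapf (N + 1) u)) -big_split /=; apply: eq_big_nat => j Hj.
  have Hj' : (0 < a + j <= m)%N by lia.
  have uj := torus_neq0 rho_gt0 Tu Hj'.
  have kj := kap_neq0 rho_gt0 v_le concave Tu Hj'.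
  rewrite /tauf; case: ifP => ej; last by rewrite mul1r.
  have -> : kap (fun j => u (a + j)%N) j = kap u (a + j).
    by rewrite /kap addnS; congr (_ - u _ - _); lia.
  rewrite /gapf; have -> : (e j)%:Z + 1 - (N + 1) = (e j).-1%:Z + (1 + (1 - (N + 1))).
    by lia.
  rewrite !expfzDr // expr1z -exprnP.
  move: (kap u (a + j)) kj (u (a + j)%N ^+ _) (u (a + j)%N ^ _) => K K0 x y.
  by field.
ring.
Qed.

(** Induction on [e = 2k - N]. The position [a] is arbitrary because the recursion uses the formula
    on blocks at every place of the torus. *)
Lemma closed_form e d n a : (0 < d)%N -> (0 < a)%N -> (a + d <= m)%N ->
  ratr (vsc_rec R k e n d) = d%:R * ct (Hf k ((2 * k)%:Z - e%:Z) n a (a + d)).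
Proof.
elim: e d n a => [|e IHe] d n a d0 a0 adm.
  by rewrite subr0; exact: (closed_form_base rho_gt0 v_le concave k_gt0).
have [s [Hs Hu Hv]] := virt_polyE R d0.
rewrite (vsc_rec_step e n d0 Hs Hv).
set N := (2 * k)%:Z - e.+1%:Z.
have N1 : (2 * k)%:Z - e%:Z = N + 1 by rewrite /N -addn1 PoszD; ring.
rewrite N1 in IHe.
pose nn (t : rat * (nat -> nat)) q := n + mnm_delta k N (mnm_of d t.2) q.
pose P (t : rat * (nat -> nat)) u := \prod_(1 <= q < (nlen d t.2).+1)
     Hf k (N + 1) (nn t q) (a + node d t.2 q.-1) (a + node d t.2 q) u : C.
have nlt (t : rat * (nat -> nat)) q : (0 < q < (nlen d t.2).+1)%N ->
    (node d t.2 q.-1 < node d t.2 q <= d)%N.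
  move=> Hq; rewrite (node_le d0) ?andbT; last by lia.
  by apply: (node_lt d0); lia.
have nP t : nice m rho v (P t).
  apply: nice_prod => // q; rewrite mem_index_iota => Hq.
  by have := nlt t q Hq; move=> Hn; apply: nice_Hf => //; lia.
have E u : T u -> Hf k N n a (a + d) u = \sum_(t <- s) ratr t.1 * P t u.
  move=> Tu; rewrite /Hf addKn.
  have -> : \prod_(a.+1 <= i < a + d) gapf N u i =
      (\prod_(1 <= j < d) u (a + j)%N) * \prod_(a.+1 <= i < a + d) gapf (N + 1) u i.
    rewrite -(big_shift u) addn1 -big_split /=; apply: eq_big_nat => i Hi.
    have ui : u i != 0 by apply: (torus_neq0 rho_gt0 Tu); lia.
    rewrite /gapf; have -> : 1 - N = 1 + (1 - (N + 1)) by ring.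
    by rewrite expfzDr // expr1z -mulrA.
  rewrite (Hu (fun j => u (a + j)%N)) mulr_suml !mulr_sumr.
  apply: eq_big_seq => t ts.
  have /eqP He := allP Hs t ts.
  rewrite /P -(Hf_normal_form Tu d0 a0 adm He (nn := nn t) (n := n)) //.
  move: (nfb _ _ _) (u a ^ _) (u (a + d)%N ^ _) (\prod_(a <= i < _) _) (\prod_(a.+1 <= i < _) _).
  by move=> x y z w y'; ring.
rewrite (ct_ext rho_gt0 E); last by apply/nice_lap/nice_Hf => //; lia.
rewrite ct_sum //; last first.
  by move=> t _; apply/nice_lap/niceM => //; exact: nice_cst.
rewrite mulr_sumr raddf_sum /=; apply: eq_bigr => t _.
rewrite ctZ //; last exact: nice_lap.
rewrite /P (ct_chain_prod rho_gt0 v_le concave k_gt0 d0 _ (nn t) a0 adm) //.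
set S := \prod_(1 <= q < _) vsc_rec R k e _ _.
(* The gap lengths in the closed forms of the factors cancel the denominator [gapprod] of the
   coefficient of [Poly_d]. *)
have SE : ratr S = (gapprod d t.2)%:R * \prod_(1 <= q < (nlen d t.2).+1)
      ct (Hf k (N + 1) (nn t q) (a + node d t.2 q.-1) (a + node d t.2 q)).
  rewrite /S rmorph_prod /gapprod natr_prod -big_split /=; apply: eq_big_nat => q Hq.
  have Hn := nlt t q Hq.
  rewrite (IHe _ _ (a + node d t.2 q.-1)%N); [|lia|lia|lia].
  by congr (_ * ctm _ _ (Hf _ _ _ _ _) _); lia.
rewrite !rmorphM /= fmorphV !rmorph_nat SE.
have g0 : (gapprod d t.2)%:R != 0 :> C by rewrite pnatr_eq0 -lt0n gapprod_gt0.
by move: ((gapprod d t.2)%:R) g0 => G G0; field.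
Qed.

End Torus.
End Recursion.

(** * The left-hand side as a constant term *)

Section Residues.
Variables (R : realType) (k : nat).
Hypothesis k_gt0 : (0 < k)%N.
Variables (t T : nat).
Hypothesis t_gt0 : (0 < t)%N.
Local Notation C := R[i].
Implicit Types (u : nat -> C) (W : (nat -> int) -> Prop) (c : (nat -> int) -> int).

(** Strictly concave, with second difference -2, and larger than every [hh p]. *)
Definition rad (p : nat) : R := (t + T + 1 + p * (T.+1 - p))%:R.
Definition base0 : nat -> C := fun=> 0.
(* The levels are read backwards: position p stands for the coefficient of    *)
(* q^(T - p), on which d/dx + t acts as multiplication by hh p.               *)
Definition hh (p : nat) : C := (t + (T - p))%:R.

Lemma rad_gt0 j : (0 < j <= T)%N -> 0 < rad j.
Proof. by move=> _; rewrite ltr0n; lia. Qed.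

Lemma base0_le j : (j <= T.+1)%N -> ~~ (0 < j <= T)%N ->
  `|base0 j| <= (rad j)%:C%C.
Proof. by move=> _ _; rewrite normr0 rmorph_nat ler0n. Qed.

Lemma rad_concave j : (0 < j <= T)%N -> rad j.-1 + rad j.+1 < 2 * rad j.
Proof.
case: j => // j /andP[_ jT]; rewrite /rad -natrD -natrM ltr_nat /=.
have -> : (T.+1 - j = T - j.+1 + 2)%N by lia.
have -> : (T.+1 - j.+1 = T - j.+1 + 1)%N by lia.
have -> : (T.+1 - j.+2 = T - j.+1)%N by lia.
by move: (T - j.+1)%N => s; nia.
Qed.

Lemma hh_neq0 p : hh p != 0.
Proof. by rewrite pnatr_eq0; lia. Qed.

Lemma hh_lt p : (0 < p <= T)%N -> `|hh p| < (rad p)%:C%C.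
Proof. by move=> Hp; rewrite normr_nat rmorph_nat ltr_nat; lia. Qed.

Local Notation torus := (on_torus T rad base0).
Local Notation ct f := (ctm T rad f base0).
Local Notation deg W c f := (ldeg T rad base0 W c f).
Local Notation nice f := (nice T rad base0 f).
Local Notation wt := (wt T).
Local Hint Resolve rad_gt0 base0_le rad_concave : core.

Definition chain (a b : nat) u : C :=
  \prod_(a <= i < b) edge k (u i) (u i.+1) *
  \prod_(a.+1 <= i < b) gapf k%:Z u i.

(** Explicit poles, at [t] and [t + 1], occur only in the last two positions. Since [hh] is affine,
    they determine the remaining [hh p] through the kernels. *)
Definition kerA (p : nat) u : C :=
  chain p T u * (zeta (hh T) T u * (u p * (u T.-1 ^ (- 1) * zeta (hh T.-1) T.-1 u))).

(* Up to the sign, the coefficient of q^(T - p) in the image of e^(tx) under  *)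
(* the innermost factors, those of index at least n, of the left-hand side.   *)
Definition resV (n p : nat) : C := ct (fun u => u p ^ (- n%:Z) * kerA p u).

Lemma deg_chain W c a b : (0 < a)%N -> (a < b)%N -> (b <= T)%N ->
  (forall om, W om -> forall i, (a <= i <= b)%N -> wt om i <= c om) ->
  (forall om, W om -> forall i, (a < i < b)%N -> wt om i = c om) ->
  deg W (fun om => (k%:Z - 1) * c om) (chain a b).
Proof.
move=> a0 ab bT Hle Heq.
apply: (@ldeg_le _ _ _ _ W _ (fun om =>
   \sum_(i <- index_iota a b) k.-1%:Z * c om +
    \sum_(i <- index_iota a.+1 b) c om * (1 - k%:Z))).
  move=> om Hom; split=> //.
  rewrite !big_const_seq !count_predT !size_iota !iter_addr_0.
  have [h hE] : exists h, b = (a + h.+1)%N by exists (b - a).-1; lia.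
  have -> : (b - a = h.+1)%N by lia.
  have -> : (b - a.+1 = h)%N by lia.
  have -> : k.-1%:Z = k%:Z - 1 by lia.
  rewrite -[_ *+ h.+1]mulr_natl -[_ *+ h]mulr_natl !natz.
  rewrite le_eqVlt; apply/orP; left; apply/eqP.
  by rewrite -(addn1 h) PoszD; ring.
apply: (ldegM rad_gt0); apply: (ldeg_prod rad_gt0) => // i; rewrite mem_index_iota => Hi.
  by apply: (deg_edge _ rad_gt0) => om Hom; rewrite !Hle //; lia.
apply: (@ldeg_le _ _ _ _ W _ (fun om => wt om i * (1 - k%:Z))).
  by move=> om Hom; rewrite Heq //; lia.
apply: (deg_gapf rad_gt0 base0_le rad_concave); first by lia.
by move=> om Hom; rewrite (Heq om Hom i) ?Hle //; lia.
Qed.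

Lemma deg_kerA W c p : (0 < p)%N -> (p < T)%N ->
  (forall om, W om -> forall i, (p <= i <= T)%N -> wt om i <= c om) ->
  (forall om, W om -> forall i, (p < i < T)%N -> wt om i = c om) ->
  (forall om, W om -> 0 <= wt om T /\ 0 <= wt om T.-1) ->
  deg W (fun om => (k%:Z - 1) * c om + wt om p - wt om T.-1) (kerA p).
Proof.
move=> p0 pT Hle Heq Hge.
apply: (@ldeg_le _ _ _ _ W _ (fun om => (k%:Z - 1) * c om +
   (0 + (wt om p * 1 + (wt om T.-1 * (- 1) + 0))))).
  by move=> om Hom; split=> //; lia.
apply: (ldegM rad_gt0); first exact: deg_chain.
apply: (ldegM rad_gt0).
  by apply: (deg_zeta _ rad_gt0); [lia | apply: hh_lt; lia | move=> om /Hge []].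
apply: (ldegM rad_gt0).
  apply: (@ldeg_ext _ _ _ _ _ _ (fun u => u p ^ 1)); first by move=> u _; rewrite expr1z.
  exact: deg_var.
apply: (ldegM rad_gt0); first exact: deg_var.
by apply: (deg_zeta _ rad_gt0); [lia | apply: hh_lt; lia | move=> om /Hge []].
Qed.

Lemma nice_kerA n p : (0 < p)%N -> (p < T)%N ->
  nice (fun u => u p ^ n * kerA p u).
Proof.
move=> p0 pT; apply: (niceM rad_gt0); first exact: nice_var.
by apply: (deg_nice (W := fun=> False) (c := fun om => (k%:Z - 1) * 0 + wt om p - wt om T.-1));
  apply: (@deg_kerA _ (fun=> 0)).
Qed.

(** The total degree is at most [- k + (k - 1) = -1]. *)
Lemma resV_k p : (0 < p)%N -> (p < T)%N -> resV k p = 0.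
Proof.
move=> p0 pT; have wt1 i : (0 < i <= T)%N -> wt (Wtot 1) i = 1 by rewrite /wt => ->.
apply: (@ct_deg0 _ _ _ _ rad_gt0 (eq (Wtot 1))
  (fun om => wt om p * (- k%:Z) + ((k%:Z - 1) * 1 + wt om p - wt om T.-1)) _ (Wtot 1)) => //.
  apply: (ldegM rad_gt0); first exact: deg_var.
  apply: (@deg_kerA _ (fun=> 1)) => // _ <- => [i Hi|i Hi|]; rewrite !wt1 //; lia.
by rewrite !wt1; lia.
Qed.

(** For [n = 0] the integrand contains [u_p] to a positive power; at [p = T - 1] this would be
    cancelled by [u_(T-1)^(-1)]. *)
Lemma resV_0 p : (0 < p)%N -> (p.+1 < T)%N -> resV 0 p = 0.
Proof.
move=> p0 pT; have wp : wt (delta p (- 1)) p = - 1 by rewrite /wt /delta eqxx ifT //; lia.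
have w0 i : i != p -> wt (delta p (- 1)) i = 0.
  by move=> /negbTE ip; rewrite /wt /delta ip if_same.
apply: (@ct_deg0 _ _ _ _ rad_gt0 (eq (delta p (- 1)))
  (fun om => wt om p * (- 0%:Z) + ((k%:Z - 1) * 0 + wt om p - wt om T.-1)) _ (delta p (- 1))) => //.
  apply: (ldegM rad_gt0); first exact: deg_var.
  apply: (@deg_kerA _ (fun=> 0)) => //; first by lia.
  - move=> _ <- i Hi; have [->|ip] := eqVneq i p; first by rewrite wp.
    by rewrite w0.
  - by move=> _ <- i Hi; rewrite w0 //; lia.
  - by move=> _ <-; rewrite !w0 //; lia.
by rewrite wp w0 //; lia.
Qed.

Lemma ct_pow_zeta M i : (0 < i <= T)%N ->
  ct (fun u => u i ^+ M * zeta (hh i) i u) = hh i ^+ M.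
Proof.
move=> Hi; have := ct_zeta rad_gt0 M Hi (hh_lt Hi) (f := fun=> 1) (ldeg_cst T rad base0 _ 1).
rewrite (ct_cst _ rad_gt0) mulr1 => <-; congr (ctm _ _ _ _).
by apply/funext => u; rewrite mul1r.
Qed.

Lemma resV_01 : (1 < T)%N -> resV 0 T.-1 = edge k (hh T.-1) (hh T).
Proof.
move=> T1; have HT : (0 < T <= T)%N by lia.
have HT1 : (0 < T.-1 <= T)%N by lia.
pose F (i : nat) u := (u T ^+ (k.-1 - i) * zeta (hh T) T u) *
   (u T.-1 ^+ i * zeta (hh T.-1) T.-1 u) : C.
have edgeN (x y : C) : y != 0 ->
    edge k x y = \sum_(0 <= i < k) ratr (initp k)`_i * (x ^+ i * y ^+ (k.-1 - i)).
  move=> y0; rewrite edgeE //; apply: eq_big_nat => i Hi.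
  by rewrite subzn; last by lia.
have nzeta i : (0 < i <= T)%N -> nice (zeta (hh i) i).
  by move=> Hi; apply: (deg_zeta _ rad_gt0) => //; exact: hh_lt.
have nF i : nice (F i).
  by apply: (niceM rad_gt0); apply: (niceM rad_gt0);
    do ?[exact: nzeta]; exact: (nice_var _ _ _ _ (Posz _)).
have E u : torus u -> u T.-1 ^ (- 0%:Z) * kerA T.-1 u =
    \sum_(i <- index_iota 0 k) ratr (initp k)`_i * F i u.
  move=> Tu; have uT := torus_neq0 rad_gt0 Tu HT.
  have uT1 := torus_neq0 rad_gt0 Tu HT1.
  rewrite /kerA /chain; have -> : T = T.-1.+1 by lia.
  rewrite big_nat1 big_geq //= mulr1 oppr0 expr0z mul1r.
  have -> : T.-1.+1 = T by lia.
  rewrite edgeN // mulr_suml; apply: eq_bigr => i _; rewrite /F exprN1.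
  move: (zeta _ _ _) (zeta _ _ _) (u T.-1 ^+ _) (u T ^+ _) (ratr _) => z z' x y r.
  by field.
rewrite /resV (ct_ext rad_gt0 E); last by apply/nice_lap/nice_kerA; lia.
rewrite (ct_sum rad_gt0); last first.
  by move=> i _; apply/nice_lap/(niceM rad_gt0) => //; exact: nice_cst.
rewrite edgeN ?hh_neq0 //; apply: eq_bigr => i _; rewrite (ctZ rad_gt0); last exact: nice_lap.
rewrite -(ct_pow_zeta (k.-1 - i) HT); congr (_ * _).
rewrite /F (ct_zeta rad_gt0 i HT1 (hh_lt HT1)) //.
apply: (@ldeg_le _ _ _ _ (Wsup (pred1 T.-1)) _ (fun om => wt om T * (k.-1 - i)%N%:Z + 0)).
  by move=> om Hom; rewrite /wt Hom ?if_same ?mul0r ?addr0 //=; lia.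
apply: (ldegM rad_gt0).
  by apply: (@deg_var _ _ _ _ _ T (Posz _)).
apply: (deg_zeta _ rad_gt0) => //; first exact: hh_lt.
by move=> om Hom; rewrite /wt Hom ?if_same //=; lia.
Qed.

Local Notation L n d := (ratr (vsc R k k%:Z n d) : C).

Lemma vscE n p q : (0 < p)%N -> (p < q)%N -> (q <= T)%N ->
  L n (q - p)%N = (q - p)%:R * ct (Hf k k%:Z n p q).
Proof.
move=> p0 pq qT; rewrite /vsc ifT; last by lia.
have -> : `|(2 * k)%:Z - k%:Z|%N = k by lia.
rewrite (closed_form k_gt0 rad_gt0 base0_le rad_concave _ _ _ p0); [|lia|lia].
by congr (_ * ctm _ _ (Hf _ _ _ _ _) _); lia.
Qed.

Lemma Hf_chain n p q u : (p < q)%N -> u q != 0 -> u p != 0 ->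
  Hf k k%:Z n p q u = u p ^ (- n) * u q ^ (n - (k%:Z - 1)) * chain p q u.
Proof. by move=> *; rewrite /Hf /Dg subrr mul0r subr0. Qed.

(** Cancelling the kernel at [j] separates the chain into a block that represents a structure
    constant and a shorter chain starting at [j]. *)
Lemma chain_cut n p j u : torus u -> (0 < p)%N -> (p < j)%N -> (j < T)%N ->
  kap u j * (u p ^ (- n) * chain p T u) =
  Hf k k%:Z n p j u * (u j ^ (- n) * (chain j T u * u j)).
Proof.
move=> Tu p0 pj jT; have uj : u j != 0 by apply: (torus_neq0 rad_gt0 Tu); lia.
have up : u p != 0 by apply: (torus_neq0 rad_gt0 Tu); lia.
have kj : kap u j != 0 by apply: (kap_neq0 rad_gt0 base0_le rad_concave Tu); lia.
rewrite Hf_chain // /chain.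
rewrite [in LHS](@big_cat_nat _ _ _ j) /=; [|lia|lia].
rewrite [X in _ * (_ * (_ * X))](@big_cat_nat _ _ _ j) /=; [|lia|lia].
rewrite [X in _ * (_ * (_ * (_ * X)))]big_ltn //.
have -> : kap u j * (u p ^ (- n) *
     (\prod_(p <= i < j) edge k (u i) (u i.+1) *
      \prod_(j <= i < T) edge k (u i) (u i.+1) *
      (\prod_(p.+1 <= i < j) gapf k u i * (gapf k u j * \prod_(j.+1 <= i < T) gapf k u i)))) =
   (kap u j * gapf k u j) * (u p ^ (- n) *
     (\prod_(p <= i < j) edge k (u i) (u i.+1) *
      \prod_(j <= i < T) edge k (u i) (u i.+1) *
      (\prod_(p.+1 <= i < j) gapf k u i * \prod_(j.+1 <= i < T) gapf k u i))).
  by move: (gapf k u j) (u p ^ _) => x y; ring.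
have -> : kap u j * gapf k u j = u j ^ (n - (k%:Z - 1)) * u j ^ (- n) * u j.
  rewrite /gapf -expfzDr //; have -> : n - (k%:Z - 1) + - n = 1 - k%:Z by ring.
  by move: (u j ^ _) (kap u j) kj => x y y0; field.
by move: (u p ^ _) (u j ^ _) (u j ^ _) => x y z; ring.
Qed.

Lemma hh_affine p : (p < T)%N ->
  hh p = (T - p)%:R * hh T.-1 - (T - p).-1%:R * hh T.
Proof.
move=> pT; rewrite /hh subnn addn0; have -> : (T - T.-1 = 1)%N by lia.
have [g ->] : exists g, (T - p = g.+1)%N by exists (T - p).-1; lia.
by rewrite /= !natrD -[g.+1%:R]natr1; ring.
Qed.

(** By [gap_identity_rev] and [hh_affine], [u_p - hh p] equals [(T-p)(u_(T-1) - hh (T-1)) -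
    (T-p-1)(u_T - hh T) - \sum_j (j-p) kap_j]. The first two brackets each cancel a pole, and each
    [kap_j] cuts the chain. *)
Lemma kerA_split n p u : torus u -> (0 < p)%N -> (p < T)%N -> (n < k)%N ->
  u p ^ (- n%:Z) * kerA p u =
  hh p * (u p ^ (- n.+1%:Z) * kerA p u) +
  ((T - p)%:R * ((u T ^+ (k.-1 - n) * zeta (hh T) T u) * Hf k k%:Z n p T u) +
  ((- (T - p).-1%:R) * (u p ^ (- n%:Z) * (chain p T u *
       (u T * (u T.-1 ^ (- 1) * zeta (hh T.-1) T.-1 u)))) +
  \sum_(j <- index_iota p.+1 T)
     (- (j - p)%:R) * ((u j ^ (- n%:Z) * kerA j u) * Hf k k%:Z n p j u))).
Proof.
move=> Tu p0 pT nk.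
have HT : (0 < T <= T)%N by lia.
have HT1 : (0 < T.-1 <= T)%N by lia.
have up : u p != 0 by apply: (torus_neq0 rad_gt0 Tu); lia.
have uT := torus_neq0 rad_gt0 Tu HT.
have uT1 := torus_neq0 rad_gt0 Tu HT1.
have [zT zTE] := zetaE rad_gt0 HT (hh_lt HT) Tu.
have [zT1 zT1E] := zetaE rad_gt0 HT1 (hh_lt HT1) Tu.
have -> : \sum_(j <- index_iota p.+1 T)
     (- (j - p)%:R) * ((u j ^ (- n%:Z) * kerA j u) * Hf k k%:Z n p j u) =
   - (\sum_(p.+1 <= j < T) (j - p)%:R * kap u j) * (u p ^ (- n%:Z) * chain p T u *
      (zeta (hh T) T u * (u T.-1 ^ (- 1) * zeta (hh T.-1) T.-1 u))).
  rewrite -sumrN mulr_suml; apply: eq_big_nat => j Hj.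
  have := @chain_cut n%:Z p j u Tu p0; rewrite /kerA.
  move: (zeta _ _ _) (zeta _ _ _) (u T.-1 ^ _) (u p ^ _) (u j ^ _) => x y z w r.
  move: (Hf _ _ _ _ _ _) (chain p T u) (chain j T u) (kap u j) => H c1 c2 K E.
  have {}E : K * (w * c1) = H * (r * (c2 * u j)) by apply: E; lia.
  transitivity (- (j - p)%:R * (H * (r * (c2 * u j))) * (x * (z * y))); first by ring.
  by rewrite -E; ring.
rewrite Hf_chain //.
have -> : u T ^+ (k.-1 - n) * zeta (hh T) T u *
    (u p ^ (- n%:Z) * u T ^ (n%:Z - (k%:Z - 1)) * chain p T u) =
    zeta (hh T) T u * (u p ^ (- n%:Z) * chain p T u).
  have E : u T ^+ (k.-1 - n) * u T ^ (n%:Z - (k%:Z - 1)) = 1.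
    rewrite exprnP -expfzDr // -[RHS](expr0z (u T)); congr (_ ^ _); lia.
  move: (zeta _ _ _) (u p ^ _) (u T ^+ _) (u T ^ _) E => x y z w E.
  transitivity (x * (y * chain p T u) * (z * w)); first by ring.
  by rewrite E mulr1.
have -> : u p ^ (- n.+1%:Z) = u p ^ (- n%:Z) / u p.
  by rewrite -addn1 PoszD opprD expfzDr // exprN1.
rewrite /kerA zTE zT1E exprN1.
have /= := gap_identity_rev u p (T - p).-1.
have -> : (p + (T - p).-1 = T.-1)%N by lia.
have -> : (p + (T - p).-1.+1 = T)%N by lia.
rewrite prednK ?subn_gt0 // => E.
have -> : \sum_(p.+1 <= j < T) (j - p)%:R * kap u j =
  (T - p)%:R * u T.-1 - ((T - p).-1%:R * u T + u p) by rewrite E; ring.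
rewrite (hh_affine pT).
move: (u p ^ _) (chain p T u) (T - p)%:R (T - p).-1%:R => x y z w.
move: (hh T) (hh T.-1) (u p) (u T) (u T.-1) up uT zT uT1 zT1.
move=> h h' a b c a0 b0 bh c0 ch.
field.
by rewrite a0 c0 !subr_eq0 bh ch.
Qed.

(** The constant term of [kerA_split]. Each product factors at its only shared variable, and by
    [vscE] the coefficients [T - p] and [j - p] are the ones that turn blocks into structure
    constants. *)
Lemma resV_rec n p : (0 < p)%N -> (p < T)%N -> (n < k)%N ->
  resV n p = hh p * resV n.+1 p + L n (T - p)%N * hh T ^+ (k.-1 - n) -
    \sum_(p.+1 <= j < T) L n (j - p)%N * resV n j.
Proof.
move=> p0 pT nk; have HT : (0 < T <= T)%N by lia.
have HT1 : (0 < T.-1 <= T)%N by lia.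
pose f1 u := u T ^+ (k.-1 - n) * zeta (hh T) T u : C.
pose f2 u := u p ^ (- n%:Z) * (chain p T u *
       (u T * (u T.-1 ^ (- 1) * zeta (hh T.-1) T.-1 u))) : C.
have df1 P : ~~ P T -> deg (Wsup P) (fun=> 0) f1.
  move=> PT.
  apply: (@ldeg_le _ _ _ _ (Wsup P) _ (fun om => wt om T * (k.-1 - n)%N%:Z + 0)).
    by move=> om Hom; rewrite /wt Hom // if_same mul0r addr0.
  apply: (ldegM rad_gt0); first exact: (@deg_var _ _ _ _ _ T (Posz _)).
  apply: (deg_zeta _ rad_gt0) => //; first exact: hh_lt.
  by move=> om Hom; rewrite /wt Hom // if_same.
have w0 i : i != T -> wt (delta T (- 1)) i = 0.
  by move=> /negbTE iT; rewrite /wt /delta iT if_same.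
have wT : wt (delta T (- 1)) T = - 1 by rewrite /wt /delta eqxx ifT.
have df2 : deg (eq (delta T (- 1))) (fun om => wt om p * (- n%:Z) +
     ((k%:Z - 1) * 0 + (wt om T * 1 + (wt om T.-1 * (- 1) + 0)))) f2.
  apply: (ldegM rad_gt0); first exact: deg_var.
  apply: (ldegM rad_gt0).
    apply: (@deg_chain _ (fun=> 0)) => // _ <- i Hi; last by rewrite w0 //; lia.
    by have [->|iT] := eqVneq i T; rewrite ?wT ?w0.
  apply: (ldegM rad_gt0).
    apply: (@ldeg_ext _ _ _ _ _ _ (fun u => u T ^ 1)); first by move=> u _; rewrite expr1z.
    exact: deg_var.
  apply: (ldegM rad_gt0); first exact: deg_var.
  apply: (deg_zeta _ rad_gt0) => //; first exact: hh_lt.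
  by move=> _ <-; rewrite w0 //; lia.
(* Without the pole at [T] only positive powers of [u_T] remain. *)
have ct2 : ct f2 = 0.
  apply: (ct_deg0 rad_gt0 df2 (om := delta T (- 1))) => //.
  by rewrite wT !w0 //; lia.
have n1 : nice f1 by exact: deg_nice (df1 pred0 isT).
have n2 : nice f2 by exact: deg_nice df2.
have nH q : (p < q)%N -> (q <= T)%N -> nice (Hf k k%:Z n p q).
  by move=> pq qT; apply: (nice_Hf rad_gt0 base0_le rad_concave).
have ct1 : ct (fun u => f1 u * Hf k k%:Z n p T u) = hh T ^+ (k.-1 - n) * ct (Hf k k%:Z n p T).
  rewrite -(ct_pow_zeta _ HT).
  apply: (ct_mul rad_gt0 (P := fun i => i != T) (Q := pred0) (j := T)).
  - by move=> i ->.
  - by apply: df1; rewrite eqxx.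
  - apply: (deg_Hf rad_gt0 base0_le rad_concave) => // om Hom i Hi.
    have iT : (0 < i <= T)%N by lia.
    have pT' : (0 < p <= T)%N by lia.
    by case: Hom => [Hom|[s ->]]; rewrite /wt iT pT' // !Hom.
have ct3 j : (p < j)%N -> (j < T)%N ->
    ct (fun u => (u j ^ (- n%:Z) * kerA j u) * Hf k k%:Z n p j u) =
    resV n j * ct (Hf k k%:Z n p j).
  move=> pj jT.
  apply: (ct_mul rad_gt0 (P := fun i => ~~ (j <= i <= T)%N)
     (Q := fun i => ~~ (p <= i <= j)%N) (j := j)).
  - by move=> i; lia.
  - have w0' om : Wsup (fun i => ~~ (j <= i <= T)%N) om ->
        forall i, (j <= i <= T)%N -> wt om i = 0.
      by move=> Hom i Hi; rewrite /wt Hom ?if_same ?Hi.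
    apply: (@ldeg_le _ _ _ _ (Wsup (fun i => ~~ (j <= i <= T)%N)) _
      (fun om => wt om j * (- n%:Z) + ((k%:Z - 1) * 0 + wt om j - wt om T.-1))).
      by move=> om Hom; rewrite !(w0' om Hom) ?mulr0 ?mul0r //; lia.
    apply: (ldegM rad_gt0); first exact: deg_var.
    apply: (@deg_kerA _ (fun=> 0)) => // [|om Hom i Hi|om Hom i Hi|om Hom].
    + by lia.
    + by rewrite (w0' om).
    + by rewrite (w0' om) //; lia.
    + by rewrite !(w0' om) //; lia.
  - apply: (deg_Hf rad_gt0 base0_le rad_concave) => //; first by lia.
    move=> om Hom i Hi.
    have iT : (0 < i <= T)%N by lia.
    have pT' : (0 < p <= T)%N by lia.
    case: Hom => [Hom|[s ->]]; rewrite /wt iT pT' // !Hom //; lia.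
have nK z j : (p <= j)%N -> (j < T)%N -> nice (fun u => u j ^ z * kerA j u).
  by move=> pj jT; apply: nice_kerA => //; lia.
have nC (a : C) f : nice f -> nice (fun u => a * f u).
  by move=> nf; apply: (niceM rad_gt0) => //; exact: nice_cst.
have nS j : j \in index_iota p.+1 T ->
    nice (fun u => (u j ^ (- n%:Z) * kerA j u) * Hf k k%:Z n p j u).
  rewrite mem_index_iota => Hj.
  by apply: (niceM rad_gt0); [apply: nK; lia | apply: nH; lia].
have nS' : lapprox T rad base0 (fun u => \sum_(j <- index_iota p.+1 T)
     (- (j - p)%:R) * ((u j ^ (- n%:Z) * kerA j u) * Hf k k%:Z n p j u)).
  apply: (lap_sum (f_ := fun j u => (- (j - p)%:R) * ((u j ^ (- n%:Z) * kerA j u) * Hf k k%:Z n p j u))).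
  by move=> j Hj; apply: nice_lap; apply: nC; exact: nS.
have n1H : nice (fun u => f1 u * Hf k k%:Z n p T u) by apply: (niceM rad_gt0) => //; exact: nH.
have nKp z : nice (fun u => u p ^ z * kerA p u) by exact: nK.
rewrite {1}/resV (ct_ext rad_gt0 (fun u Tu => kerA_split Tu p0 pT nk)); last by apply: nice_lap.
rewrite (ctD rad_gt0); first last.
- apply: lapD; first by apply: nice_lap; apply: nC.
  by apply: lapD => //; apply: nice_lap; exact: nC.
- by apply: nice_lap; apply: nC.
rewrite (ctD rad_gt0); first last.
- by apply: lapD => //; apply: nice_lap; exact: nC.
- by apply: nice_lap; apply: nC.
rewrite (ctD rad_gt0) //; last by apply: nice_lap; exact: nC.
rewrite !(ctZ rad_gt0); [|exact: nice_lap..].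
rewrite ct1 ct2 mulr0 add0r -/(resV n.+1 p) -addrA; congr (_ + _).
congr (_ + _); first by rewrite vscE //; ring.
rewrite (ct_sum rad_gt0); last by move=> j Hj; apply: nice_lap; apply: nC; exact: nS.
rewrite -sumrN; apply: eq_big_seq => j Hj; rewrite (ctZ rad_gt0); last by apply: nice_lap; exact: nS.
move: Hj; rewrite mem_index_iota => Hj.
rewrite vscE //; [|lia|lia]; rewrite ct3; [|lia|lia].
by ring.
Qed.

End Residues.

(** * Comparison of the operators *)

Section PowerSeries.
Variable F : fieldType.
Implicit Types (a b : fps F).

Lemma fpsMn a n d : (a *+ n) d = a d *+ n.
Proof. by elim: n => [|n IHn]; rewrite ?mulr0n ?fps0 // !mulrS fpsD IHn. Qed.

Lemma fps_natr n d : (n%:R : fps F) d = if d == 0%N then n%:R else 0.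
Proof. by rewrite fpsMn fps1; case: d => //= d; rewrite mul0rn. Qed.

Lemma fps_theta0 : fps_theta (0 : fps F) = 0.
Proof. by apply/funext => d; rewrite /fps_theta fps0 mulr0. Qed.

Lemma fps_thetaD a b : fps_theta (a + b) = fps_theta a + fps_theta b.
Proof. by apply/funext => d; rewrite /fps_theta !fpsD mulrDr. Qed.

Lemma fps_thetaMn a n : fps_theta (a *+ n) = fps_theta a *+ n.
Proof. by elim: n => [|n IHn]; rewrite ?mulr0n ?fps_theta0 // !mulrS fps_thetaD IHn. Qed.

Lemma fps_theta_sum (I : Type) (r : seq I) (f : I -> fps F) :
  fps_theta (\sum_(i <- r) f i) = \sum_(i <- r) fps_theta (f i).
Proof. by elim/big_rec2: _ => [|i x y _ <-]; rewrite ?fps_theta0 ?fps_thetaD. Qed.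

Lemma fps_divl_coef a b d : a 0%N = 1 ->
  (a^-1 * b) d = b d - \sum_(0 <= i < d) a (d - i)%N * (a^-1 * b) i.
Proof.
move=> a1; have ua : a \is a GRing.unit by rewrite fps_unitE a1 oner_eq0.
have E : b d = (a^-1 * b * a) d by rewrite mulrC mulVKr.
move: E; set g := a^-1 * b => E.
rewrite E fpsM big_ord_recr /= subnn a1 mulr1 addrC big_mkord.
by under [X in _ - X]eq_bigr do rewrite mulrC; rewrite addrK.
Qed.

End PowerSeries.

(** The root count over a ring needs differences of roots to be units; here they are nonzero
    constant series. *)
Lemma uniq_roots_natr m n : uniq_roots [seq (i%:R : fps rat) | i <- iota m n].
Proof.
elim: n m => //= n IHn m; rewrite IHn andbT all_map; apply/allP => i.
rewrite mem_iota => Hi; rewrite /= /diff_roots mulrC eqxx /= -natrB; last by lia.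
by rewrite fps_unitE fps_natr /= pnatr_eq0; lia.
Qed.

Lemma poly_fps_eq0 (p : {poly fps rat}) :
  (forall t, (0 < t)%N -> p.[t%:R] = 0) -> p = 0.
Proof.
move=> Hp; apply/eqP/negPn/negP => p0.
have H : all (root p) [seq (i%:R : fps rat) | i <- iota 1 (size p)].
  by rewrite all_map; apply/allP => i; rewrite mem_iota => Hi; apply/rootP/Hp; lia.
have := max_ring_poly_roots p0 H (uniq_roots_natr _ _).
by rewrite size_map size_iota ltnn.
Qed.

(** * Differential operators and their action on exponentials *)

Section Operators.
Variables (M : lmodType (fps rat)) (D : M -> M) (w : M).
Hypothesis DD : {morph D : x y / x + y}.
Hypothesis D_leibniz : forall a v, D (a *: v) = fps_theta a *: v + a *: D v.
Implicit Types p : {poly fps rat}.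

Definition op_at p : M := \sum_(i < size p) p`_i *: iter i D w.

Lemma op_at_wide n p : (size p <= n)%N -> op_at p = \sum_(i < n) p`_i *: iter i D w.
Proof.
move=> pn; rewrite /op_at (big_ord_widen n (fun i => p`_i *: iter i D w) pn).
rewrite [RHS](bigID (fun i : 'I_n => (i < size p)%N)) /= [X in _ + X]big1 ?addr0 //.
by move=> i; rewrite -leqNgt => H; rewrite nth_default // scale0r.
Qed.

Lemma op_atD p q : op_at (p + q) = op_at p + op_at q.
Proof.
pose n := maxn (size p) (size q).
rewrite (@op_at_wide n (p + q)) ?size_polyD // (@op_at_wide n p) ?leq_maxl //.
rewrite (@op_at_wide n q) ?leq_maxr // -big_split; apply: eq_bigr => i _.
by rewrite coefD scalerDl.
Qed.

Lemma op_atZ a p : op_at (a *: p) = a *: op_at p.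
Proof.
rewrite (@op_at_wide (size p)) ?size_scale_leq // scaler_sumr.
by apply: eq_bigr => i _; rewrite coefZ scalerA.
Qed.

Lemma op_at1 : op_at 1 = w.
Proof. by rewrite /op_at size_poly1 big_ord1 coef1 scale1r. Qed.

(* {poly fps rat} is the ring of differential operators, written with the     *)
(* coefficients on the left, and dpoly is the composition with d/dx.          *)
Definition dpoly p : {poly fps rat} := map_poly (@fps_theta rat) p + p * 'X.

Lemma op_at_dpoly p : op_at (dpoly p) = D (op_at p).
Proof.
have D0 : D 0 = 0 by apply: (addrI (D 0)); rewrite -DD !addr0.
have Dsum n (f : nat -> M) : D (\sum_(i < n) f i) = \sum_(i < n) D (f i).
  by elim: n => [|n IHn]; rewrite ?big_ord0 // !big_ord_recr /= DD IHn.
rewrite op_atD (@op_at_wide (size p) (map_poly _ p)) ?size_poly //.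
rewrite (@op_at_wide (size p).+1 (p * 'X)); last first.
  by rewrite (leq_trans (size_polyMleq _ _)) // size_polyX addn2.
rewrite big_ord_recl coefMX /= scale0r add0r -big_split /=.
rewrite {1}/op_at (Dsum _ (fun i => p`_i *: iter i D w)); apply: eq_bigr => i _.
by rewrite D_leibniz coef_map_id0 ?fps_theta0 // coefMX.
Qed.

End Operators.

(** Evaluation at [t] is the action on [e^(tx)] with the exponential divided out. *)
Lemma dpoly_horner (p : {poly fps rat}) t :
  (dpoly p).[t%:R] = fps_theta p.[t%:R] + t%:R * p.[t%:R].
Proof.
rewrite hornerD hornerMX mulrC; congr (_ + _).
rewrite (horner_coef_wide _ (size_poly _ _)) horner_coef.
rewrite -(big_mkord xpredT (fun i => (map_poly (@fps_theta rat) p)`_i * t%:R ^+ i)).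
rewrite -(big_mkord xpredT (fun i => p`_i * t%:R ^+ i)) fps_theta_sum.
apply: eq_bigr => i _; rewrite coef_map_id0 ?fps_theta0 //.
by rewrite -natrX !mulr_natr fps_thetaMn.
Qed.

Section TwoSides.
Variables (R : realType) (k : nat).

(** Both sides are stated for any module and map [D] so that they can be transported along linear
    maps commuting with [D]: from the ring of operators to [M], and to its values on
    exponentials. *)
Definition virt_op (M : lmodType (fps rat)) (D : M -> M) (w : M) : M :=
  foldr (fun (n : nat) (v : M) => (vsc_gen R k n)^-1 *: D v)
        ((vsc_gen R k k.-1)^-1 *: w) (iota 0 k.-1).

Definition hyper_op (M : lmodType (fps rat)) (D : M -> M) (w : M) : M :=
  iter k.-1 D w - (k%:R * fps_q rat) *:
    foldr (fun (j : nat) (v : M) => k%:R *: D v + j%:R *: v) w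
          (rev (iota 1 k.-1)).

Section Morphism.
Variables (M1 M2 : lmodType (fps rat)) (D1 : M1 -> M1) (D2 : M2 -> M2).
Variable phi : M1 -> M2.
Hypothesis phiD : forall u v, phi (u + v) = phi u + phi v.
Hypothesis phiZ : forall a v, phi (a *: v) = a *: phi v.
Hypothesis phi_D : forall v, phi (D1 v) = D2 (phi v).

Lemma virt_op_morph w : phi (virt_op D1 w) = virt_op D2 (phi w).
Proof.
rewrite /virt_op; elim: (iota _ _) => [|n s IHs] /=; first by rewrite phiZ.
by rewrite phiZ phi_D IHs.
Qed.

Lemma hyper_op_morph w : phi (hyper_op D1 w) = hyper_op D2 (phi w).
Proof.
rewrite /hyper_op -!scaleNr phiD phiZ; congr (_ + _ *: _).
  by elim: k.-1 => //= n IHn; rewrite phi_D IHn.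
by elim: (rev _) => //= j s IHs; rewrite phiD !phiZ phi_D IHs.
Qed.

End Morphism.

(* The action of d/dx on e^(tx) (fps rat).                                    *)
Definition shift_theta t : (fps rat)^o -> (fps rat)^o :=
  fun v => fps_theta v + t%:R * v.

Lemma fps_theta_natr n : fps_theta (n%:R : fps rat) = 0.
Proof.
apply/funext => d; rewrite /fps_theta fps_natr fps0.
by case: eqP => [->|_]; rewrite ?mul0r ?mulr0.
Qed.

Lemma hyper_op_eval t : hyper_op (shift_theta t) 1 =
  (t ^ k.-1)%:R - (k%:R * fps_q rat) * (\prod_(1 <= j < k) (k * t + j))%:R.
Proof.
have Dn n : shift_theta t (n%:R) = (t * n)%:R.
  by rewrite /shift_theta fps_theta_natr add0r natrM.
rewrite /hyper_op; congr (_ - _ *: _).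
  by elim: k.-1 => //= n ->; rewrite Dn expnS.
rewrite (perm_big (rev (iota 1 k.-1))) /=; last first.
  by rewrite perm_sym perm_rev /index_iota subn1.
elim: (rev _) => [|j s IHs] /=; first by rewrite big_nil.
by rewrite big_cons IHs Dn -![_ *: _]/(_ * _) -!natrM -natrD mulnDl mulnA.
Qed.

End TwoSides.

Lemma shift_thetaE t (v : (fps rat)^o) d :
  (shift_theta t v : fps rat) d = (t + d)%:R * v d.
Proof.
rewrite /shift_theta fpsD mulr_natl fpsMn /fps_theta natrD mulrDl addrC.
by rewrite -[v d *+ t]mulr_natl.
Qed.

Section Evaluation.
Variables (R : realType) (k : nat).
Hypothesis k_gt0 : (0 < k)%N.
Local Notation C := R[i].

Section Level.
Variables (t T : nat).
Hypothesis t_gt0 : (0 < t)%N.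
Local Notation resV := (resV R k t T).
Local Notation hh := (hh R t T).

(** At [p = T - g], [resV_rec] is the recursion for the coefficients of a quotient by [vsc_gen], up
    to sign. *)
Lemma virt_step n (w : fps rat) : (n < k)%N ->
  (forall g, (g < T)%N -> ratr (w g) =
     if g == 0%N then t%:R ^+ (k.-1 - n) else - (hh (T - g) * resV n.+1 (T - g))) ->
  forall g, (g < T)%N -> ratr (((vsc_gen R k n)^-1 * w) g) =
     if g == 0%N then t%:R ^+ (k.-1 - n) else - resV n (T - g).
Proof.
move=> nk Hw; elim/ltn_ind => g IHg gT.
rewrite fps_divl_coef // rmorphB /= Hw // rmorph_sum /=.
case: g => [|g] /= in IHg gT *; first by rewrite big_geq // subr0.
rewrite big_nat_recl // subn0 rmorphM /= IHg //=; last by lia.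
have -> : vsc_gen R k n g.+1 = vsc R k k n g.+1 by [].
rewrite (resV_rec R k_gt0 t_gt0 _ _ nk); [|lia|lia].
have -> : (T - (T - g.+1) = g.+1)%N by lia.
have -> : hh T = t%:R by rewrite /hh subnn addn0.
have -> : \sum_((T - g.+1).+1 <= j < T)
     ratr (vsc R k k n (j - (T - g.+1))) * resV n j =
   - \sum_(0 <= i < g)
     ratr (vsc_gen R k n (g.+1 - i.+1)%N * ((vsc_gen R k n)^-1 * w) i.+1).
  rewrite -sumrN [RHS]big_nat_rev /= add0n -[(T - g.+1).+1]add1n big_addn.
  have -> : (T - (T - g.+1) = g.+1)%N by lia.
  rewrite big_add1 /=; apply: eq_big_nat => i Hi.
  rewrite rmorphM /= IHg /=; [|lia|lia].
  rewrite mulrN opprK /vsc_gen ifF; last by lia.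
  by congr (ratr (vsc _ _ _ _ _) * resV _ _); lia.
by ring.
Qed.

Lemma virt_op_coef g : (g < T)%N ->
  ratr ((virt_op R k (shift_theta t) 1 : fps rat) g) =
     if g == 0%N then t%:R ^+ k.-1 else - resV 0 (T - g).
Proof.
pose f (n : nat) (v : (fps rat)^o) := (vsc_gen R k n)^-1 *: shift_theta t v.
suff H j n : (n + j = k.-1)%N -> forall g, (g < T)%N ->
    ratr ((foldr f ((vsc_gen R k k.-1)^-1 *: (1 : (fps rat)^o)) (iota n j) : fps rat) g) =
     if g == 0%N then t%:R ^+ j else - resV n (T - g).
  by apply: (H k.-1 0%N).
elim: j n => [|j IHj] n nj {}g gT /=.
  rewrite -[_ *: _]/(_ * _); have <- : (n = k.-1) by lia.
  rewrite (virt_step (n := n)) //; first by rewrite (_ : (k.-1 - n = 0)%N) //; lia.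
    by lia.
  move=> {}g {}gT; rewrite fps1; case: ifP => [_|g0]; last first.
    have -> : n.+1 = k by lia.
    by rewrite rmorph0 resV_k ?mulr0 ?oppr0 //; lia.
  by rewrite rmorph1 (_ : (k.-1 - n = 0)%N) //; lia.
rewrite /f -[_ *: _]/(_ * _).
rewrite (virt_step (n := n)) //; first by rewrite (_ : (k.-1 - n = j.+1)%N) //; lia.
  by lia.
move=> {}g {}gT; rewrite shift_thetaE rmorphM /= IHj //; last by lia.
rewrite ratr_nat; have -> : (k.-1 - n = j.+1)%N by lia.
case: eqP => [->|_]; first by rewrite addn0 exprS.
rewrite mulrN /hh; have -> : (T - (T - g) = g)%N by lia.
by [].
Qed.

End Level.

Lemma virt_op_eval t : (0 < t)%N ->
  virt_op R k (shift_theta t) 1 = hyper_op k (shift_theta t) 1.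
Proof.
move=> t0; rewrite hyper_op_eval; apply/funext => d.
(* With [T = d + 2] the coefficient of [q^d] sits at position 2, which is [T - 1] for [d = 1] and
   further inside for [d >= 2]. *)
apply: (fmorph_inj (@ratr C)); rewrite /= (@virt_op_coef t d.+2) //.
rewrite fpsD fpsN fps_natr -mulrA mulr_natl mulr_natr !fpsMn /fps_q.
case: d => [|[|d]] /=.
- by rewrite !mul0rn subr0 ratr_nat natrX.
- rewrite subSS subn0 sub0r rmorphN /= (@resV_01 R k k_gt0 t 3 t0) //.
  rewrite -mulrnA ratr_nat; congr (- _).
  rewrite /edge /hh natrM mulrC natr_prod; congr (_ * _).
  apply: eq_big_nat => j Hj; rewrite -!natrM -natrD; congr (_%:R); nia.
- by rewrite !mul0rn subr0 rmorph0 resV_0 ?oppr0 //; lia.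
Qed.

End Evaluation.

Lemma virt_op_hyper (R : realType) (k : nat) : (0 < k)%N ->
  virt_op R k dpoly 1 = hyper_op k dpoly 1.
Proof.
move=> k0; apply/eqP; rewrite -subr_eq0; apply/eqP.
apply: poly_fps_eq0 => t t0.
pose ev (p : {poly fps rat}) : (fps rat)^o := p.[t%:R].
have evD p q : ev (p + q) = ev p + ev q by exact: hornerD.
have evZ a p : ev (a *: p) = a *: ev p by exact: hornerZ.
have ev_D p : ev (dpoly p) = shift_theta t (ev p) by exact: dpoly_horner.
rewrite hornerD hornerN.
rewrite -[_.[_]]/(ev (virt_op R k dpoly 1)) -[X in _ - X]/(ev (hyper_op k dpoly 1)).
rewrite (virt_op_morph R k evZ ev_D) (hyper_op_morph k evD evZ ev_D).
rewrite /ev hornerC virt_op_eval // subrr //.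
Qed.

(* A function w(x) is an element of a left module M over the power series in  *)
(* e^x, on which D acts as d/dx, that is, D is additive and satisfies the     *)
(* Leibniz rule. For M the ring of differential operators and w the identity  *)
(* operator, the equation is the identity of differential operators.          *)
Theorem theorem6 (R : realType) (k : nat) (k_gt0 : (0 < k)%N)
    (M : lmodType (fps rat)) (D : {additive M -> M})
    (D_leibniz : forall (a : fps rat) (v : M),
       D (a *: v) = fps_theta a *: v + a *: D v)
    (w : M) :
  foldr (fun (n : nat) (v : M) => (vsc_gen R k n)^-1 *: D v)
        ((vsc_gen R k k.-1)^-1 *: w)
        (iota 0 k.-1)
  = iter k.-1 D w
    - (k%:R * fps_q rat) *:
        foldr (fun (j : nat) (v : M) => k%:R *: D v + j%:R *: v) w
              (rev (iota 1 k.-1)).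
Proof.
(* Applying operators to [w] intertwines [dpoly] with [D] and sends the identity operator to [w]. *)
pose phi := op_at D w.
have phi_D p : phi (dpoly p) = D (phi p).
  by apply: op_at_dpoly D_leibniz p => x y; rewrite raddfD.
have phiD : forall p q, phi (p + q) = phi p + phi q by exact: op_atD.
have phiZ : forall a p, phi (a *: p) = a *: phi p by exact: op_atZ.
rewrite -[LHS]/(virt_op R k D w) -[RHS]/(hyper_op k D w).
rewrite -(op_at1 D w) -/phi.
rewrite -(virt_op_morph R k phiZ phi_D) -(hyper_op_morph k phiD phiZ phi_D).
by rewrite virt_op_hyper.
Qed.
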